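(* Let $Q(n)$ be the number of $n$-quasigroups of order $4$ on the set $A=\{0,1,2,3\}$. Then for every integer $n\geq 5$, $$Q(n) \leq (3^{n+1} + 1)\,2^{2^{n}+1}.$$
   Context: Let $A=\{0,1,2,3\}$. For a natural number $n$, an $n$-quasigroup (of order $4$) is a pair $(A,q)$ where $q:A^n\to A$ satisfies $q(c)\neq q(c')$ for all $c,c'\in A^n$ that differ in exactly one coordinate. $Q(n)$ denotes the number of different $n$-quasigroups $(A,q)$, i.e. the number of such maps $q$ (not up to equivalence). *)

(* Defs.v *)
From mathcomp Require Import all_boot.

Set Implicit Arguments.
Unset Strict Implicit.
Unset Printing Implicit Defensive.

Local Notation A := 'I_4.

(* Number of coordinates in which two n-tuples over A differ. *)
Definition hamming (n : nat) (c c' : {ffun 'I_n -> A}) : nat :=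
  #|[set i | c i != c' i]|.

Definition is_quasigroup (n : nat) (q : {ffun {ffun 'I_n -> A} -> A}) : bool :=
  [forall c, forall c', (hamming c c' == 1) ==> (q c != q c')].

(* Labelled count: maps are not identified up to equivalence. *)
Definition Q (n : nat) : nat :=
  #|[set q : {ffun {ffun 'I_n -> A} -> A} | is_quasigroup q]|.

(* Main.v *)
(* The values are written as pairs of bits and a quasigroup q is replaced by its graph M, a set of
   points in n+1 coordinates. Call M semilinear if the sum of suitable bits lf (P i) (x i), one
   for each coordinate, is constant on M. Such an M is described by the partitions P i, the constant
   and one function of n bits, so there are at most L n = 3^n 2^(2^n+1) of them with a given
   partition at a given coordinate, and at most 3 L n altogether. It remains to find at most
   2^(2^n+1) codes that are not semilinear.

   A code that is not semilinear and has at least four coordinates has two disjoint leaves, that is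
   blocks X and Y on each of which it depends through a quasigroup K of the form "sum of the bits lf,
   sum of the bits mf plus a connected function of the bits lf", and the induced bijection between
   the values of K on X and on Y does not respect the partitions fst (a mismatch). This is shown by
   induction on the number of coordinates. If all hyperplanes are semilinear, then so is the code,
   because a nonzero mixed difference forces the partitions; the case of four coordinates is a finite
   computation. Otherwise a hyperplane has two mismatched leaves X and Y. On a position with a
   mismatch one of them remains a leaf of the whole code: for two planes this is again a finite
   computation, and connectedness propagates it. The positions at which X, respectively Y, fails to
   be a leaf are governed by balanced functions of the remaining coordinates, and the two kinds of
   failure cannot both occur. So X, say, is a leaf of the code; replacing it by one of its
   coordinates gives a smaller code, whose leaves provide the second leaf.

   A code with a leaf X is determined by the normalised K on X and a smaller code that is not
   semilinear with the partition of K at the root. This gives a recursive bound, explicit for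
   n = 3, 4, 5 and crude for n >= 6. *)

Require Import Defs.
From mathcomp Require Import all_boot zify.
From Stdlib Require Import Classical.

Set Implicit Arguments.
Unset Strict Implicit.
Unset Printing Implicit Defensive.

(** * Four-element sets and Latin squares *)

(** What connectedness buys: change the bits [lf] of coordinates i, j, i, j in turn, each time
    correcting the second bit so that the value of the quasigroup stays in a pair {v, y} from two
    different classes of its partition. The bits [lf] return, and the second bits of both
    coordinates have been flipped exactly if the mixed difference is nonzero. So for a connected
    function all points with value v or y are linked by coordinate moves, and facts about single 4
    by 4 Latin squares, checked by enumeration, spread from one coordinate line to all. What a
    mismatch buys: two elements in one class of a partition lie in different classes of any other
    partition. Hence a pair that arises naturally for one leaf is a pair that can be walked with for
    the other. Why small n is explicit: for n = 5 the recursion yields 8579105280, and 2^33 =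
    8589934592 is allowed. With the plain [2 * L 2] = 576 in place of 288 for three coordinates the
    limit would already be exceeded. *)

Notation V := (bool * bool)%type.

(* The three partitions of [V] into two pairs are indexed by [option bool]: [lf P a] names the pair
   of [a], [mf P a] its place inside that pair, and [dec P] is the inverse encoding. *)
Definition lf (P : option bool) (a : V) : bool :=
  match P with None => a.1 | Some true => a.2 | Some false => a.1 (+) a.2 end.
Definition mf (P : option bool) (a : V) : bool :=
  match P with Some true => a.1 | _ => a.2 end.
Definition dec (P : option bool) (u v : bool) : V :=
  match P with None => (u, v) | Some true => (v, u) | Some false => (u (+) v, v) end.

Lemma lf_dec P u v : lf P (dec P u v) = u.
Proof. by case: P => [[]|] //=; case: u; case: v. Qed.
Lemma mf_dec P u v : mf P (dec P u v) = v.
Proof. by case: P => [[]|]. Qed.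
Lemma dec_lm P a : dec P (lf P a) (mf P a) = a.
Proof. by case: P => [[]|]; case: a => [[] []]. Qed.

Definition vs : seq V := [:: (false, false); (false, true); (true, false); (true, true)].
Lemma mem_vs a : a \in vs. Proof. by case: a => [[] []]. Qed.
Definition vi (a : V) : nat := a.1.*2 + a.2.
Lemma nth_vs (a d : V) : nth d vs (vi a) = a. Proof. by case: a => [[] []]. Qed.
Lemma vi_lt a : vi a < 4. Proof. by case: a => [[] []]. Qed.

(* [all] with a conditional: boolean connectives are strict under vm_compute. *)
Fixpoint lall (T : Type) (p : T -> bool) (s : seq T) : bool :=
  if s is x :: s' then if p x then lall p s' else false else true.
Lemma lallE T (p : T -> bool) s : lall p s = all p s.
Proof. by elim: s => //= x s ->; case: (p x). Qed.

Section Enum.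
Variable (T : eqType) (d : T) (cand : nat -> seq T) (ok : nat -> seq T -> T -> bool).
Fixpoint enumseqs n : seq (seq T) :=
  if n is n'.+1 then
    flatten [seq [seq rcons s x | x <- cand n' & ok n' s x] | s <- enumseqs n']
  else [:: [::]].
Lemma enumseqsP s :
  (forall i, i < size s -> nth d s i \in cand i) ->
  (forall i, i < size s -> ok i (take i s) (nth d s i)) -> s \in enumseqs (size s).
Proof.
elim/last_ind: s => [|s x IH] // hc ho; rewrite size_rcons /=.
apply/flatten_mapP; exists s.
  apply: IH => i hi.
    by have := hc i; rewrite size_rcons nth_rcons hi; apply; rewrite ltnS ltnW.
  have := ho i; rewrite size_rcons nth_rcons hi -cats1 take_cat hi; apply.
  by rewrite ltnS ltnW.
apply/mapP; exists x => //.
have := ho (size s); rewrite size_rcons nth_rcons ltnn eqxx -cats1 take_size_cat //.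
rewrite mem_filter => -> //=.
by have := hc (size s); rewrite size_rcons nth_rcons ltnn eqxx; apply.
Qed.
End Enum.

Definition row4 (g : V -> V) : seq V := [seq g t | t <- vs].
Definition zr : V := (false, false).
Definition disj (p q : seq V) : bool :=
  lall (fun t => nth zr p (vi t) != nth zr q (vi t)) vs.
Definition prm0 (t : V) : seq (seq V) :=
  enumseqs (fun i => if i == vi t then [:: zr] else [seq v <- vs | v != zr])
           (fun i s x => x \notin s) 4.

Lemma row4_nth g t : nth zr (row4 g) (vi t) = g t.
Proof. by case: t => [[] []]. Qed.

Lemma prm0P t (g : V -> V) :
  injective g -> (forall u, (g u == zr) = (u == t)) -> row4 g \in prm0 t.
Proof.
move=> gi gz.
have E : size (row4 g) = 4 by [].
rewrite /prm0 -{1}E; apply: (@enumseqsP _ zr).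
- move=> i; rewrite E => hi.
  have -> : nth zr (row4 g) i = g (nth zr vs i).
    by rewrite (nth_map zr).
  have -> : (i == vi t) = (nth zr vs i == t).
    by move: i hi t {E gz} => [|[|[|[|i]]]] // _ [[] []].
  rewrite -gz; case: ifP => [/eqP->|h]; first by rewrite mem_seq1.
  by rewrite mem_filter h mem_vs.
move=> i; rewrite E => hi.
have u : uniq (row4 g) by rewrite map_inj_uniq.
by rewrite in_take ?mem_nth // index_uniq // ltnn.
Qed.

Definition sq (L : V -> V -> V) : seq (seq V) := [seq row4 (L r) | r <- vs].
Definition at2 (s : seq (seq V)) (r t : V) : V := nth zr (nth [::] s (vi r)) (vi t).
(** The Latin squares with [zr] exactly on the diagonal. In the applications [zr] marks membership
    in a fixed hyperplane of the code, and rows and columns are indexed by the two values that have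
    to coincide for it. *)
Definition zsq : seq (seq (seq V)) :=
  enumseqs (fun i => prm0 (nth zr vs i)) (fun i s x => all (disj x) s) 4.

Lemma at2_sq L r t : at2 (sq L) r t = L r t.
Proof. by case: r => [[] []]; case: t => [[] []]. Qed.

Lemma sqP L :
  (forall r t, (L r t == zr) = (t == r)) -> (forall r, injective (L r)) ->
  (forall t, injective (L^~ t)) -> sq L \in zsq.
Proof.
move=> hz hr hc.
have E : size (sq L) = 4 by [].
have N i : i < 4 -> nth [::] (sq L) i = row4 (L (nth zr vs i)).
  by move=> hi; rewrite (nth_map zr).
rewrite /zsq -{1}E; apply: (@enumseqsP _ [::]) => i; rewrite E => hi.
  by rewrite N //; apply: prm0P.
apply/allP => x /(nthP [::]) [j]; rewrite size_takel ?E; last exact: ltnW.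
move=> hj <-.
rewrite nth_take // !N ?(ltn_trans hj hi) // /disj lallE; apply/allP => t _.
rewrite !row4_nth; apply/eqP => /hc /eqP; rewrite nth_uniq //.
- by rewrite eq_sym (ltn_eqF hj).
- by rewrite (ltn_trans hj).
Qed.

Definition rowe t (s s' : seq (seq V)) := all (fun c => at2 s t c == at2 s' t c) vs.
Definition cole t (s s' : seq (seq V)) := all (fun c => at2 s c t == at2 s' c t) vs.
Definition iso t u s :=
  all (fun s' => if rowe t s s' then if cole u s s' then s' == s else true else true) zsq.
Definition parts : seq (option bool) := [:: None; Some true; Some false].
Lemma mem_parts P : P \in parts. Proof. by case: P => [[]|]. Qed.

(** Two facts about squares sharing row [t]. Sharing column [t] as well forces equality. And if
    neither square is determined by row [t] together with a column outside the pair of [t], which is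
    what [iso] expresses, then they also share the row of the partner of [t]. *)
Definition factI : bool :=
  all (fun s => all (fun t => all (fun s' =>
    if rowe t s s' then
      if (if cole t s s' then s == s' else true) then
        all (fun P => all (fun t' =>
          if lf P t == lf P t' then
            if all (fun u => if lf P t == lf P u then true
                             else if iso t u s then false else ~~ iso t u s') vs
            then rowe t' s s' else true
          else true) vs) parts
      else false
    else true) zsq) vs) zsq.
Lemma factIP : factI. Proof. by vm_compute. Qed.

Definition swi v y s :=
  has (fun s' => if rowe v s s' then if rowe y s s' then s' != s else false else false) zsq.
Definition factD1 : bool :=
  all (fun s => all (fun v => all (fun s' => if rowe v s s' then
    all (fun y => if v == y then true else if rowe y s s' then
      if s == s' then true else if cole v s s' then false else ~~ cole y s s'
      else true) vs else true) zsq) vs) zsq.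
Lemma factD1P : factD1. Proof. by vm_compute. Qed.

(** [swi v y s] says that [s] has a different square with the same rows [v] and [y]. Such squares
    are so special that a common column forces the companion column on the same side of {[v], [y]};
    this lets a column be carried from one class of a partition to the other. *)
Definition factD2 : bool :=
  all (fun v => all (fun y => if v == y then true else
    let z := [seq s <- zsq | swi v y s] in
    all (fun s => all (fun s' => all (fun a => if cole a s s' then all (fun b =>
      if ((a == v) || (a == y)) == ((b == v) || (b == y)) then cole b s s' else true) vs
      else true) vs) z) z) vs) vs.
Lemma factD2P : factD2. Proof. by vm_compute. Qed.

Lemma other_pair P s v y : s != v -> s != y -> lf P v != lf P y ->
  exists2 s', lf P s != lf P s' & (s' != v) && (s' != y).
Proof.
move=> sv sy ne.
suff /hasP[s' _ /andP[]] : has (fun s' => (lf P s != lf P s') && ((s' != v) && (s' != y))) vs.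
  by exists s'.
by case: P ne => [[]|]; case: s sv sy => [[] []]; case: v => [[] []]; case: y => [[] []].
Qed.

(** * Functions along the lines of a block *)

Section Lines.
Variables (T : Type) (dom : T -> Prop) (K : T -> V) (line : (V -> T) -> Prop).

Definition good (g : T -> V) :=
  forall b b', dom b -> dom b' -> K b = K b' -> g b = g b'.

(** Exactly the conditions under which the values of [f] along a line form a square in [zsq]. *)
Definition fam (f : V -> T -> V) :=
  [/\ forall r b, dom b -> (f r b == zr) = (K b == r),
      forall b, dom b -> injective (f^~ b) &
      forall m r, line m -> injective (fun t => f r (m t))].

(** [lconn] is connectedness of the graph of lines in which two lines are adjacent when they have
    the same point at [v] or the same point at [y]. It is phrased by invariant predicates, so that
    no paths have to be handled. *)
Record linespace (P : option bool) := Linespace {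
  lineK : forall m t, line m -> K (m t) = t;
  lined : forall m t, line m -> dom (m t);
  cover : forall b, dom b -> exists2 m, line m & m (K b) = b;
  lconn : forall v y, lf P v != lf P y -> forall Pi : (V -> T) -> Prop,
    (forall m m', line m -> line m' -> m v = m' v -> Pi m -> Pi m') ->
    (forall m m', line m -> line m' -> m y = m' y -> Pi m -> Pi m') ->
    forall m m', line m -> line m' -> Pi m -> Pi m' }.

Arguments lined {P} l {m} t.
Arguments lineK {P} l {m} t.
Arguments cover {P} l {b}.
Arguments lconn {P} l {v y} _ Pi.

Variables (P : option bool) (LS : linespace P).

Definition lsq (f : V -> T -> V) (m : V -> T) := sq (fun r t => f r (m t)).

Lemma lsqP f m : fam f -> line m -> lsq f m \in zsq.
Proof.
move=> [fz fi fl] lm; apply: sqP => [r t|r|t]; last exact: fi (lined LS t lm).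
  by rewrite fz; [rewrite (lineK LS) | exact: (lined LS t lm)].
exact: fl.
Qed.

Lemma roweP t f m f' m' :
  reflect (forall c, f t (m c) = f' t (m' c)) (rowe t (lsq f m) (lsq f' m')).
Proof.
apply: (iffP allP) => [h c|h c _]; last by rewrite !at2_sq h.
by have /eqP := h c (mem_vs c); rewrite !at2_sq.
Qed.
Lemma coleP t f m f' m' :
  reflect (forall c, f c (m t) = f' c (m' t)) (cole t (lsq f m) (lsq f' m')).
Proof.
apply: (iffP allP) => [h c|h c _]; last by rewrite !at2_sq h.
by have /eqP := h c (mem_vs c); rewrite !at2_sq.
Qed.
Lemma lsq_eqP f m f' m' : lsq f m = lsq f' m' -> forall c t, f c (m t) = f' c (m' t).
Proof. by move=> e c t; have := congr1 (fun s => at2 s c t) e; rewrite !at2_sq. Qed.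

Lemma goodP g : (forall m m' t, line m -> line m' -> g (m t) = g (m' t)) -> good g.
Proof.
move=> h b b' db db' e; have [m lm mb] := cover LS db.
by have [m' lm' mb'] := cover LS db'; rewrite -mb -mb' -e; apply: h.
Qed.
Lemma good_line g m m' t : good g -> line m -> line m' -> g (m t) = g (m' t).
Proof.
by move=> gg lm lm'; apply: gg; rewrite ?(lineK LS) //; apply: (lined LS).
Qed.

(** All squares share row [t]. If a column [u] outside the class of [t] isolates one of them, this
    square is the same on every line: lines meeting at [t] agree by the first half of [factI], lines
    meeting at [u] by isolation. If no such column exists, the second half of [factI] applies
    directly. *)
Lemma good_partner f t t' : fam f -> lf P t = lf P t' -> good (f t) -> good (f t').
Proof.
move=> ff et gt; apply: goodP => m m' s lm lm'.
have R m1 m2 : line m1 -> line m2 -> rowe t (lsq f m1) (lsq f m2).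
  by move=> l1 l2; apply/roweP => c; exact: (good_line c gt l1 l2).
have F m1 m2 (l1 : line m1) (l2 : line m2) :
    (cole t (lsq f m1) (lsq f m2) -> lsq f m1 = lsq f m2) /\
    (forall t', lf P t = lf P t' ->
      (forall u, lf P t <> lf P u -> ~~ iso t u (lsq f m1) /\ ~~ iso t u (lsq f m2)) ->
      rowe t' (lsq f m1) (lsq f m2)).
  have /allP/(_ _ (lsqP ff l1))/allP/(_ _ (mem_vs t))/allP/(_ _ (lsqP ff l2)) := factIP.
  rewrite R //; case: ifP => // h1 h2; split=> [c|u eu hu].
    by move: h1; rewrite c => /eqP.
  have /allP/(_ _ (mem_vs u)) := allP h2 P (mem_parts P).
  rewrite eu eqxx; case: ifP => // /allP[] v _; case: eqP => // ne.
  by have [/negbTE->] := hu v (fun e => ne (etrans (esym eu) e)).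
case: (boolP (has (fun u => (lf P t != lf P u) && iso t u (lsq f m)) vs)).
  case/hasP => u _ /andP[ne iu].
  suff e : lsq f m = lsq f m' by rewrite (lsq_eqP e).
  apply: (lconn LS ne (fun m' => lsq f m = lsq f m')) lm lm' (erefl _) => m1 m2 l1 l2 e E.
    by have [F1 _] := F _ _ l1 l2; rewrite E; apply: F1; apply/coleP => c; rewrite e.
  apply/esym/eqP; move: iu; rewrite E => /allP/(_ _ (lsqP ff l2)).
  by rewrite R //; case: ifP => // /negP[]; apply/coleP => c; rewrite e.
move/hasPn => h.
case: (boolP (has (fun u => (lf P t != lf P u) && iso t u (lsq f m')) vs)).
  case/hasP => u _ /andP[ne iu].
  suff e : lsq f m' = lsq f m by rewrite (lsq_eqP e).
  apply: (lconn LS ne (fun m => lsq f m' = lsq f m)) lm' lm (erefl _) => m1 m2 l1 l2 e E.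
    by have [F1 _] := F _ _ l1 l2; rewrite E; apply: F1; apply/coleP => c; rewrite e.
  apply/esym/eqP; move: iu; rewrite E => /allP/(_ _ (lsqP ff l2)).
  by rewrite R //; case: ifP => // /negP[]; apply/coleP => c; rewrite e.
move/hasPn => h'.
have [_ F2] := F m m' lm lm'; have /roweP H : rowe t' (lsq f m) (lsq f m'); last exact: H.
apply: F2 => // u ne.
have k b : ~~ ((lf P t != lf P u) && b) -> ~~ b.
  by rewrite negb_and negbK => /orP[/eqP|].
by split; apply: k; [apply: h | apply: h']; apply: mem_vs.
Qed.

(** If the squares of [f] and [f'] differ on one line they differ on all: by [factD1] distinct
    squares with common rows [v], [y] differ in the columns [v] and [y], and adjacent lines share
    one of these. Then every square of [f] is switchable, and walking with two elements on the same
    side of {[v], [y]} makes all columns constant, so that every [f t] is good. *)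
Lemma fam_determined f f' v y :
  fam f -> fam f' -> lf P v != lf P y ->
  (forall b, dom b -> f v b = f' v b) -> (forall b, dom b -> f y b = f' y b) ->
  ~ (forall t, good (f t)) -> forall t b, dom b -> f t b = f' t b.
Proof.
move=> ff ff' ne ev ey ng.
have vy : (v == y) = false by apply: contraNF ne => /eqP->.
suff S m : line m -> lsq f m = lsq f' m.
  move=> t b db; have [m lm <-] := cover LS db.
  by rewrite (lsq_eqP (S m lm)).
move=> lm; apply/eqP/negP => /negP nem; apply: ng.
have Rv m1 : line m1 -> rowe v (lsq f m1) (lsq f' m1).
  by move=> l1; apply/roweP => c; apply: ev; apply: (lined LS).
have Ry m1 : line m1 -> rowe y (lsq f m1) (lsq f' m1).
  by move=> l1; apply/roweP => c; apply: ey; apply: (lined LS).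
have D m1 : line m1 -> lsq f m1 != lsq f' m1.
  have X m2 : line m2 -> lsq f m2 != lsq f' m2 ->
     ~~ cole v (lsq f m2) (lsq f' m2) /\ ~~ cole y (lsq f m2) (lsq f' m2).
    move=> l2 n2; have /allP/(_ _ (lsqP ff l2))/allP/(_ _ (mem_vs v))/allP/(_ _ (lsqP ff' l2)) := factD1P.
    rewrite Rv // => /allP/(_ _ (mem_vs y)); rewrite vy Ry // (negbTE n2).
    by case: ifP.
  move=> l1; apply: (lconn LS ne (fun m' => lsq f m' != lsq f' m')) lm l1 nem => m2 m3 l2 l3 e n2.
    have [+ _] := X _ l2 n2; apply: contraNN => /eqP E; apply/coleP => c.
    by rewrite e (lsq_eqP E).
  have [_] := X _ l2 n2; apply: contraNN => /eqP E; apply/coleP => c.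
  by rewrite e (lsq_eqP E).
have W m1 : line m1 -> lsq f m1 \in [seq s <- zsq | swi v y s].
  move=> l1; rewrite mem_filter lsqP // andbT; apply/hasP.
  by exists (lsq f' m1); rewrite ?lsqP // Rv // Ry // eq_sym D.
have C a b m1 m2 : line m1 -> line m2 -> cole a (lsq f m1) (lsq f m2) ->
    ((a == v) || (a == y)) = ((b == v) || (b == y)) -> cole b (lsq f m1) (lsq f m2).
  move=> l1 l2 ca ab; have /allP/(_ _ (mem_vs v))/allP/(_ _ (mem_vs y)) := factD2P.
  rewrite vy => /allP/(_ _ (W _ l1))/allP/(_ _ (W _ l2))/allP/(_ _ (mem_vs a)).
  by rewrite ca => /allP/(_ _ (mem_vs b)); rewrite ab eqxx.
have G a a' : lf P a != lf P a' -> ((a == v) || (a == y)) = ((a' == v) || (a' == y)) ->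
   forall m1 m2, line m1 -> line m2 -> cole a (lsq f m1) (lsq f m2).
  move=> na ea m1 m2 l1 l2.
  apply: (lconn LS na (fun m' => cole a (lsq f m1) (lsq f m'))) l1 l2 _.
  - move=> m3 m4 l3 l4 e /coleP h; apply/coleP => c; by rewrite h e.
  - move=> m3 m4 l3 l4 e /coleP h; apply/coleP => c; rewrite h.
    have /coleP : cole a (lsq f m3) (lsq f m4); last exact.
    by apply: (C a') => //; apply/coleP => d; rewrite e.
  - by apply/coleP.
move=> t; apply: goodP => m1 m2 s l1 l2.
have [s' ns es] : exists2 s', lf P s != lf P s' & ((s == v) || (s == y)) = ((s' == v) || (s' == y)).
  case: (s =P v) => [->|/eqP sv]; first by exists y; rewrite // eqxx orbT.
  case: (s =P y) => [->|/eqP sy]; first by exists v; rewrite 1?eq_sym // eqxx.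
  have [s' n1 /andP[/negbTE e1 /negbTE e2]] := other_pair sv sy ne.
  by exists s'; rewrite // ?(negbTE sv) ?(negbTE sy) ?e1 ?e2.
by have /coleP := G s s' ns es m1 m2 l1 l2.
Qed.
End Lines.
Arguments lined {T dom K line P} l {m} t.
Arguments lineK {T dom K line P} l {m} t.
Arguments cover {T dom K line P} l {b}.
Arguments lconn {T dom K line P} l {v y} _ Pi.

(** * Points, faces and connected bit functions *)

Section Points.
Variable I : finType.
Notation pt := {ffun I -> V}.
Notation bt := {ffun I -> bool}.
Implicit Types (x y c : pt) (l : bt) (F : {set I}).

Definition upd x (i : I) (a : V) : pt := [ffun j => if j == i then a else x j].
Definition mix F x y : pt := [ffun j => if j \in F then x j else y j].
Definition agree (T : eqType) F (c x : {ffun I -> T}) := forall i, i \notin F -> x i = c i.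

Lemma updE x i a j : upd x i a j = if j == i then a else x j. Proof. by rewrite ffunE. Qed.
Lemma mixE F x y j : mix F x y j = if j \in F then x j else y j. Proof. by rewrite ffunE. Qed.
Lemma upd_eq x i : upd x i (x i) = x.
Proof. by apply/ffunP => j; rewrite updE; case: eqP => [->|]. Qed.
Lemma upd_upd x i a b : upd (upd x i a) i b = upd x i b.
Proof. by apply/ffunP => j; rewrite !updE; case: eqP. Qed.
Lemma updC x i j a b : i != j -> upd (upd x i a) j b = upd (upd x j b) i a.
Proof.
move=> ne; apply/ffunP => k; rewrite !updE; case: (k =P j) => // ->.
by rewrite eq_sym (negbTE ne).
Qed.
Lemma agree_upd F c x i a : i \in F -> agree F c x -> agree F c (upd x i a).
Proof. by move=> iF h j jF; rewrite updE; case: eqP => [e|_]; [rewrite e iF in jF | apply: h]. Qed.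
Lemma agree_refl (T : eqType) F (c : {ffun I -> T}) : agree F c c. Proof. by []. Qed.
Lemma agree_mix F x c : agree F c (mix F x c).
Proof. by move=> i iF; rewrite mixE (negbTE iF). Qed.

Definition sumb F (g : I -> bool) : bool := \big[addb/false]_(i in F) g i.
Lemma sumbD1 F g i : i \in F -> sumb F g = g i (+) sumb (F :\ i) g.
Proof.
move=> iF; rewrite /sumb (bigD1 i) //=; congr addb.
by apply: eq_bigl => j; rewrite !inE andbC.
Qed.
Lemma eq_sumb F g h : {in F, g =1 h} -> sumb F g = sumb F h.
Proof. by move=> e; apply: eq_bigr => i; apply: e. Qed.

Definition flipb l i : bt := [ffun j => if j == i then ~~ l j else l j].
Definition dd (be : bt -> bool) i j l : bool :=
  be l (+) be (flipb l i) (+) be (flipb l j) (+) be (flipb (flipb l i) j).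

(* [dd be i j] is the mixed second difference; [be] is connected on [F] if, for no proper nonempty
   subset [U], it is a sum of a function of the bits in [U] and a function of those in [F :\: U]. *)
Definition conn (be : bt -> bool) F (l0 : bt) :=
  forall U : {set I}, U \subset F -> U != set0 -> U != F ->
  exists i j l, [/\ i \in U, j \in F :\: U, agree F l0 l & dd be i j l].

Variable P : I -> option bool.
Definition bits x : bt := [ffun i => lf (P i) (x i)].

Lemma bits_upd x i a : bits (upd x i a) = if lf (P i) a == bits x i then bits x else flipb (bits x) i.
Proof.
case: eqP => h; apply/ffunP => j; rewrite !ffunE.
  by case: (j =P i) => // ->; rewrite h ffunE.
case: (j =P i) => // ->; move/eqP: h; rewrite ffunE.
by case: (lf _ a); case: (lf _ _).
Qed.

Section Walk.
Variables (F F0 : {set I}) (c : pt) (ga : bt -> bool).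
Hypothesis sF : F0 \subset F.
Definition surf x := agree F0 c x /\ sumb F (fun i => mf (P i) (x i)) = ga (bits x).

(** The two elementary moves: [fm] flips only the second bit and so leaves the surface when [i] is
    in [F], whereas [stp] flips the bit [lf] and corrects the second bit to stay on it. *)
Definition fm x i : pt := upd x i (dec (P i) (lf (P i) (x i)) (~~ mf (P i) (x i))).
Definition stp x i : pt :=
  upd x i (dec (P i) (~~ lf (P i) (x i))
             (mf (P i) (x i) (+) (ga (bits x) (+) ga (flipb (bits x) i)))).

Lemma bits_fm x i : bits (fm x i) = bits x.
Proof. by rewrite bits_upd lf_dec ffunE eqxx. Qed.
Lemma bits_stp x i : bits (stp x i) = flipb (bits x) i.
Proof. by rewrite bits_upd lf_dec ffunE; case: (lf _ _). Qed.
Lemma flipbK l i : flipb (flipb l i) i = l.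
Proof. by apply/ffunP => j; rewrite !ffunE; case: eqP => // _; rewrite negbK. Qed.
Lemma flipbC l i j : flipb (flipb l i) j = flipb (flipb l j) i.
Proof. by apply/ffunP => k; rewrite !ffunE; case: eqP; case: eqP. Qed.

Lemma ptP x y : bits x = bits y -> (forall i, mf (P i) (x i) = mf (P i) (y i)) -> x = y.
Proof.
move=> /ffunP hb hm; apply/ffunP => i.
by rewrite -(dec_lm (P i) (x i)) -(dec_lm (P i) (y i)) hm; have := hb i; rewrite !ffunE => ->.
Qed.
Lemma m_fm x i j : mf (P j) (fm x i j) = mf (P j) (x j) (+) (j == i).
Proof. by rewrite updE; case: eqP => [->|_]; rewrite ?mf_dec ?addbT ?addbF. Qed.
Lemma m_stp x i j : mf (P j) (stp x i j) =
  mf (P j) (x j) (+) ((j == i) && (ga (bits x) (+) ga (flipb (bits x) i))).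
Proof. by rewrite updE; case: eqP => [->|_]; rewrite ?mf_dec ?addbF. Qed.

Lemma fmK x i : fm (fm x i) i = x.
Proof. by apply: ptP => [|j]; rewrite ?bits_fm // !m_fm addbK. Qed.
Lemma stpK x i : stp (stp x i) i = x.
Proof.
apply: ptP => [|j]; rewrite ?bits_stp ?flipbK // !m_stp bits_stp flipbK.
by rewrite [ga _ (+) ga (bits x)]addbC addbK.
Qed.
Lemma stp_fm x i j : stp (fm x i) j = fm (stp x j) i.
Proof.
apply: ptP => [|k]; first by rewrite bits_stp !bits_fm bits_stp.
by rewrite m_stp !m_fm m_stp !bits_fm addbAC.
Qed.

Lemma surf_stp x i : i \in F0 -> surf x -> surf (stp x i).
Proof.
move=> i0 [ha hs]; split; first exact: agree_upd.
have iF := subsetP sF _ i0.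
rewrite bits_stp -[ga (flipb _ _)](addKb (ga (bits x))) -{1}hs.
rewrite (sumbD1 _ iF) [in RHS](sumbD1 _ iF) m_stp eqxx /=.
rewrite (@eq_sumb (F :\ i) _ (fun i => mf (P i) (x i))); last first.
  by move=> j; rewrite !inE => /andP[/negbTE ne _]; rewrite m_stp ne addbF.
by rewrite addbAC -!addbA.
Qed.
Lemma surf_fm2 x i j : i \in F0 -> j \in F0 -> surf x -> surf (fm (fm x i) j).
Proof.
move=> i0 j0 [ha hs]; split; first by do 2!apply: agree_upd => //.
rewrite !bits_fm -hs; have iF := subsetP sF _ i0; have jF := subsetP sF _ j0.
have S z k : k \in F -> sumb F (fun i => mf (P i) (fm z k i)) = ~~ sumb F (fun i => mf (P i) (z i)).
  move=> kF; rewrite !(sumbD1 _ kF) m_fm eqxx addbT -addNb; congr addb.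
  by apply: eq_sumb => u; rewrite !inE m_fm => /andP[/negbTE-> _]; rewrite addbF.
by rewrite !S // negbK.
Qed.

Variable R : pt -> Prop.
Hypothesis Rstep : forall x y i a, i \in F0 -> surf x -> surf y -> y = upd x i a -> R x -> R y.

Lemma Rstp x i : i \in F0 -> surf x -> R x -> R (stp x i).
Proof. by move=> i0 sx; apply: (Rstep i0 sx (surf_stp i0 sx) (erefl _)). Qed.

(** The four steps i, j, i, j restore the bits [lf], and each of the two second bits has changed by
    the mixed difference, which is 1 here. *)
Lemma Rsquare x i j : i \in F0 -> j \in F0 -> surf x -> dd ga i j (bits x) ->
  R x -> R (fm (fm x i) j).
Proof.
move=> i0 j0 sx hd rx.
have ne : i != j.
  by apply: contraTneq hd => ->; rewrite /dd flipbK addbK addbb.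
have -> : fm (fm x i) j = stp (stp (stp (stp x i) j) i) j.
  apply: ptP => [|k].
    by rewrite !bits_fm !bits_stp [flipb (flipb _ i) j]flipbC flipbK flipbK.
  rewrite !m_fm !m_stp !bits_stp [flipb (flipb _ i) j]flipbC flipbK flipbK.
  move: hd ne; rewrite /dd [flipb (flipb _ i) j]flipbC; have [->|ni] := eqVneq k i.
    move=> + /negbTE ->.
    by move: (mf _ _) (ga (bits x)) (ga (flipb (bits x) i)) (ga (flipb (bits x) j)) (ga (flipb (flipb (bits x) j) i)) => [] [] [] [] [].
  have [->|nj] := eqVneq k j.
    by move: (mf _ _) (ga (bits x)) (ga (flipb (bits x) i)) (ga (flipb (bits x) j)) (ga (flipb (flipb (bits x) j) i)) => [] [] [] [] [].
  by rewrite /= !addbF.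
have s1 := surf_stp i0 sx; have s2 := surf_stp j0 s1; have s3 := surf_stp i0 s2.
exact: Rstp j0 s3 (Rstp i0 s2 (Rstp j0 s1 (Rstp i0 sx rx))).
Qed.

Definition Eq i j := forall x, surf x -> R x -> R (fm (fm x i) j).

(* The flip at a distant position is obtained by walking there, flipping, and walking back. *)
Lemma Eq_dd i j l : i \in F0 -> j \in F0 -> agree F0 (bits c) l -> dd ga i j l -> Eq i j.
Proof.
move=> i0 j0 hl hd x.
have [n] := ubnP #|[set k | l k != bits x k]|; elim: n x => // n IH x hn sx rx.
case: (pickP (fun k => l k != bits x k)) => [k hk|h]; last first.
  apply: Rsquare => //; suff <- : l = bits x by [].
  by apply/ffunP => k; apply/eqP; have := h k; move/negbFE.
have k0 : k \in F0.
  apply: contraNT hk => nk; rewrite hl // !ffunE; have [ha _] := sx.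
  by rewrite ha.
have -> : fm (fm x i) j = stp (fm (fm (stp x k) i) j) k by rewrite !stp_fm stpK.
apply: (Rstp k0); first exact: (surf_fm2 i0 j0 (surf_stp k0 sx)).
apply: IH; [ | exact: surf_stp | exact: Rstp].
rewrite ltnS in hn; apply: leq_trans hn; rewrite bits_stp; apply: proper_card; apply/properP; split.
  by apply/subsetP => u; rewrite !inE [flipb _ _ _]ffunE; have [->|_] := eqVneq u k.
exists k; first by rewrite inE.
by rewrite inE [flipb _ _ _]ffunE eqxx; move: hk; case: (l k); case: (bits x k).
Qed.

Lemma Eq_trans i j k : i \in F0 -> j \in F0 -> k \in F0 -> Eq i j -> Eq j k -> Eq i k.
Proof.
move=> i0 j0 k0 e1 e2 x sx rx.
have := e2 _ (surf_fm2 i0 j0 sx) (e1 x sx rx).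
by rewrite fmK.
Qed.

Hypothesis cF : conn ga F0 (bits c).

(** The indices reachable from [i] through nonzero mixed differences form a set [U]; if it were not
    all of [F0], connectedness would give an edge leaving it. *)
Lemma Eq_all i j : i \in F0 -> j \in F0 -> Eq i j.
Proof.
move=> i0 j0.
pose e := [rel u v | [&& u \in F0, v \in F0 &
   [exists l : bt, [forall k, (k \notin F0) ==> (l k == bits c k)] && dd ga u v l]]].
have E u v : e u v -> Eq u v.
  case/and3P => u0 v0 /existsP[l /andP[/forallP hl hd]]; apply: (@Eq_dd _ _ l) => // k nk.
  by apply/eqP; have /implyP := hl k; apply.
have C v : connect e i v -> v \in F0 -> Eq i v.
  case/connectP => p; elim/last_ind: p v => [|p w IH] v /=.
    by move=> _ -> _ x _ rx; rewrite fmK.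
  rewrite rcons_path last_rcons => /andP[hp hw] -> w0.
  have l0 : last i p \in F0 by case/and3P: hw.
  exact: Eq_trans (IH _ hp (erefl _) l0) (E _ _ hw).
apply: C => //.
pose U := [set v in F0 | connect e i v].
have [UF|nU] := eqVneq U F0; first by have : j \in U; [rewrite UF | rewrite inE => /andP[]].
have [||u [v [l [uU]]]] := cF _ _ nU.
- by apply/subsetP => v; rewrite inE => /andP[].
- by apply/set0Pn; exists i; rewrite inE i0 connect0.
rewrite !inE => /andP[+ v0] hl hd; rewrite v0 /= => /negP[].
move: uU; rewrite inE => /andP[u0 /connect_trans]; apply; apply: connect1.
apply/and3P; split => //; apply/existsP; exists l; rewrite hd andbT.
by apply/forallP => k; apply/implyP => nk; rewrite hl.
Qed.

Lemma surf_connected x y : surf x -> surf y -> R x -> R y.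
Proof.
move=> sx sy; have [n] := ubnP #|[set k | bits y k != bits x k]|.
elim: n x sx => // n IH x sx hn rx.
case: (pickP (fun k => bits y k != bits x k)) => [k hk|h].
  have k0 : k \in F0.
    apply: contraNT hk => nk; rewrite !ffunE; have [ha _] := sx; have [hb _] := sy.
    by rewrite ha ?hb.
  apply: (IH (stp x k)); [exact: surf_stp | | exact: Rstp].
  rewrite ltnS in hn; apply: leq_trans hn; rewrite bits_stp; apply: proper_card; apply/properP; split.
    by apply/subsetP => u; rewrite !inE [flipb _ _ _]ffunE; have [->|_] := eqVneq u k.
  exists k; first by rewrite inE.
  by rewrite inE [flipb _ _ _]ffunE eqxx; move: hk; case: (bits y k); case: (bits x k).
have eb : bits x = bits y.
  by apply/ffunP => k; apply/esym/eqP; have := h k; move/negbFE.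
move: x sx rx eb {IH hn h}.
(* The bits [lf] agree from here on, so the surface equation makes the number of wrong second bits
   even, and they can be repaired two at a time. *)
pose dif x := [set k | mf (P k) (y k) != mf (P k) (x k)].
move=> x; have [m] := ubnP #|dif x|; elim: m x => // m IH x hm sx rx eb.
have dF k : k \in dif x -> k \in F0.
  apply: contraLR => nk; rewrite inE negbK; have [ha _] := sx; have [hb _] := sy.
  by rewrite ha ?hb.
case: (pickP (mem (dif x))) => [i /= iD|h]; last first.
  suff <- : x = y by [].
  by apply: ptP => // k; have := h k; rewrite /= inE => /negbFE/eqP.
case: (pickP (mem (dif x :\ i))) => [j /=|h].
  rewrite in_setD1 => /andP[ji jD].
  apply: (IH (fm (fm x i) j)); first last.
  - by rewrite !bits_fm.
  - by apply: Eq_all => //; apply: dF.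
  - by apply: surf_fm2 => //; apply: dF.
  rewrite ltnS in hm; apply: leq_trans hm; apply: proper_card; apply/properP; split.
    apply/subsetP => k; rewrite !inE !m_fm.
    have [->|_] := eqVneq k i; first by move: iD; rewrite inE.
    have [->|_] := eqVneq k j; first by move: jD; rewrite inE.
    by rewrite !addbF.
  exists i => //; rewrite inE !m_fm eqxx [i == j]eq_sym (negbTE ji) addbF addbT.
  by move: iD; rewrite inE; case: (mf _ _); case: (mf _ _).
have iF := subsetP sF _ (dF _ iD).
have : sumb F (fun i => mf (P i) (x i)) = sumb F (fun i => mf (P i) (y i)).
  by have [_ ->] := sx; have [_ ->] := sy; rewrite eb.
rewrite !(sumbD1 _ iF) (@eq_sumb (F :\ i) (fun i => mf (P i) (x i)) (fun i => mf (P i) (y i))).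
  by move/addIb => e; move: iD; rewrite inE e eqxx.
move=> k; rewrite !inE => /andP[ki _]; have := h k; rewrite /= !inE ki /=.
by move/negbFE/eqP.
Qed.
End Walk.
End Points.

Section Coords.
Variable I : finType.
Notation pt := {ffun I -> V}.
Notation bt := {ffun I -> bool}.
Implicit Types (x y c : pt) (l : bt) (F : {set I}).

Definition cline (K : pt -> V) F c (m : V -> pt) :=
  exists x i, [/\ agree F c x, i \in F & forall t, K (m t) = t /\ m t = upd x i (m t i)].

Definition lat (K : pt -> V) F := forall x i, i \in F -> injective (fun a => K (upd x i a)).

(** The coordinate line through [x] in direction [i], parametrised by the value of [K]; if [lat]
    holds and [i] is in the face, the default is never reached. *)
Definition thru (K : pt -> V) x i (t : V) : pt :=
  odflt x [pick z | (K z == t) && (z == upd x i (z i))].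

Lemma thruP K F x i t : lat K F -> i \in F -> K (thru K x i t) = t /\ thru K x i t = upd x i (thru K x i t i).
Proof.
move=> hK iF; rewrite /thru; case: pickP => [z /andP[/eqP ? /eqP ?]|h] //=.
have inj := hK x i iF; have := h (upd x i (invF inj t)).
by rewrite (f_invF inj) updE !eqxx.
Qed.
Lemma thru_line K F c x i : lat K F -> i \in F -> agree F c x -> cline K F c (thru K x i).
Proof. by move=> hK iF ha; exists x, i; split=> // t; apply: (thruP _ _ hK iF). Qed.
Lemma thru_upd K F x i a : lat K F -> i \in F -> thru K x i (K (upd x i a)) = upd x i a.
Proof.
move=> hK iF; have [e1 e2] := thruP x (K (upd x i a)) hK iF.
by rewrite e2; congr upd; apply: (hK x i iF); rewrite -e2 e1.
Qed.
Lemma thru_self K F x i : lat K F -> i \in F -> thru K x i (K x) = x.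
Proof. by move=> hK iF; rewrite -{2}(upd_eq x i) (thru_upd _ _ hK) // upd_eq. Qed.

Variable P : I -> option bool.

(** An affine quasigroup twisted by [be]: the bit [lf Q] of the value is affine in the bits [lf],
    and only the second bit sees the arbitrary function. *)
Definition kval Q F s (be : bt -> bool) x : V :=
  dec Q (sumb F (fun i => lf (P i) (x i)) (+) s)
        (sumb F (fun i => mf (P i) (x i)) (+) be (bits P x)).

Lemma lf_kval Q F s be x : lf Q (kval Q F s be x) = sumb F (fun i => lf (P i) (x i)) (+) s.
Proof. exact: lf_dec. Qed.
Lemma mf_kval Q F s be x :
  mf Q (kval Q F s be x) = sumb F (fun i => mf (P i) (x i)) (+) be (bits P x).
Proof. exact: mf_dec. Qed.
Lemma sumb_upd F (g : I -> V -> bool) x i a : i \in F ->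
  sumb F (fun j => g j (upd x i a j)) = g i a (+) sumb (F :\ i) (fun j => g j (x j)).
Proof.
move=> iF; rewrite (sumbD1 _ iF) updE eqxx; congr addb; apply: eq_sumb => j.
by rewrite !inE updE => /andP[/negbTE->].
Qed.

Lemma lfm_inj Q (a b : V) : lf Q a = lf Q b -> mf Q a = mf Q b -> a = b.
Proof. by move=> e1 e2; rewrite -(dec_lm Q a) -(dec_lm Q b) e1 e2. Qed.

Lemma lat_kval Q F s be : lat (kval Q F s be) F.
Proof.
move=> x i iF a b /= e.
have el : lf (P i) a = lf (P i) b.
  have := congr1 (lf Q) e; rewrite !lf_kval !(sumb_upd (fun j => lf (P j))) //.
  by move/addIb/addIb.
apply: (lfm_inj el).
have := congr1 (mf Q) e; rewrite !mf_kval !(sumb_upd (fun j => mf (P j))) //.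
by rewrite !bits_upd el => /addIb/addIb.
Qed.

Lemma lat_sub K F F0 : F0 \subset F -> lat K F -> lat K F0.
Proof. by move=> /subsetP s h x i /s; apply: h. Qed.

Lemma sumb_flip F l i : i \in F -> sumb F (flipb l i) = ~~ sumb F l.
Proof.
move=> iF; rewrite !(sumbD1 _ iF) ffunE eqxx -addNb; congr addb.
by apply: eq_sumb => j; rewrite !inE ffunE => /andP[/negbTE->].
Qed.

(** As [v] and [y] lie in different classes of [Q], the bit [lf Q] of the value tells them apart.
    The points with value [v] or [y] therefore form a single surface in the sense of [surf], and its
    connectedness passes to the lines. *)
Lemma kval_linespace Q F s be F0 c i0 : F0 \subset F -> i0 \in F0 -> conn be F0 (bits P c) ->
  linespace (agree F0 c) (kval Q F s be) (cline (kval Q F s be) F0 c) Q.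
Proof.
move=> sF i00 hc; set K := kval Q F s be.
have hK : lat K F0 by apply: (lat_sub sF); apply: lat_kval.
split.
- by move=> m t [x [i [_ _ /(_ t)[]]]].
- by move=> m t [x [i [ha iF /(_ t)[_ ->]]]]; apply: agree_upd.
- by move=> b db; exists (thru K b i0); [exact: thru_line | exact: thru_self hK i00].
move=> v y ne Pi Pv Py m m' lm lm' pm.
(* [tau] sees the bits only through their sum over [F], which two flips restore; hence [ga] has the
   same mixed differences as [be]. *)
pose tau l := if (sumb F l (+) s) == lf Q v then mf Q v else mf Q y.
pose ga l := be l (+) tau l.
have S x : agree F0 c x -> K x = v \/ K x = y -> surf P F F0 c ga x.
  move=> ha h; split=> //; rewrite /ga /tau.
  have El : sumb F (bits P x) (+) s = lf Q (K x).
    by rewrite lf_kval; congr addb; apply: eq_sumb => j _; rewrite ffunE.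
  have Em : sumb F (fun i => mf (P i) (x i)) = be (bits P x) (+) mf Q (K x).
    by rewrite mf_kval addbC addbK.
  by rewrite El Em; case: h => ->; rewrite ?eqxx // eq_sym (negbTE ne).
have S' x : surf P F F0 c ga x -> K x = v \/ K x = y.
  move=> [ha]; rewrite /ga /tau.
  have -> : sumb F (bits P x) (+) s = lf Q (K x).
    by rewrite lf_kval; congr addb; apply: eq_sumb => j _; rewrite ffunE.
  have -> : sumb F (fun i => mf (P i) (x i)) = be (bits P x) (+) mf Q (K x).
    by rewrite mf_kval addbC addbK.
  move/addbI; case: eqP => e1 e2; [left | right]; apply: (lfm_inj _ e2) => //.
  by move: ne e1; case: (lf Q v); case: (lf Q y); case: (lf Q (K x)).
have D i j l : i \in F0 -> j \in F0 -> dd ga i j l = dd be i j l.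
  move=> /(subsetP sF) iF /(subsetP sF) jF; rewrite /dd /ga /tau !sumb_flip // negbK.
  move: (be l) (be (flipb l i)) (be (flipb l j)) (be (flipb (flipb l i) j)) => b1 b2 b3 b4.
  move: (sumb F l) (lf Q v) (mf Q v) (mf Q y) => q1 q2 q3 q4 {S S' ga tau K hK ne Pi Pv Py pm lm lm'}.
  by case: q1; case: s; case: q2; case: q3; case: q4; case: b1; case: b2; case: b3; case: b4.
have cg : conn ga F0 (bits P c).
  move=> U sU U0 UF; have [i [j [l [iU jU al dl]]]] := hc U sU U0 UF.
  exists i, j, l; split=> //; rewrite D //; first exact: (subsetP sU).
  by move: jU; rewrite inE => /andP[].
pose R x := forall m, cline K F0 c m -> m v = x \/ m y = x -> Pi m.
have lK m1 t : cline K F0 c m1 -> K (m1 t) = t by move=> [x [i [_ _ /(_ t)[]]]].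
have ld m1 t : cline K F0 c m1 -> agree F0 c (m1 t).
  by move=> [x [i [ha iF /(_ t)[_ ->]]]]; apply: agree_upd.
have vy : v <> y by move=> e; rewrite e eqxx in ne.
have Rstep x z i a : i \in F0 -> surf P F F0 c ga x -> surf P F F0 c ga z ->
    z = upd x i a -> R x -> R z.
  move=> iF0 sx sz ez rx m1 l1 h1.
  have l2 : cline K F0 c (thru K x i) by apply: thru_line => //; case: sx.
  have e1 : thru K x i (K x) = x by exact: thru_self hK iF0.
  have e2 : thru K x i (K z) = z by rewrite ez (thru_upd _ _ hK).
  have p2 : Pi (thru K x i).
    by apply: rx => //; case: (S' _ sx) => e; [left | right]; rewrite -{1}e.
  case: (S' _ sz) => e.
    rewrite e in e2; case: h1 => h; first by apply: (Pv _ _ l2 l1) p2; rewrite h e2.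
    by case: vy; rewrite -(lK _ y l1) h.
  rewrite e in e2; case: h1 => h; last by apply: (Py _ _ l2 l1) p2; rewrite h e2.
  by case: vy; rewrite -(lK _ v l1) h.
have Rv : R (m v).
  move=> m1 l1 [h|h]; first by apply: (Pv _ _ lm l1) pm.
  by case: vy; rewrite -(lK _ v lm) -h lK.
have : R (m' v).
  apply: (surf_connected sF Rstep cg _ _ Rv).
    by apply: S; [exact: ld | left; exact: lK].
  by apply: S; [exact: ld | left; exact: lK].
by apply=> //; left.
Qed.
End Coords.

Lemma lf_sep P P' v y : P != P' -> v != y -> lf P v = lf P y -> lf P' v != lf P' y.
Proof.
by case: P => [[]|]; case: P' => [[]|] //; case: v => [[] []]; case: y => [[] []].
Qed.
Lemma partner_ex P (t : V) : exists2 t', t != t' & lf P t = lf P t'.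
Proof.
exists (dec P (lf P t) (~~ mf P t)); last by rewrite lf_dec.
by case: P => [[]|]; case: t => [[] []].
Qed.

Section Growth.
Variable I : finType.
Notation pt := {ffun I -> V}.
Notation bt := {ffun I -> bool}.
Implicit Types (x y c : pt) (l : bt) (F : {set I}).

Lemma ddC be i j l : dd be i j l = dd be j i l.
Proof. by rewrite /dd flipbC -!addbA; congr addb; rewrite addbCA. Qed.
(** Both sides are the third difference in the directions [i], [j], [s]. *)
Lemma dd3 be i j s l :
  dd be i j l (+) dd be i j (flipb l s) = dd be i s l (+) dd be i s (flipb l j).
Proof.
rewrite /dd [flipb (flipb l j) i]flipbC [flipb (flipb (flipb l i) j) s]flipbC.
rewrite [flipb (flipb l i) s]flipbC [flipb (flipb l j) s]flipbC.
move: (be l) (be (flipb l i)) (be (flipb l j)) (be (flipb (flipb l i) j)) (be (flipb l s)).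
move: (be (flipb (flipb l s) i)) (be (flipb (flipb l s) j)) (be (flipb (flipb (flipb l s) i) j)).
by do 8!case.
Qed.
Lemma dd_same be i l : dd be i i l = false.
Proof. by rewrite /dd flipbK addbK addbb. Qed.

Lemma agree_trans (T : eqType) F (c x y : {ffun I -> T}) : agree F c x -> agree F x y -> agree F c y.
Proof. by move=> h1 h2 i iF; rewrite h2 // h1. Qed.
Lemma agree_sym (T : eqType) F (c x : {ffun I -> T}) : agree F c x -> agree F x c.
Proof. by move=> h1 i iF; rewrite h1. Qed.
Lemma agree_sub (T : eqType) F F' (c x : {ffun I -> T}) : F \subset F' -> agree F c x -> agree F' c x.
Proof. by move=> s h i iF; apply: h; apply: contraNN iF; apply: (subsetP s). Qed.
Lemma agree_flip F l l' i : i \in F -> agree F l l' -> agree F l (flipb l' i).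
Proof. by move=> iF h k kF; rewrite ffunE; case: eqP => [e|_]; [rewrite e iF in kF | apply: h]. Qed.

Lemma conn_agree be F l l' : agree F l l' -> conn be F l -> conn be F l'.
Proof.
move=> h hc U a b d; have [i [j [l1 [p q r t]]]] := hc U a b d.
by exists i, j, l1; split=> //; apply: agree_trans r; apply: agree_sym.
Qed.

Lemma conn_nonempty_edge be F l0 i : i \in F -> 1 < #|F| -> conn be F l0 ->
  exists j l, [/\ j \in F, j != i, agree F l0 l & dd be i j l].
Proof.
move=> iF h2 hc; have [|||i' [j [l [iU jU al dl]]]] := hc [set i].
- by rewrite sub1set.
- by apply/set0Pn; exists i; rewrite inE.
- by apply: contraTneq h2 => <-; rewrite cards1.
move: iU; rewrite inE => /eqP ei; rewrite ei in dl; move: jU; rewrite !inE => /andP[ne jF].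
by exists j, l.
Qed.

Lemma pair_conn be i j l0 : dd be i j l0 -> i != j -> conn be [set i; j] l0.
Proof.
move=> hd ij U sU U0 UF.
have E : forall u, u \in U -> u = i \/ u = j.
  by move=> u /(subsetP sU); rewrite !inE => /orP[/eqP|/eqP]; [left|right].
have [iU|iU] := boolP (i \in U).
  exists i, j, l0; split=> //; rewrite !inE eqxx orbT andbT; apply: contraNN UF => jU.
  by rewrite eqEsubset sU subUset !sub1set iU.
exists j, i, l0; rewrite ddC; split=> //; last by rewrite !inE iU eqxx.
by have /set0Pn[u uU] := U0; case: (E u uU) => e; [rewrite e (negbTE iU) in uU | rewrite -e].
Qed.

(** A subset of the enlarged face either cuts [F], which is connected, or separates [s] from all of
    [F]. A single edge between [F] and [s] would thus make the enlarged face connected. *)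
Lemma conn_step be F s l1 : s \notin F -> 1 < #|F| -> conn be F l1 -> ~ conn be (s |: F) l1 ->
  forall i l, i \in F -> agree (s |: F) l1 l -> dd be i s l = false.
Proof.
move=> sF h2 hc nc i l iF al; apply/negP => dl; apply: nc => U sU U0 UF.
have [e|UI] := boolP ((U :&: F == set0) || (F \subset U)); last first.
  move: UI; rewrite negb_or => /andP[n0 nF].
  have [|||i' [j [l' [iU jU al' dl']]]] := hc (U :&: F); rewrite ?subsetIr //.
    by apply: contraNneq nF => <-; apply: subsetIl.
  exists i', j, l'; split=> //; first by move: iU; rewrite inE => /andP[].
    by move: jU; rewrite !inE => /andP[a b]; move: a; rewrite b orbT !andbT.
  by apply: agree_sub al'; apply: subsetUr.
case/orP: e => [/eqP e|FU].
  have sU' : s \in U.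
    have /set0Pn[u uU] := U0; have := subsetP sU _ uU; rewrite !inE => /orP[/eqP<-//|uF].
    by have := in_set0 u; rewrite -e inE uU uF.
  exists s, i, l; rewrite ddC; split=> //; rewrite !inE iF orbT andbT.
  by apply/negP => iU; have := in_set0 i; rewrite -e inE iU iF.
exists i, s, l; split=> //; first exact: (subsetP FU).
rewrite !inE eqxx /= andbT; apply: contraNN UF => sU'.
by rewrite eqEsubset sU subUset sub1set sU' FU.
Qed.

(* A connected face of maximal dimension among the proper ones is a hyperplane: otherwise all its
   neighbouring parallel faces would be connected too, with no edge leaving any of them. *)
Lemma conn_hyperplane be F l0 : 2 < #|F| -> conn be F l0 ->
  exists s l, [/\ s \in F, agree F l0 l & conn be (F :\ s) l].
Proof.
move=> h3 hc.
suff X d (G : {set I}) l : #|F| <= d + #|G| -> G \subset F -> G != F -> 1 < #|G| -> agree F l0 l -> conn be G l ->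
    exists s l, [/\ s \in F, agree F l0 l & conn be (F :\ s) l].
  have /card_gt0P[i iF] : 0 < #|F| by apply: leq_trans h3.
  have [j [l [jF ji al dl]]] := conn_nonempty_edge iF (ltnW h3) hc.
  apply: (X #|F| [set i; j] l) => //; rewrite ?leq_addr //.
  - by rewrite subUset !sub1set iF.
  - by apply: contraTneq h3 => <-; rewrite cards2 eq_sym ji.
  - by rewrite cards2 eq_sym ji.
  by apply: pair_conn; rewrite // eq_sym.
elim: d G l => [|d IH] G l hd sG nG G2 al cG.
  case/eqP: nG; apply/eqP; rewrite eqEcard sG; exact: hd.
have pG : G \proper F by rewrite properEneq nG.
have [e|ne] := eqVneq #|F| #|G|.+1.
  have /properP[_ [s sF sG']] := pG; exists s, l; split=> //.
  suff -> : F :\ s = G by [].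
  apply/esym/eqP; rewrite eqEcard subsetD1 sG sG' /=.
  by have := cardsD1 s F; rewrite sF e add1n => -[->].
have [[s [l' [sF sG' al' cl']]]|nex] :=
    classic (exists s l', [/\ s \in F, s \notin G, agree F l0 l' & conn be (s |: G) l']).
  have cs : #|s |: G| = #|G|.+1 by rewrite cardsU1 sG'.
  apply: (IH (s |: G) l') => //; rewrite ?cs.
  - by rewrite addnS -addSn.
  - by rewrite subUset sub1set sF.
  - by apply: contraNneq ne => <-; rewrite cs.
  - exact: leqW.
have step s l' : s \in F -> s \notin G -> agree F l0 l' -> conn be G l' ->
    forall i l, i \in G -> agree (s |: G) l' l -> dd be i s l = false.
  move=> sF sG' al' cl'; apply: conn_step => // h; apply: nex; by exists s, l'.
have C l' : agree F l0 l' -> conn be G l'.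
  have [n] := ubnP #|[set k in F :\: G | l' k != l k]|; elim: n l' => // n IHn l' hn al'.
  case: (pickP (fun k => (k \in F :\: G) && (l' k != l k))) => [k /andP[kF hk]|h].
    have := kF; rewrite inE => /andP[kG kF'].
    have al2 : agree F l0 (flipb l' k) by apply: agree_flip.
    have c2 : conn be G (flipb l' k).
      apply: IHn => //; rewrite ltnS in hn; apply: leq_trans hn; apply: proper_card; apply/properP; split.
        apply/subsetP => u; rewrite !inE [flipb _ _ _]ffunE; have [->|_] := eqVneq u k => //.
        by rewrite hk !andbT => /andP[].
      exists k; first by rewrite inE kF hk.
      by rewrite inE kF [flipb _ _ _]ffunE eqxx; move: hk; case: (l k); case: (l' k).
    move=> U sU U0 UG; have [i [j [l1 [iU jU al1 dl1]]]] := c2 U sU U0 UG.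
    have iG := subsetP sU _ iU; have jG : j \in G by move: jU; rewrite inE => /andP[].
    have Z l3 : agree (k |: G) (flipb l' k) l3 -> dd be i k l3 = false.
      exact: (step k _ kF' kG al2 c2).
    exists i, j, (flipb l1 k); split=> //.
      move=> u uG; rewrite ffunE; case: (u =P k) => [->|uk]; rewrite al1 // ffunE.
        by rewrite eqxx negbK.
      by move/eqP/negbTE: uk => ->.
    have := dd3 be i j k l1; rewrite dl1 !Z //; first by case: (dd _ _ _ _).
      by apply: agree_flip; [rewrite inE jG orbT | apply: agree_sub al1; apply: subsetUr].
    by apply: agree_sub al1; apply: subsetUr.
  apply: conn_agree cG => u uG; have := h u; rewrite inE uG /=.
  have [uF|uF] := boolP (u \in F); first by move=> /negbFE/eqP.
  by rewrite al' // al.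
have [|i [s [l1 [iG sFG al1 dl1]]]] := hc G sG _ nG.
  by rewrite -card_gt0; apply: leq_trans G2.
move: sFG; rewrite inE => /andP[sG' sF].
by have := step s l1 sF sG' al1 (C _ al1) i l1 iG (agree_refl _); rewrite dl1.
Qed.
End Growth.

(** * A connected face against a space of lines with another partition *)

Section Step.
Variables (T : Type) (dom : T -> Prop) (KL : T -> V) (line : (V -> T) -> Prop) (PL : option bool).
Hypothesis LS : linespace dom KL line PL.
Variable I : finType.
Notation pt := {ffun I -> V}.
Notation bt := {ffun I -> bool}.
Implicit Types (x y c : pt) (l : bt).
Variables (P : I -> option bool) (Q : option bool) (F : {set I}) (s : bool) (be : bt -> bool) (c : pt).
Hypothesis QP : PL != Q.
Local Notation H := (kval P Q F s be).
Variable g : pt -> T -> V.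
Hypothesis gfam : forall m, cline H F c m -> fam dom KL line (fun t => g (m t)).

Definition mono (F0 : {set I}) c0 := forall x y, agree F0 c0 x -> agree F0 c0 y -> H x = H y ->
  forall b, dom b -> g x b = g y b.
Local Notation lgood := (good dom KL).

Hypothesis planes : forall x i j, agree F c x -> i \in F -> j \in F -> dd be i j (bits P x) ->
  (forall y, agree [set i; j] x y -> lgood (g y)) \/ mono [set i; j] x.

Let hH : lat H F. Proof. exact: lat_kval. Qed.

Definition ptof l x : pt := [ffun k => dec (P k) (l k) (mf (P k) (x k))].
Lemma bits_ptof l x : bits P (ptof l x) = l.
Proof. by apply/ffunP => k; rewrite !ffunE lf_dec. Qed.
Lemma agree_ptof (F0 : {set I}) l x : agree F0 (bits P x) l -> agree F0 x (ptof l x).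
Proof. by move=> h k kF; rewrite ffunE h // ffunE dec_lm. Qed.

(** A connected face has a connected hyperplane. This one and the parallel one obtained by flipping
    the second bit at [w] have the same bits, so induction settles both, and a plane across them
    makes [g] the same function of [H] on both. A line in direction [w] meets them at two values in
    one class of [Q], hence in different classes of [PL], and [fam_determined] fixes the rest of the
    line. *)
Lemma grow (F0 : {set I}) c0 : (forall m, cline H F c m -> ~ forall t, lgood (g (m t))) ->
  F0 \subset F -> agree F c c0 -> conn be F0 (bits P c0) -> 1 < #|F0| -> mono F0 c0.
Proof.
move=> ng; have [n] := ubnP #|F0|; elim: n F0 c0 => // n IH F0 c0 hn sF ac cF h2.
have pl x i j : agree F c x -> i \in F -> j \in F -> dd be i j (bits P x) -> mono [set i; j] x.
  move=> ax iF jF hd; have [h|//] := planes ax iF jF hd.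
  have lm : cline H F c (thru H x i) by apply: thru_line.
  case: (ng _ lm) => t; apply: h => k; rewrite !inE negb_or => /andP[ki _].
  by have [_ ->] := thruP x t hH iF; rewrite updE (negbTE ki).
have [F3|] := ltnP 2 #|F0|; last first.
  move=> h3; have /eqP c2 : #|F0| == 2 by rewrite eqn_leq h2 h3.
  have /card_gt0P[i iF] : 0 < #|F0| by rewrite c2.
  have [j [l [jF ji al dl]]] := conn_nonempty_edge iF h2 cF.
  have eF : F0 = [set i; j].
    apply/esym/eqP; rewrite eqEcard subUset !sub1set iF jF cards2 eq_sym ji c2 //.
  have ap := agree_ptof al.
  have hm : mono [set i; j] (ptof l c0).
    apply: pl; rewrite ?bits_ptof ?(subsetP sF) //.
    by apply: agree_trans ac _; apply: agree_sub ap.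
  rewrite eF in ap ac *; move=> x y ax ay; apply: hm.
    by apply: agree_trans (agree_sym ap) _.
  by apply: agree_trans (agree_sym ap) _.
have [w [l1 [wF al1 cl1]]] := conn_hyperplane F3 cF.
pose c1 := ptof l1 c0; pose c2 := fm P c1 w.
have a01 : agree F0 c0 c1 by apply: agree_ptof.
have a02 : agree F0 c0 c2 by apply: agree_upd.
have cw : #|F0| = #|F0 :\ w|.+1 by rewrite (cardsD1 w F0) wF.
have sw : F0 :\ w \subset F by apply: subset_trans sF; apply: subsetDl.
have G d : agree F0 c0 d -> bits P d = l1 -> mono (F0 :\ w) d.
  move=> ad bd; apply: IH => //.
  - by rewrite -ltnS -cw.
  - by apply: agree_trans ac _; apply: agree_sub ad.
  - by rewrite bd.
  - by rewrite -ltnS -cw.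
have m1 := G c1 a01 (bits_ptof _ _).
have m2 : mono (F0 :\ w) c2 by apply: G => //; rewrite bits_fm bits_ptof.
have [j [l [jF jw al dl]]] := conn_nonempty_edge wF h2 cF.
pose x := ptof l c0; have ax : agree F0 c0 x by apply: agree_ptof.
have ax' : agree F c x by apply: agree_trans ac _; apply: agree_sub ax.
have wF' := subsetP sF _ wF; have jF' := subsetP sF _ jF.
have mp : mono [set w; j] x by apply: pl => //; rewrite bits_ptof.
have Aw d e : agree F0 c0 d -> agree F0 c0 e -> agree (F0 :\ w) d (upd e w (d w)).
  move=> ad ae k; rewrite !inE negb_and negbK updE; case: eqP => [->|_ /= kF] //.
  by rewrite ad // ae.
pose lm d := thru H (upd x w (d w)) j.
have jw' : j \in F0 :\ w by rewrite !inE jw.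
have lmP d t : agree F0 c0 d -> [/\ H (lm d t) = t, agree (F0 :\ w) d (lm d t) & agree [set w; j] x (lm d t)].
  move=> ad; have [e1 e2] := thruP (upd x w (d w)) t hH jF'; split=> //; rewrite /lm e2.
    by apply: agree_upd => //; apply: Aw.
  by apply: agree_upd; [rewrite !inE eqxx orbT | apply: agree_upd; rewrite // !inE eqxx].
have lml d : agree F0 c0 d -> cline H F c (lm d).
  by move=> ad; apply: thru_line => //; apply: agree_upd.
have E1 a b : agree (F0 :\ w) c1 a -> dom b -> g a b = g (lm c1 (H a)) b.
  by move=> aa db; have [e1 e2 _] := lmP c1 (H a) a01; apply: (m1 _ _ aa e2) => //.
have E2 a b : agree (F0 :\ w) c2 a -> dom b -> g a b = g (lm c1 (H a)) b.
  move=> aa db; have [e1 e2 e3] := lmP c2 (H a) a02; rewrite (m2 _ _ aa e2) //.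
  by have [f1 f2 f3] := lmP c1 (H a) a01; apply: mp => //; rewrite e1.
have E a b : agree F0 c0 a -> dom b -> g a b = g (lm c1 (H a)) b.
  move=> aa db; have ac' : agree F c a by apply: agree_trans ac _; apply: agree_sub aa.
  have ls : cline H F c (thru H a w) by apply: thru_line.
  pose p1 := upd a w (c1 w); pose p2 := upd a w (c2 w).
  have q1 : thru H a w (H p1) = p1 by apply: thru_upd hH _.
  have q2 : thru H a w (H p2) = p2 by apply: thru_upd hH _.
  have ne : lf PL (H p1) != lf PL (H p2).
    apply: (@lf_sep Q); first by rewrite eq_sym.
      apply/eqP => /hH; rewrite /p1 /p2 updE eqxx => /(_ wF') /(congr1 (mf (P w))).
      by rewrite mf_dec; case: (mf _ _).
    rewrite !lf_kval; congr addb; apply: eq_sumb => k _; rewrite !updE.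
    by case: eqP => [->|] //; rewrite eqxx lf_dec.
  rewrite -{1}(thru_self a hH wF'); apply/esym.
  apply: (fam_determined LS (gfam (lml _ a01)) (gfam ls) ne) => //; last exact: ng (lml _ a01).
    by move=> d dd; rewrite q1 -E1 //; apply: Aw.
  by move=> d dd; rewrite q2 -E2 //; apply: Aw.
by move=> a a' aa aa' e b db; rewrite E // [RHS]E // e.
Qed.

(** If [g] fails to be good at [x0], it fails somewhere on every line: walk between lines through
    the value [H x0] and its [PL]-partner, which lies in another class of [Q], and pass the failure
    between these two values by [good_partner]. *)
Lemma step_dichotomy : 1 < #|F| -> conn be F (bits P c) ->
  (forall x, agree F c x -> lgood (g x)) \/ mono F c.
Proof.
move=> h2 cF; have [h|/not_all_ex_not[x0 h]] := classic (forall x, agree F c x -> lgood (g x)); first by left.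
have {h}[a0 n0] := imply_to_and _ _ h.
have /card_gt0P[i iF] : 0 < #|F| by apply: ltnW.
have BS := @kval_linespace I P Q F s be F c i (subxx _) iF cF.
right; apply: grow => // m lm; have [t' ne et] := partner_ex PL (H x0).
have nq : lf Q (H x0) != lf Q t' by apply: lf_sep ne et.
have l0 := thru_line hH iF a0.
suff : ~ lgood (g (m (H x0))) by move=> n h; apply: n.
refine (lconn BS nq (fun m => ~ lgood (g (m (H x0)))) _ _ _ _ l0 lm _).
- by move=> m1 m2 l1 l2 ->.
- move=> m1 m2 l1 l2 e n1 n2; apply: n1.
  apply: (good_partner LS (gfam l1) (esym et)); rewrite e.
  exact: (good_partner LS (gfam l2) et).
by rewrite (thru_self _ hH).
Qed.
End Step.

(** * Two strict planes *)

(* Addition in Z_2^2 ([e = false]) and in Z_4 ([e = true]). *)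
Definition hc (e : bool) (x y : V) : V := (x.1 (+) y.1, x.2 (+) y.2 (+) (e && (x.1 && y.1))).
Definition kc (z v : V) : V := (z.2 (+) v.2 (+) (z.1 && v.1), z.1 (+) v.1).

Definition cells : seq (V * V) := [seq (x, y) | x <- vs, y <- vs].
Definition ci (x y : V) : nat := 4 * vi x + vi y.
Lemma nth_cells x y : nth (zr, zr) cells (ci x y) = (x, y).
Proof. by case: x => [[] []]; case: y => [[] []]. Qed.
Lemma ci_lt x y : ci x y < 16. Proof. by case: x => [[] []]; case: y => [[] []]. Qed.

(** Ternary quasigroups, stored as 16 rows, whose value [zr] is prescribed to form the graph of
    [hc e]. One layer of the code is thus fixed and the search finds all its extensions. *)
Definition exts e : seq (seq (seq V)) :=
  enumseqs (fun n => let c := nth (zr, zr) cells n in prm0 (hc e c.1 c.2))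
    (fun n s r => let c := nth (zr, zr) cells n in
       lall (fun i => let d := nth (zr, zr) cells i in
         if (if c.1 == d.1 then true else c.2 == d.2) then disj (nth [::] s i) r else true)
       (iota 0 n)) 16.

Definition tab (f : V -> V -> V -> V) : seq (seq V) := [seq row4 (f c.1 c.2) | c <- cells].
Definition at3 (s : seq (seq V)) (x y t : V) := nth zr (nth [::] s (ci x y)) (vi t).
Lemma at3_tab f x y t : at3 (tab f) x y t = f x y t.
Proof. by rewrite /at3 (nth_map (zr, zr)) ?ci_lt // nth_cells row4_nth. Qed.

Lemma extsP e f : (forall x y t, (f x y t == zr) = (t == hc e x y)) ->
  (forall x y, injective (f x y)) -> (forall x t, injective (fun y => f x y t)) ->
  (forall y t, injective (fun x => f x y t)) -> tab f \in exts e.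
Proof.
move=> hz h3 h2 h1.
have E : size (tab f) = 16 by [].
have N i : i < 16 -> nth [::] (tab f) i =
    row4 (f (nth (zr, zr) cells i).1 (nth (zr, zr) cells i).2).
  by move=> hi; rewrite (nth_map (zr, zr)).
rewrite /exts -{1}E; apply: (@enumseqsP _ [::]) => i; rewrite E => hi.
  by rewrite N //; apply: prm0P => // t; rewrite hz.
rewrite lallE; apply/allP => j; rewrite mem_iota /= add0n => hj.
have ne : nth (zr, zr) cells j != nth (zr, zr) cells i.
  by rewrite nth_uniq ?(ltn_trans hj hi) // neq_ltn hj.
case: ifP => // h; rewrite nth_take // !N ?(ltn_trans hj hi) // /disj lallE; apply/allP => t _.
rewrite !row4_nth; move: h ne.
case: (nth _ cells i) => x y; case: (nth _ cells j) => x' y' /=.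
have [->|_] := eqVneq x x'.
  by move=> _ ne; apply: contraNneq ne => /h2 ->.
by move=> /eqP -> ne; apply: contraNneq ne => /h1 ->.
Qed.

Definition compat z z' (f f' : seq (seq V)) : bool :=
  lall (fun v => let t := kc z v in let t' := kc z' v in
    lall (fun c => at3 f c.1 c.2 t != at3 f' c.1 c.2 t') cells) vs.
Definition goodf e (f : seq (seq V)) : bool :=
  lall (fun c => lall (fun d => if hc e c.1 c.2 == hc e d.1 d.2 then
     nth [::] f (ci c.1 c.2) == nth [::] f (ci d.1 d.2) else true) cells) cells.
(** Four ternary quasigroups, one for each [z]. Reparametrising the last argument by [kc z] gives
    all of them the same set of zeros, so that one list [exts true] serves; [compat] expresses
    injectivity in [z]. *)
Definition planelist : seq (seq (seq (seq V))) :=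
  let e := exts true in enumseqs (fun _ => e)
    (fun n s f => lall (fun i => compat (nth zr vs i) (nth zr vs n) (nth [::] s i) f) (iota 0 n)) 4.
Definition okplanes (s : seq (seq (seq V))) : bool :=
  if all (goodf true) s then true else all (fun f => f == head [::] s) s.
Lemma planelist_ok : all okplanes planelist. Proof. by vm_compute. Qed.
Opaque exts planelist.
Lemma planelistP s : s \in planelist ->
  all (goodf true) s \/ all (fun f => f == head [::] s) s.
Proof.
move=> hs; have := allP planelist_ok s hs; rewrite /okplanes.
by case: ifP => h h'; [left | right].
Qed.
Transparent exts planelist.

Definition kinv (z t : V) : V := (z.1 (+) t.2, t.1 (+) z.2 (+) (z.1 && (z.1 (+) t.2))).
Lemma kc_kinv z t : kc z (kinv z t) = t.
Proof. by case: z => [[] []]; case: t => [[] []]. Qed.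
Lemma kinv_kc z v : kinv z (kc z v) = v.
Proof. by case: z => [[] []]; case: v => [[] []]. Qed.
Lemma cellsP x y : (x, y) \in cells.
Proof. by rewrite /cells allpairs_f ?mem_vs. Qed.

(** The smallest instance of two leaves with a mismatch: the root partition is the first bit for
    [hc true] and the second bit for [kc]. *)
Lemma plane_dichotomy (f : V -> V -> V -> V -> V) :
  (forall x y z v, (f x y z v == zr) = (hc true x y == kc z v)) ->
  (forall y z v, injective (fun x => f x y z v)) -> (forall x z v, injective (fun y => f x y z v)) ->
  (forall x y v, injective (fun z => f x y z v)) -> (forall x y z, injective (f x y z)) ->
  (forall x y x' y', hc true x y = hc true x' y' -> forall z v, f x y z v = f x' y' z v) \/
  (forall z v z' v', kc z v = kc z' v' -> forall x y, f x y z v = f x y z' v').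
Proof.
move=> fz f1 f2 f3 f4.
pose g z x y t := f x y z (kinv z t).
have gE x y z v : f x y z v = at3 (tab (g z)) x y (kc z v) by rewrite at3_tab /g kinv_kc.
have gT z : tab (g z) \in exts true.
  apply: extsP => [x y t|x y|x t|y t].
  - by rewrite /g fz kc_kinv eq_sym.
  - by apply: inj_comp (f4 x y z) (can_inj (kc_kinv z)).
  - exact: f2.
  - exact: f1.
pose s := [seq tab (g z) | z <- vs].
have E : size s = 4 by [].
have N i : i < 4 -> nth [::] s i = tab (g (nth zr vs i)) by move=> hi; rewrite (nth_map zr).
have sP : s \in planelist.
  rewrite /planelist -{1}E; apply: (@enumseqsP _ [::]) => i; rewrite E => hi; first by rewrite N.
  rewrite lallE; apply/allP => j; rewrite mem_iota /= add0n => hj.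
  rewrite nth_take // !N ?(ltn_trans hj hi) // /compat lallE; apply/allP => v _.
  rewrite lallE; apply/allP => [[x y]] _ /=; rewrite !at3_tab /g !kinv_kc.
  apply/eqP => /f3/eqP; rewrite nth_uniq ?(ltn_trans hj hi) //.
  by rewrite (ltn_eqF hj).
have [/allP h|/allP h] := planelistP sP.
  left=> x y x' y' e z v; rewrite !gE.
  have := h _ (map_f (fun z => tab (g z)) (mem_vs z)).
  rewrite /goodf lallE => /allP/(_ _ (cellsP x y)).
  rewrite lallE => /allP/(_ _ (cellsP x' y')); rewrite /= e eqxx.
  by rewrite /at3 => /eqP->.
right=> z v z' v' e x y; rewrite !gE e; congr at3.
have X u : tab (g u) = head [::] s.
  exact/eqP/h/(map_f (fun z => tab (g z)) (mem_vs u)).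
by rewrite (X z) (X z').
Qed.

(** * Two leaves with different partitions at the root *)

Section Canon.
Variable I : finType.
Notation pt := {ffun I -> V}.
Variables (P : I -> option bool) (Q : option bool) (X : {set I}) (s : bool) (be : {ffun I -> bool} -> bool).
Local Notation H := (kval P Q X s be).

Lemma lf_other (Q' : option bool) : Q != Q' ->
  exists d, forall t, lf Q' t = mf Q t (+) (d && lf Q t).
Proof.
case: Q => [[]|]; case: Q' => [[]|] // _;
  try by [exists true => - [[] []] | exists false => - [[] []]].
Qed.

(** A function of two bits with nonzero mixed difference is their product up to affine terms, and
    passing from [mf Q] to [lf Q'] adds only another affine term. The relabellings [Di] and [Dj]
    absorb all of these. *)
Lemma canonical_plane a i j Q' : i \in X -> j \in X -> dd be i j (bits P a) -> Q != Q' ->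
  exists Di Dj : V -> V, [/\ bijective Di, bijective Dj &
    forall x y, let t := H (upd (upd a i (Di x)) j (Dj y)) in (lf Q t, lf Q' t) = hc true x y].
Proof.
move=> iX jX hd /lf_other[d hQ].
have ij : i != j by apply: contraTneq hd => ->; rewrite dd_same.
have jX' : j \in X :\ i by rewrite !inE eq_sym ij.
pose u0 := bits P a i; pose w0 := bits P a j.
pose L := [ffun k => if k == i then false else if k == j then false else bits P a k].
pose pt2 u v : {ffun I -> bool} := [ffun k => if k == i then u else if k == j then v else bits P a k].
pose c1 := s (+) sumb (X :\ i :\ j) (fun k => lf (P k) (a k)).
pose c2 := sumb (X :\ i :\ j) (fun k => mf (P k) (a k)).
have E (g : I -> V -> bool) x y : sumb X (fun k => g k (upd (upd a i x) j y k)) =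
   g i x (+) g j y (+) sumb (X :\ i :\ j) (fun k => g k (a k)).
  rewrite (sumbD1 _ iX) (sumbD1 _ jX') !updE eqxx (negbTE ij) eqxx addbA; congr addb.
  apply: eq_sumb => k; rewrite !inE !updE => /and3P[/negbTE-> /negbTE->] //.
have El x y : lf Q (H (upd (upd a i x) j y)) = lf (P i) x (+) lf (P j) y (+) c1.
  by rewrite lf_kval (E (fun k => lf (P k))) -!addbA; congr addb; congr addb; rewrite addbC.
have Eb x y : bits P (upd (upd a i x) j y) = pt2 (lf (P i) x) (lf (P j) y).
  apply/ffunP => k; rewrite !ffunE; have [->|kj] := eqVneq k j; first by rewrite eq_sym (negbTE ij).
  by have [->|ki] := eqVneq k i; rewrite // ffunE.
pose b3 u v := c2 (+) be (pt2 u v) (+) (d && (u (+) v (+) c1)).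
have Em x y : lf Q' (H (upd (upd a i x) j y)) = mf (P i) x (+) mf (P j) y (+) b3 (lf (P i) x) (lf (P j) y).
  by rewrite hQ El mf_kval (E (fun k => mf (P k))) Eb /b3 -!addbA.
have D u v : b3 u v (+) b3 (~~ u) v (+) b3 u (~~ v) (+) b3 (~~ u) (~~ v).
  have F1 u' v' : flipb (pt2 u' v') i = pt2 (~~ u') v'.
    by apply/ffunP => k; rewrite !ffunE; case: eqP.
  have F2 u' v' : flipb (pt2 u' v') j = pt2 u' (~~ v').
    apply/ffunP => k; rewrite !ffunE; have [->|kj] := eqVneq k j => //.
    by rewrite eq_sym (negbTE ij).
  have : dd be i j (pt2 u0 w0).
    suff -> : pt2 u0 w0 = bits P a by [].
    by apply/ffunP => k; rewrite ffunE; case: eqP => [->|_] //; case: eqP => [->|].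
  rewrite /dd !F1 !F2 /b3.
  generalize c1 c2 d u0 w0 => b1 b2 b3' u1 w1.
  case: u1; case: w1; case: u; case: v => /=;
  move: (be (pt2 true true)) (be (pt2 true false)) (be (pt2 false true)) (be (pt2 false false));
  by case: b1; case: b2; case: b3'; do 4!case.
exists (fun x => dec (P i) (x.1 (+) c1) (x.2 (+) b3 (x.1 (+) c1) false)),
       (fun y => dec (P j) y.1 (y.2 (+) b3 c1 y.1 (+) b3 c1 false)); split.
- exists (fun t => (lf (P i) t (+) c1, mf (P i) t (+) b3 (lf (P i) t) false)) => t.
    by rewrite lf_dec mf_dec addbK addbK; case: t.
  by rewrite /= addbK addbK dec_lm.
- exists (fun t => (lf (P j) t, mf (P j) t (+) b3 c1 false (+) b3 c1 (lf (P j) t))) => t.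
    by rewrite lf_dec mf_dec addbK addbK; case: t.
  by rewrite /= addbK addbK dec_lm.
move=> x y /=; rewrite El Em !lf_dec !mf_dec /hc; congr pair.
  by rewrite addbAC addbK.
have := D c1 false; move: (D c1 true) => /=.
case: x => x1 x2; case: y => y1 y2 /=; case: x1; case: y1; rewrite ?addbF ?addTb /=;
move: (b3 c1 false) (b3 c1 true) (b3 (~~ c1) false) (b3 (~~ c1) true) => b1 b2 e1 e2;
by case: x2; case: y2; case: b1; case: b2; case: e1; case: e2.
Qed.
End Canon.

Section TwoLeaves.
Variable I : finType.
Notation pt := {ffun I -> V}.
Notation bt := {ffun I -> bool}.
Variables (PX PY : I -> option bool) (X Y : {set I}) (QX QY : option bool) (sX sY : bool) (bX bY : bt -> bool).
Variables (cX cY : pt).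
Hypothesis QXY : QX != QY.
Local Notation HX := (kval PX QX X sX bX).
Local Notation HY := (kval PY QY Y sY bY).
Variable f : pt -> pt -> V.
Hypothesis f0 : forall a b, agree X cX a -> agree Y cY b -> (f a b == zr) = (HX a == HY b).
Hypothesis fX : forall a b i, agree X cX a -> agree Y cY b -> i \in X -> injective (fun u => f (upd a i u) b).
Hypothesis fY : forall a b i, agree X cX a -> agree Y cY b -> i \in Y -> injective (fun u => f a (upd b i u)).

Lemma face_dichotomy a i j b k l :
  agree X cX a -> i \in X -> j \in X -> dd bX i j (bits PX a) ->
  agree Y cY b -> k \in Y -> l \in Y -> dd bY k l (bits PY b) ->
  (forall a1 a2, agree [set i; j] a a1 -> agree [set i; j] a a2 -> HX a1 = HX a2 ->
     forall b', agree [set k; l] b b' -> f a1 b' = f a2 b') \/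
  (forall b1 b2, agree [set k; l] b b1 -> agree [set k; l] b b2 -> HY b1 = HY b2 ->
     forall a', agree [set i; j] a a' -> f a' b1 = f a' b2).
Proof.
move=> aa iX jX hij ab kY lY hkl.
have [Di [Dj [[Ei DEi EDi] [Ej DEj EDj] hX]]] := @canonical_plane I PX QX X sX bX a i j QY iX jX hij QXY.
have QYX : QY != QX by rewrite eq_sym.
have [Dk [Dl [[Ek DEk EDk] [El DEl EDl] hY]]] := @canonical_plane I PY QY Y sY bY b k l QX kY lY hkl QYX.
pose A x y := upd (upd a i (Di x)) j (Dj y).
pose B z v := upd (upd b k (Dk z)) l (Dl v).
have ij : i != j by apply: contraTneq hij => ->; rewrite dd_same.
have kl : k != l by apply: contraTneq hkl => ->; rewrite dd_same.
have sA a' : agree [set i; j] a a' -> a' = A (Ei (a' i)) (Ej (a' j)).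
  move=> h; apply/ffunP => u; rewrite /A !updE EDi EDj; case: (u =P j) => [->|/eqP uj] //.
  by case: (u =P i) => [->|/eqP ui] //; rewrite h // !inE negb_or ui.
have sB b' : agree [set k; l] b b' -> b' = B (Ek (b' k)) (El (b' l)).
  move=> h; apply/ffunP => u; rewrite /B !updE EDk EDl; case: (u =P l) => [->|/eqP uj] //.
  by case: (u =P k) => [->|/eqP ui] //; rewrite h // !inE negb_or ui.
have aA x y : agree X cX (A x y) by do 2!apply: agree_upd => //.
have aB x y : agree Y cY (B x y) by do 2!apply: agree_upd => //.
have pair_lf t t' : (lf QX t, lf QY t) = (lf QX t', lf QY t') -> t = t'.
  by move: QXY; case: QX => [[]|]; case: QY => [[]|] //; case: t => [[] []]; case: t' => [[] []].
have KE z v : kc z v = (lf QX (HY (B z v)), lf QY (HY (B z v))).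
  by have := hY z v; rewrite /= => -[-> ->]; rewrite /kc.
have HE x y : hc true x y = (lf QX (HX (A x y)), lf QY (HX (A x y))) by rewrite -hX.
have EX x y x' y' : (hc true x y == hc true x' y') = (HX (A x y) == HX (A x' y')).
  by rewrite !HE; apply/eqP/eqP => [/pair_lf|->].
have EY x y x' y' : (kc x y == kc x' y') = (HY (B x y) == HY (B x' y')).
  by rewrite !KE; apply/eqP/eqP => [/pair_lf|->].
have [|y z v|x z v|x y v|x y z|h|h] := @plane_dichotomy (fun x y z v => f (A x y) (B z v)).
- by move=> x y z v; rewrite f0 // HE KE; apply/eqP/eqP => [->|/pair_lf].
- rewrite /A => x x'; rewrite updC // [X in _ = f X _]updC // => /fX e.
  by apply: (can_inj DEi); apply: e => //; apply: agree_upd.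
- by move=> y y' /fX e; apply: (can_inj DEj); apply: e => //; apply: agree_upd.
- rewrite /B => x1 x'; rewrite updC // [X in _ = f _ X]updC // => /fY e.
  by apply: (can_inj DEk); apply: e => //; apply: agree_upd.
- by move=> y1 y' /fY e; apply: (can_inj DEl); apply: e => //; apply: agree_upd.
- left=> a1 a2 /sA e1 /sA e2 e b' /sB eb; rewrite e1 e2 eb; apply: h.
  by apply/eqP; rewrite EX -e1 -e2 e.
right=> b1 b2 /sB e1 /sB e2 e a' /sA ea; rewrite e1 e2 ea; apply: h.
by apply/eqP; rewrite EY -e1 -e2 e.
Qed.

Hypotheses (X2 : 1 < #|X|) (Y2 : 1 < #|Y|) (hcX : conn bX X (bits PX cX)) (hcY : conn bY Y (bits PY cY)).

(** One plane of [X] against all of [Y]: [step_dichotomy] with the plane as space of lines and [Y]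
    as the growing face. A second use of it, with [Y] as space of lines and [X] growing, gives
    [leaf_dichotomy]. *)
Lemma plane_leaf_dichotomy a i j : agree X cX a -> i \in X -> j \in X -> dd bX i j (bits PX a) ->
  (forall b, agree Y cY b -> good (agree [set i; j] a) HX (f^~ b)) \/
  (forall b1 b2, agree Y cY b1 -> agree Y cY b2 -> HY b1 = HY b2 ->
     forall a', agree [set i; j] a a' -> f a' b1 = f a' b2).
Proof.
move=> aa iX jX hij.
have ij : i != j by apply: contraTneq hij => ->; rewrite dd_same.
have sX' : [set i; j] \subset X by rewrite subUset !sub1set iX.
have aX a' : agree [set i; j] a a' -> agree X cX a'.
  by move=> h; apply: agree_trans aa _; apply: agree_sub h.
have i2 : i \in [set i; j] by rewrite !inE eqxx.
have LS := @kval_linespace I PX QX X sX bX [set i; j] a i sX' i2 (pair_conn hij ij).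
have hHX := @lat_kval I PX QX X sX bX; have hHY := @lat_kval I PY QY Y sY bY.
apply: (step_dichotomy LS QXY (g := fun b => f^~ b)) => //.
- move=> m [y [k [ay kY hm]]].
  have am t : agree Y cY (m t) by have [_ ->] := hm t; apply: agree_upd.
  split.
  + by move=> r b' db; rewrite f0 //; [have [-> _] := hm r | exact: aX].
  + move=> b' db r r'; have [e1 e2] := hm r; have [e1' e2'] := hm r'.
    rewrite e2 e2' => /(fY (aX _ db) ay kY) e.
    by rewrite -e1 -e1' e2 e2' e.
  move=> m' r [z [u [az uX hm']]] t t'; have [e1 e2] := hm' t; have [e1' e2'] := hm' t'.
  rewrite e2 e2' => /(fX (aX _ az) (am r) (subsetP sX' _ uX)) e.
  by rewrite -e1 -e1' e2 e2' e.
move=> y k l ay kY lY hkl.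
have [h|h] := face_dichotomy aa iX jX hij ay kY lY hkl; [left | right].
  by move=> y' ay' a1 a2 d1 d2 e; apply: h.
by move=> b1 b2 ab1 ab2 e b' db; apply: h.
Qed.

Theorem leaf_dichotomy :
  (forall a1 a2, agree X cX a1 -> agree X cX a2 -> HX a1 = HX a2 ->
     forall b, agree Y cY b -> f a1 b = f a2 b) \/
  (forall b1 b2, agree Y cY b1 -> agree Y cY b2 -> HY b1 = HY b2 ->
     forall a, agree X cX a -> f a b1 = f a b2).
Proof.
have /card_gt0P[k0 k0Y] : 0 < #|Y| by apply: ltnW.
have LS := @kval_linespace I PY QY Y sY bY Y cY k0 (subxx _) k0Y hcY.
have QYX : QY != QX by rewrite eq_sym.
have hHX := @lat_kval I PX QX X sX bX; have hHY := @lat_kval I PY QY Y sY bY.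
have [||h|h] := step_dichotomy LS QYX (g := f) (P := PX) (F := X) (s := sX) (be := bX) (c := cX) _ _ X2 hcX.
- move=> m [y [k [ay kX hm]]].
  have am t : agree X cX (m t) by have [_ ->] := hm t; apply: agree_upd.
  split.
  + by move=> r b' db; rewrite f0 // eq_sym; have [-> _] := hm r.
  + move=> b' db r r'; have [e1 e2] := hm r; have [e1' e2'] := hm r'.
    rewrite e2 e2' => /(fX ay db kX) e.
    by rewrite -e1 -e1' e2 e2' e.
  move=> m' r [z [u [az uY hm']]] t t'; have [e1 e2] := hm' t; have [e1' e2'] := hm' t'.
  rewrite e2 e2' => /(fY (am r) az uY) e.
  by rewrite -e1 -e1' e2 e2' e.
- move=> a i j aa iX jX hij.
  have [h|h] := plane_leaf_dichotomy aa iX jX hij; [right | left].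
    by move=> a1 a2 d1 d2 e b db; apply: h.
  by move=> a' da b1 b2 d1 d2 e; apply: h.
- by right=> b1 b2 d1 d2 e a da; apply: h.
by left=> a1 a2 d1 d2 e b db; apply: h.
Qed.
End TwoLeaves.

(** * Balanced functions and shadows *)

Definition bal (g : V -> bool) : bool := count g vs == 2.

Ltac bal_tac g := move: (g (false, false)) (g (false, true)) (g (true, false)) (g (true, true)).

Lemma bal_other g a : bal g -> exists2 b, b != a & g b = g a.
Proof.
move=> hb; suff /hasP[b _ /andP[? /eqP]] : has (fun b => (b != a) && (g b == g a)) vs by exists b.
move: hb; rewrite /bal /=; case: a => [[] []]; bal_tac g; by do 4!case.
Qed.
Lemma bal_rest g a b c : bal g -> a != b -> g a = g b -> c != a -> c != b -> g c = ~~ g a.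
Proof.
rewrite /bal /=; case: a => [[] []]; case: b => [[] []] //; case: c => [[] []] //; bal_tac g; by do 4!case.
Qed.
Lemma bal_diff g g' a : bal g -> bal g' -> g a != g' a -> exists2 b, b != a & g b != g' b.
Proof.
move=> hb hb' ha; suff /hasP[b _ /andP[? ?]] : has (fun b => (b != a) && (g b != g' b)) vs by exists b.
move: hb hb' ha; rewrite /bal /=; case: a => [[] []]; bal_tac g; bal_tac g'; by do 8!case.
Qed.
Lemma bal_neg g : bal g -> bal (fun a => ~~ g a).
Proof. by rewrite /bal /=; bal_tac g; do 4!case. Qed.

Definition flp (u : V) : V := (u.1, ~~ u.2).
Lemma flpK u : flp (flp u) = u. Proof. by case: u => [[] []]. Qed.
Lemma flp_neq u : flp u != u. Proof. by case: u => [[] []]. Qed.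

Section Shadow.
Variable I : finType.
Notation pt := {ffun I -> V}.
Implicit Types (x y z c : pt) (F : {set I}).

(** The model: [ga z u] is the first bit of the value that one leaf must take at position [z] when
    the other leaf takes the value [u]. In [closed_on], [N] is the set of places where the leaf
    property fails. *)
Definition balanced_on F (c : pt) (ga : pt -> V -> bool) :=
  (forall z, agree F c z -> bal (ga z)) /\
  (forall z s u, agree F c z -> s \in F -> bal (fun a => ga (upd z s a) u)).
Definition closed_on F (c : pt) (ga : pt -> V -> bool) (N : pt -> V -> Prop) :=
  (forall z u v, agree F c z -> N z u -> ga z u = ga z v -> N z v) /\
  (forall z s u a, agree F c z -> s \in F -> N z u -> ga (upd z s a) u = ga z u -> N (upd z s a) u).
(** Mismatch: a pair of the partition by the first bit is split by [ga z]. *)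
Definition del (ga : pt -> V -> bool) z u := ga z u != ga z (flp u).

Lemma del_any ga z u v : bal (ga z) -> del ga z u -> del ga z v.
Proof.
rewrite /del /bal /=; case: u => [[] []]; case: v => [[] []] /=; bal_tac (ga z); by do 4!case.
Qed.

(** Induction on the free coordinates, within the layer of [z1] in one direction [s]. If [N] misses
    this layer, its shadow [N'] replaces it there; the shadow is again closed, so it meets a
    mismatch, and this is then carried to a layer in which [N] itself holds. *)
Lemma shadow_meets F c ga N z0 u0 z1 u1 :
  balanced_on F c ga -> closed_on F c ga N -> agree F c z0 -> agree F c z1 -> N z0 u0 -> del ga z1 u1 ->
  exists z u, [/\ agree F c z, N z u & del ga z u].
Proof.
have [n] := ubnP #|F|; elim: n F c ga N z0 u0 z1 u1 => // n IH F c ga N z0 u0 z1 u1 hn [b1 b2] [k1 k2] a0 a1 h0 h1.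
have [F0|/set0Pn[s sF]] := eqVneq F set0.
  have E : z0 = z1 by apply/ffunP => i; rewrite a0 ?F0 ?inE // a1 // F0 inE.
  by exists z0, u0; split=> //; rewrite E; apply: del_any h1; apply: b1.
have hn' : #|F :\ s| < n by move: hn; rewrite (cardsD1 s F) sF.
have sub : F :\ s \subset F by apply: subsetDl.
pose c' := upd c s (z1 s).
have a1' : agree (F :\ s) c' z1.
  move=> i; rewrite !inE negb_and negbK updE; case: eqP => [->|_] //=; exact: a1.
have up z : agree (F :\ s) c' z -> agree F c z.
  by move=> h i iF; rewrite h ?inE ?(negbTE iF) ?andbF // updE; case: eqP iF => // ->; rewrite sF.
have zs z : agree (F :\ s) c' z -> z s = z1 s.
  by move=> h; rewrite h ?inE ?eqxx // updE eqxx.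
have B : balanced_on (F :\ s) c' ga.
  split=> [z /up|z t u /up az]; first exact: b1.
  by rewrite inE => /andP[_]; apply: b2.
have [[z [u [az nz]]]|noN] := classic (exists z u, agree (F :\ s) c' z /\ N z u).
  have [|z' [u' [az' nz' dz']]] := IH (F :\ s) c' ga N z u z1 u1 hn' B _ az a1' nz h1.
    split=> [x v w /up|x t v a /up ax]; first exact: k1.
      by rewrite inE => /andP[_]; apply: k2.
  by exists z', u'; split=> //; apply: up.
pose ka := ga z0 u0.
(* If [ga] took the value [ka] on the layer below a point of [N] with value [ka], closedness would
   carry [N] into the layer. So the shadow can only lie where [ga] is the negation of [ka]. *)
pose N' z v := ga z v = ~~ ka /\ forall a, ga (upd z s a) v = ka -> N (upd z s a) v.
have au z a : agree F c z -> agree F c (upd z s a) by apply: agree_upd.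
have two z v a b : agree F c z -> ga (upd z s a) v = ka -> ga (upd z s b) v = ka ->
     N (upd z s a) v -> N (upd z s b) v.
  move=> az ea eb na; have := k2 (upd z s a) s v b (au _ _ az) sF na.
  by rewrite upd_upd ea eb; apply.
(* Two pairs of positions among the three remaining layers have a common element. *)
have share z v w y t : agree F c z -> agree F c y -> ga (upd z s t) v = ~~ ka -> ga (upd y s t) w = ~~ ka ->
    exists a, ga (upd z s a) v = ka /\ ga (upd y s a) w = ka.
  move=> az ay ev ew; have := b2 z s v az sF; have := b2 y s w ay sF.
  move: ev ew; set g := fun a => ga (upd z s a) v; set g' := fun a => ga (upd y s a) w.
  rewrite -[ga (upd z s t) v]/(g t) -[ga (upd y s t) w]/(g' t) => e1 e2 h2 h3.
  suff /hasP[a _ /andP[/eqP ? /eqP ?]] : has (fun a => (g a == ka) && (g' a == ka)) vs by exists a.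
  move: e1 e2 h2 h3; rewrite /bal /=; clear; case: t => [[] []]; bal_tac g; bal_tac g'; generalize ka; by case; do 8!case.
have K' : closed_on (F :\ s) c' ga N'.
  split=> [z u v az [e hN] euv|z t u b az tF [e hN] eu].
    split=> [|b eb]; first by rewrite -euv.
    have ez : upd z s (z1 s) = z by rewrite -(zs _ az) upd_eq.
    have [||a [ea1 ea2]] := @share z u v z (z1 s) (up _ az) (up _ az); rewrite ?ez // -?euv //.
    apply: (two _ _ a) => //; first exact: up.
    by apply: k1 (hN _ ea1) _; rewrite ?ea1 ?ea2 //; apply/au/up.
  have ab : agree (F :\ s) c' (upd z t b) by apply: agree_upd.
  have tF' := subsetP sub _ tF; have st : t != s by move: tF; rewrite !inE => /andP[].
  split=> [|d ed]; first by rewrite eu.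
  have ez y : agree (F :\ s) c' y -> upd y s (z1 s) = y by move/zs => <-; rewrite upd_eq.
  have [||a [ea1 ea2]] := @share z u u (upd z t b) (z1 s) (up _ az) (up _ ab); rewrite ?ez // ?eu //.
  apply: (two _ _ a) => //; first exact: up.
  rewrite updC // ; apply: k2 (hN _ ea1) _ => //; first by apply/au/up.
  by rewrite -updC // ea1 ea2.
have n0' : N' (upd z0 s (z1 s)) u0.
  have az : agree (F :\ s) c' (upd z0 s (z1 s)).
    move=> i; rewrite !inE negb_and negbK !updE; case: eqP => //= _; exact: a0.
  split.
    have [e|] := eqVneq (ga (upd z0 s (z1 s)) u0) ka; last by generalize ka; case: (ga _ _) => -[].
    case: noN.
    exists (upd z0 s (z1 s)), u0; split=> //; exact: k2.
  by move=> a; rewrite upd_upd => e; apply: k2.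
have az0 : agree (F :\ s) c' (upd z0 s (z1 s)).
  move=> i; rewrite !inE negb_and negbK !updE; case: eqP => //= _; exact: a0.
have [z [v [az [ev hN] dz]]] := IH (F :\ s) c' ga N' _ u0 z1 u1 hn' B K' az0 a1' n0' h1.
have az' := up _ az; have ez : upd z s (z1 s) = z by rewrite -(zs _ az) upd_eq.
have [a na da] : exists2 a, a != z1 s & ga (upd z s a) v != ga (upd z s a) (flp v).
  by apply: (bal_diff (b2 z s v az' sF) (b2 z s (flp v) az' sF)); rewrite ez.
have [ea|ea] := eqVneq (ga (upd z s a) v) ka.
  by exists (upd z s a), v; split; [apply: au | apply: hN |].
have [v' nv ev'] := bal_other v (b1 z az').
have N'v : N' z v' by apply: (K'.1 z v v' az (conj ev hN)).
have dv' : del ga (upd z s a) v' by apply: (@del_any _ _ v); [apply/b1/au | ].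
have [ea'|ea'] := eqVneq (ga (upd z s a) v') ka.
  by exists (upd z s a), v'; split; [apply: au | apply: N'v.2 |].
(* If neither [v] nor [v'] succeeds in layer [a], balance along [s] gives both of them the value
   [ka] in every remaining layer, and balance in the value then separates [v] from [flp v] there. *)
have [a2 ha] : exists a2, (a2 != z1 s) && (a2 != a).
  have /hasP[a2 _ ?] : has (fun a2 => (a2 != z1 s) && (a2 != a)) vs; last by exists a2.
  by clear; case: (z1 s) => [[] []]; case: a => [[] []].
have /andP[ha1 ha2] := ha.
have R w : ga z w = ~~ ka -> ga (upd z s a) w != ka -> ga (upd z s a2) w = ka.
  move=> e1 e2; have := bal_rest (b2 z s w az' sF) (a := z1 s) (b := a) (c := a2).
  rewrite /= ez eq_sym na e1 => -> //; first by rewrite negbK.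
  by move: e2; generalize ka; case: (ga _ _) => -[].
have r1 := R v ev ea; have r2 := R v' (etrans ev' ev) ea'.
exists (upd z s a2), v; split; [exact: au | exact: hN |].
rewrite /del r1; have nf : flp v != v' by apply: contraTneq dz => e; rewrite /del e ev' eqxx.
rewrite (bal_rest (b1 _ (au _ a2 az')) (a := v) (b := v') (c := flp v)) ?flp_neq // ?r1 ?r2 //; first by generalize ka; case.
by rewrite eq_sym.
Qed.

(** Both [u] and the other value [u'] with the same bit continue [N] into a new layer. If the
    mismatch is lost each time, the two new layers are distinct, and balance forces the mismatch
    into the last layer, at [flp u]. *)
Lemma shadow_moves F c ga N z u s :
  balanced_on F c ga -> closed_on F c ga N -> agree F c z -> s \in F -> N z u -> del ga z u ->
  exists a v, [/\ a != z s, N (upd z s a) v & del ga (upd z s a) v].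
Proof.
move=> [b1 b2] [k1 k2] az sF nz dz.
have au a : agree F c (upd z s a) by apply: agree_upd.
have ez : upd z s (z s) = z by rewrite upd_eq.
have [u' nu eu] := bal_other u (b1 z az).
have nz' : N z u' by apply: k1 nz _.
have nf : u' != flp u by apply: contraTneq dz => e; rewrite /del -e eu eqxx.
have C w : N z w -> exists a, [/\ a != z s, N (upd z s a) w & ga (upd z s a) w = ga z w].
  move=> nw; have [a na ea] := bal_other (z s) (b2 z s w az sF).
  by exists a; rewrite /= ez in ea; split=> //; apply: k2.
have [a1 [n1 m1 e1]] := C u nz; have [a2 [n2 m2 e2]] := C u' nz'.
have [d1|d1] := boolP (del ga (upd z s a1) u); first by exists a1, u.
have [d2|d2] := boolP (del ga (upd z s a2) u'); first by exists a2, u'.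
move: d1 d2; rewrite /del !negbK => /eqP d1 /eqP d2.
have [e12|ne] := eqVneq a1 a2.
  subst a2; have := bal_rest (b1 _ (au a1)) (a := u) (b := flp u) (c := u').
  rewrite eq_sym flp_neq -d1 nu nf => /(_ isT (erefl _) isT isT).
  by rewrite e1 e2 eu; case: (ga z u).
have [a3 /and3P[h1 h2 h3]] : exists a3, [&& a3 != z s, a3 != a1 & a3 != a2].
  have /hasP[a3 _ ?] : has (fun a3 => [&& a3 != z s, a3 != a1 & a3 != a2]) vs; last by exists a3.
  by move: n1 n2 ne; clear; case: (z s) => [[] []]; case: a1 => [[] []]; case: a2 => [[] []].
have g3 : ga (upd z s a3) u = ~~ ga z u.
  have := bal_rest (b2 z s u az sF) (a := z s) (b := a1) (c := a3).
  by rewrite /= ez e1 eq_sym n1; apply.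
have g3' : ga (upd z s a3) u' = ~~ ga z u.
  have := bal_rest (b2 z s u' az sF) (a := z s) (b := a2) (c := a3).
  by rewrite /= ez e2 eu eq_sym n2; apply.
have g4 : ga (upd z s a3) (flp u) = ga z u.
  have := bal_rest (b1 _ (au a3)) (a := u) (b := u') (c := flp u).
  by rewrite g3 g3' negbK eq_sym nu flp_neq [flp u == _]eq_sym nf; apply.
exists a3, (flp u); split=> //; last by rewrite /del flpK g3 g4; case: (ga z u).
have m1' : N (upd z s a1) (flp u) by apply: k1 m1 d1.
have := k2 (upd z s a1) s (flp u) a3 (au _) sF m1'; rewrite upd_upd; apply.
by rewrite g4 -d1 e1.
Qed.
End Shadow.

(** * Leaves of a code *)

Section Codes.
Variable I : finType.
Notation pt := {ffun I -> V}.
Notation bt := {ffun I -> bool}.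
Implicit Types (x y z c p : pt) (l : bt) (S F X Y : {set I}).

(* The graph of an n-quasigroup is a set of points with n+1 coordinates in which every coordinate
   is determined by the others; this makes the value and the arguments interchangeable. *)
Definition mds (M : pt -> bool) :=
  (forall x i, exists a, M (upd x i a)) /\
  (forall x i a b, M (upd x i a) -> M (upd x i b) -> a = b).

Definition kv P X be := kval P None X false be.

(* A leaf is a block X of the face (S, c) such that membership in M compares a quasigroup of the
   coordinates in X with a function of the others, where the quasigroup is affine up to a connected
   function of the bits [lf]. *)
Record leaf (M : pt -> bool) S c X P be (U : pt -> V) : Prop := Leaf {
  leaf_sub : X \subset S;
  leaf_card : 1 < #|X|;
  leaf_conn : conn be X (bits P c);
  leaf_dep : forall l l', {in X, l =1 l'} -> be l = be l';
  leaf_off : forall x y, agree X x y -> U x = U y;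
  leaf_eq : forall x, agree S c x -> M x = (kv P X be x == U x) }.

Lemma conn_dep be X l0 l1 : (forall l l', {in X, l =1 l'} -> be l = be l') ->
  conn be X l0 -> conn be X l1.
Proof.
move=> hd hc U sU U0 UF; have [i [j [l [iU jU al dl]]]] := hc U sU U0 UF.
exists i, j, [ffun k => if k \in X then l k else l1 k]; split=> //.
  by move=> k kX; rewrite ffunE (negbTE kX).
suff <- : dd be i j l = dd be i j [ffun k => if k \in X then l k else l1 k] by [].
rewrite /dd; do 3 (congr addb; last by apply: hd => k kX; rewrite !ffunE kX).
by apply: hd => k kX; rewrite ffunE kX.
Qed.

Lemma kv_dep P X be x y : (forall l l', {in X, l =1 l'} -> be l = be l') ->
  {in X, x =1 y} -> kv P X be x = kv P X be y.
Proof.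
move=> hd e; rewrite /kv /kval; congr dec; congr addb.
- by apply: eq_sumb => i iX; rewrite e.
- by apply: eq_sumb => i iX; rewrite e.
by apply: hd => i iX; rewrite !ffunE e.
Qed.

Definition vx (a b : V) : V := (a.1 (+) b.1, a.2 (+) b.2).
Lemma vx_inj b : injective (vx^~ b).
Proof. by move: b => [[] []] [[] []] [[] []]. Qed.
Lemma vx_zr a b : (vx a b == zr) = (a == b).
Proof. by case: a => [[] []]; case: b => [[] []]. Qed.

Section Completion.
Variables (M : pt -> bool) (w : I) (w0 : V).
Hypothesis hM : mds M.
Definition cmp x : V := odflt zr [pick a | M (upd x w a)].
(** The completion in direction [w], shifted so that the value [zr] means membership in the
    hyperplane where the coordinate [w] equals [w0]. *)
Definition phi x : V := vx (cmp x) w0.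
Lemma cmpP x : M (upd x w (cmp x)).
Proof.
rewrite /cmp; case: pickP => // h; have [a ha] := hM.1 x w.
by have := h a; rewrite ha.
Qed.
Lemma phi0 x : (phi x == zr) = M (upd x w w0).
Proof.
rewrite /phi vx_zr; apply/eqP/idP => [<-|h]; first exact: cmpP.
exact: hM.2 (cmpP x) h.
Qed.
Lemma phi_upd x a : phi (upd x w a) = phi x.
Proof. by rewrite /phi /cmp; congr vx; congr odflt; apply: eq_pick => b; rewrite upd_upd. Qed.
Lemma phi_inj x i a b : i != w -> phi (upd x i a) = phi (upd x i b) -> a = b.
Proof.
move=> iw /vx_inj e; have h1 := cmpP (upd x i a); have h2 := cmpP (upd x i b).
by rewrite e updC // in h1; rewrite updC // in h2; apply: hM.2 h1 h2.
Qed.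
End Completion.

Section OneLeaf.
Variables (M : pt -> bool) (S : {set I}) (w : I) (c : pt).
Hypotheses (hM : mds M) (wS : w \in S).
Local Notation S0 := (S :\ w).
Variables (Y : {set I}) (P : I -> option bool) (be : bt -> bool) (U : pt -> V).
Hypothesis LY : leaf M S0 c Y P be U.
Local Notation K := (kv P Y be).
Local Notation f := (phi M w (c w)).

Lemma leaf_lat : lat K Y. Proof. exact: lat_kval. Qed.
Lemma leaf_wY i : i \in Y -> i \in S0. Proof. exact: (subsetP (leaf_sub LY)). Qed.
Lemma leaf_ex : exists k, k \in Y.
Proof. by apply/card_gt0P/ltnW/(leaf_card LY). Qed.
Lemma K_upd x i a : i \notin Y -> K (upd x i a) = K x.
Proof.
move=> iY; apply: (kv_dep _ (leaf_dep LY)) => j jY; rewrite updE.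
by case: eqP => // e; rewrite -e jY in iY.
Qed.
Lemma U_upd x i a : i \in Y -> U (upd x i a) = U x.
Proof.
move=> iY; apply/esym/(leaf_off LY) => j jY; rewrite updE.
by case: eqP => // e; rewrite e iY in jY.
Qed.
Lemma face_w x : agree S0 c x -> upd x w (c w) = x.
Proof. by move=> h; rewrite -{2}(upd_eq x w) h // !inE eqxx. Qed.
Lemma phiM x : agree S0 c x -> (f x == zr) = (K x == U x).
Proof. by move=> ax; rewrite phi0 // face_w // (leaf_eq LY). Qed.
Lemma inS0_w i : i \in S0 -> i != w. Proof. by rewrite !inE => /andP[]. Qed.

Lemma U_inj x i : agree S0 c x -> i \in S0 -> i \notin Y -> injective (fun a => U (upd x i a)).
Proof.
move=> ax iS iY a b /= e; have [k kY] := leaf_ex.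
pose y := thru K x k (U (upd x i a)).
have [e1 e2] := thruP x (U (upd x i a)) leaf_lat kY.
have ay : agree S0 c y by rewrite /y e2; apply: agree_upd => //; apply: leaf_wY.
have ki : k != i by apply: contraNneq iY => <-.
have m d : U (upd x i d) = U (upd x i a) -> M (upd y i d).
  move=> ed; rewrite (leaf_eq LY); last exact: agree_upd.
  rewrite K_upd // e1 -ed; apply/eqP; rewrite -/y /y e2.
  by rewrite updC // [RHS]U_upd.
by apply: hM.2 (m a (erefl _)) (m b (esym e)).
Qed.

(** At the position [x] the block remains a leaf outside the hyperplane too: the completion still
    depends on the coordinates in [Y] only through [K]. *)
Definition lgd x := good (agree Y x) K f.

Lemma lgd_agree x y : agree Y x y -> lgd x -> lgd y.
Proof. by move=> h g b b' ab ab'; apply: g; apply: agree_trans h _. Qed.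

(** Relabelling the coordinate [i] by the value of [U] turns the completions into a family over the
    lines of [Y], whose partition is the one by the first bit; then [good_partner] applies. *)
Lemma lgd_move x i a b : agree S0 c x -> i \in S0 -> i \notin Y ->
  (U (upd x i a)).1 = (U (upd x i b)).1 -> lgd (upd x i a) -> lgd (upd x i b).
Proof.
move=> ax iS iY e; have inj := U_inj ax iS iY; have [k kY] := leaf_ex.
have LS := @kval_linespace I P None Y false be Y x k (subxx _) kY (conn_dep _ (leaf_dep LY) (leaf_conn LY)).
have iw := inS0_w iS.
have aY y : agree Y x y -> agree S0 c y.
  by move=> h; apply: agree_trans ax _; apply: agree_sub h; exact: leaf_sub LY.
pose g r y := f (upd y i (invF inj r)).
have fg : fam (agree Y x) K (cline K Y x) g.
  split.
  - move=> r y ay; rewrite phiM; last by apply: agree_upd => //; apply: aY.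
    rewrite K_upd //; congr (_ == _); rewrite -{2}(f_invF inj r) /=; apply/esym/(leaf_off LY).
    by move=> j jY; rewrite !updE ay.
  - move=> y ay r r' /= er; have := phi_inj hM iw er.
    by move/(congr1 (fun a => U (upd x i a))); rewrite !(f_invF inj).
  move=> m r [y [j [ay jY hm]]] t t'; have [e1 e2] := hm t; have [e1' e2'] := hm t'.
  have ji : j != i by apply: contraNneq iY => <-.
  rewrite /g e2 e2' updC // [X in _ = f X]updC // => /(phi_inj hM (inS0_w (leaf_wY jY))) E.
  by rewrite -e1 -e1' e2 e2' E.
have gE d : lgd (upd x i d) <-> good (agree Y x) K (g (U (upd x i d))).
  have Ei : invF inj (U (upd x i d)) = d by rewrite -{2}(invF_f inj d).
  split=> h y y' ay ay' ek.
    rewrite /g Ei; apply: h; rewrite ?K_upd //.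
      by move=> j jY; rewrite !updE ay.
    by move=> j jY; rewrite !updE ay'.
  have E z : agree Y (upd x i d) z -> z = upd (upd z i (x i)) i d /\ agree Y x (upd z i (x i)).
    move=> az; have zi : z i = d by rewrite az // updE eqxx.
    split; first by rewrite upd_upd -zi upd_eq.
    by move=> j jY; rewrite updE; case: eqP => [->|/eqP/negbTE ji] //; rewrite az // updE ji.
  have [E1 a1] := E _ ay; have [E2 a2] := E _ ay'; rewrite E1 E2.
  by have := h _ _ a1 a2; rewrite /g Ei; apply; rewrite !K_upd.
move/gE => h; apply/gE; exact: (good_partner LS fg e h).
Qed.
End OneLeaf.
End Codes.

(* Every permutation of a four-element set permutes its three partitions into pairs. *)
Lemma perm_affine (G : V -> V) : injective G -> exists Q k d e, forall u,
  lf Q (G u) = u.1 (+) k /\ mf Q (G u) = u.2 (+) (d && u.1) (+) e.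
Proof.
move=> inj; pose bs := [:: true; false].
suff /hasP[Q _ /hasP[k _ /hasP[d _ /hasP[e _ /allP h]]]] :
   has (fun Q => has (fun k => has (fun d => has (fun e => all (fun u =>
     (lf Q (G u) == u.1 (+) k) && (mf Q (G u) == u.2 (+) (d && u.1) (+) e)) vs) bs) bs) bs) parts.
  by exists Q, k, d, e => u; have /andP[/eqP ? /eqP ?] := h u (mem_vs u).
have : uniq [seq G u | u <- vs] by rewrite map_inj_uniq.
rewrite /=; move: (G (false, false)) (G (false, true)) (G (true, false)) (G (true, true)).
by case=> [[] []] [[] []] [[] []] [[] []].
Qed.

Lemma bal_inj (G : V -> V) : injective G -> bal (fun u => (G u).1).
Proof.
move=> inj; have : uniq [seq G u | u <- vs] by rewrite map_inj_uniq.
rewrite /bal /=; move: (G (false, false)) (G (false, true)) (G (true, false)) (G (true, true)).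
by case=> [[] []] [[] []] [[] []] [[] []].
Qed.

Lemma eq_fst (u v : V) : u.1 = v.1 -> v = u \/ v = flp u.
Proof. by case: u => [[] []]; case: v => [[] []] //; auto. Qed.

Section TwoLeavesCode.
Variable I : finType.
Notation pt := {ffun I -> V}.
Notation bt := {ffun I -> bool}.
Implicit Types (x y z p : pt) (l : bt).
Variables (M : pt -> bool) (S : {set I}) (w : I) (c : pt).
Hypotheses (hM : mds M) (wS : w \in S).
Local Notation S0 := (S :\ w).
Variables (X : {set I}) (PX : I -> option bool) (bX : bt -> bool) (UX : pt -> V).
Variables (Y : {set I}) (PY : I -> option bool) (bY : bt -> bool) (UY : pt -> V).
Hypothesis LX : leaf M S0 c X PX bX UX.
Hypothesis LY : leaf M S0 c Y PY bY UY.
Hypothesis dXY : [disjoint X & Y].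
Local Notation KX := (kv PX X bX).
Local Notation KY := (kv PY Y bY).
Local Notation f := (phi M w (c w)).

(* At the position z the bijection between the values of the two leaves does not respect the
   partitions given by the first bit. *)
Definition mism z := exists p q, [/\ agree (X :|: Y) z p, agree (X :|: Y) z q, M p, M q &
   ((KX p).1 == (KX q).1) != ((KY p).1 == (KY q).1)].

Lemma notXY i : i \in X -> i \notin Y. Proof. by move/(disjointFr dXY)->. Qed.
Lemma notYX i : i \in Y -> i \notin X. Proof. by move/(disjointFl dXY)->. Qed.
Lemma XS0 i : i \in X -> i \in S0. Proof. exact: (subsetP (leaf_sub LX)). Qed.
Lemma YS0 i : i \in Y -> i \in S0. Proof. exact: (subsetP (leaf_sub LY)). Qed.
Lemma agX x y : agree S0 c x -> agree X x y -> agree S0 c y.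
Proof. by move=> ax h; apply: agree_trans ax _; apply: agree_sub h; exact: leaf_sub LX. Qed.
Lemma agY x y : agree S0 c x -> agree Y x y -> agree S0 c y.
Proof. by move=> ax h; apply: agree_trans ax _; apply: agree_sub h; exact: leaf_sub LY. Qed.
Lemma agXY x y : agree S0 c x -> agree (X :|: Y) x y -> agree S0 c y.
Proof.
move=> ax h; apply: agree_trans ax _; apply: agree_sub h.
by rewrite subUset (leaf_sub LX) (leaf_sub LY).
Qed.

Definition setX x i u := thru KX x i u.
Lemma setXP x i u : i \in X -> KX (setX x i u) = u /\ setX x i u = upd x i (setX x i u i).
Proof. by move=> iX; apply: thruP iX; apply: leaf_lat. Qed.
Lemma setY_P x k u : k \in Y -> KY (thru KY x k u) = u /\ thru KY x k u = upd x k (thru KY x k u k).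
Proof. by move=> kY; apply: thruP kY; apply: leaf_lat. Qed.
Lemma setX_agree x i u : i \in X -> agree X x (setX x i u).
Proof. by move=> iX; have [_ ->] := setXP x u iX; apply: agree_upd. Qed.
Lemma setY_agree x k u : k \in Y -> agree Y x (thru KY x k u).
Proof. by move=> kY; have [_ ->] := setY_P x u kY; apply: agree_upd. Qed.

Lemma KX_agY x y : agree Y x y -> KX y = KX x.
Proof. by move=> h; apply: (kv_dep _ (leaf_dep LX)) => i iX; rewrite h // notXY. Qed.
Lemma KY_agX x y : agree X x y -> KY y = KY x.
Proof. by move=> h; apply: (kv_dep _ (leaf_dep LY)) => i iY; rewrite h // notYX. Qed.

(** Both leaves describe the same codewords: complete [x] to a codeword inside [Y], change the
    coordinates in [X] without changing the value of [X], and read off the value demanded of [Y]. *)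
Lemma UY_fun x y : agree S0 c x -> agree X x y -> KX x = KX y -> UY x = UY y.
Proof.
move=> ax axy e; have [k kY] := leaf_ex LY.
pose x' := thru KY x k (UY x); have [e1 e2] := setY_P x (UY x) kY.
have ax' : agree S0 c x' by apply: (agY ax); apply: setY_agree.
have ux' : UY x' = UY x by rewrite /x' e2 (U_upd LY).
have Mx' : M x' by rewrite (leaf_eq LY) // e1 ux'.
pose y' := upd y k (x' k).
have axy' : agree X x' y'.
  move=> i iX; rewrite /y' /x' updE; case: eqP => [->|/eqP/negbTE ik] //.
  by rewrite axy // e2 updE ik.
have ay' : agree S0 c y' by apply: agX axy'.
have My' : M y'.
  rewrite (leaf_eq LX) // -(leaf_off LX axy').
  have : KX x' == UX x' by rewrite -(leaf_eq LX).
  move/eqP => <-; rewrite /y' (K_upd LX) ?notYX // -e.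
  by rewrite (KX_agY (setY_agree x _ kY)).
have : KY y' == UY y' by rewrite -(leaf_eq LY).
by rewrite (KY_agX axy') e1 (U_upd LY) // => /eqP.
Qed.

Lemma UY_setX_inj x i : agree S0 c x -> i \in X -> injective (fun u => UY (setX x i u)).
Proof.
move=> ax iX u v e; have [e1 e2] := setXP x u iX; have [e3 e4] := setXP x v iX.
have inj := U_inj hM LY ax (XS0 iX) (notXY iX).
by rewrite -e1 -e3 e2 e4; congr (KX (upd _ _ _)); apply: inj; rewrite -e2 -e4.
Qed.

Lemma mism_del z i : agree S0 c z -> i \in X -> mism z ->
  forall u, (UY (setX z i u)).1 != (UY (setX z i (flp u))).1.
Proof.
move=> az iX [p [q [ap aq Mp Mq ne]]] u.
have b := bal_inj (UY_setX_inj az iX).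
have Sp r : agree (X :|: Y) z r -> M r -> UY (setX z i (KX r)) = KY r.
  move=> ar Mr; have ar' := agXY az ar.
  have : KY r == UY r by rewrite -(leaf_eq LY).
  move/eqP => ->.
  pose r' := mix X r z.
  have h1 : UY r' = UY r.
    apply/esym/(leaf_off LY) => j jY; rewrite mixE; case: ifP => // /negbT jX.
    by rewrite ar // inE negb_or jX.
  have h2 : agree X (setX z i (KX r)) r'.
    move=> j jX; rewrite mixE (negbTE jX).
    by have [_ ->] := setXP z (KX r) iX; rewrite updE; case: eqP jX => // ->; rewrite iX.
  rewrite -h1; apply: UY_fun => //; first by apply: (agX az); apply: setX_agree.
  have [-> _] := setXP z (KX r) iX.
  by apply: (kv_dep _ (leaf_dep LX)) => j jX; rewrite mixE jX.
have := Sp p ap Mp; have := Sp q aq Mq => e1 e2.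
pose ga := fun (_ : pt) u => (UY (setX z i u)).1.
apply: (@del_any I ga z (KX p)); first exact: b.
rewrite /del /ga e2.
have [e|n1] := eqVneq (KX p).1 (KX q).1.
  move: ne; rewrite e eqxx; have [eq|eq] := eq_fst e.
    by have : KY p = KY q; [rewrite -e1 -e2 eq | move=> ->; rewrite eqxx].
  by rewrite -eq e1; case: ((KY p).1 == _).
move: ne; rewrite (negbTE n1); case: ((KY p).1 =P _) => // n2 _.
have pq : KX q != KX p by apply: contraNneq n1 => ->.
have -> : (UY (setX z i (flp (KX p)))).1 = ~~ (UY (setX z i (KX p))).1.
  apply: (bal_rest b (b := KX q)); rewrite ?e1 ?e2 ?n2 ?flp_neq //; first by rewrite eq_sym.
  by apply: contraNneq n1 => <-.
by rewrite e2; case: (KY p).1.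
Qed.

Lemma del_mism z i u : agree S0 c z -> i \in X ->
  (UY (setX z i u)).1 != (UY (setX z i (flp u))).1 -> mism z.
Proof.
move=> az iX ne; have [k kY] := leaf_ex LY.
pose r v := thru KY (setX z i v) k (UY (setX z i v)).
have rP v : [/\ agree (X :|: Y) z (r v), M (r v), KX (r v) = v & KY (r v) = UY (setX z i v)].
  have a1 := setX_agree z v iX; have [e1 _] := setXP z v iX.
  have a2 := setY_agree (setX z i v) (UY (setX z i v)) kY.
  have [e2 e3] := setY_P (setX z i v) (UY (setX z i v)) kY.
  have a3 : agree (X :|: Y) z (r v).
    apply: agree_trans (agree_sub _ a1) (agree_sub _ a2); [exact: subsetUl | exact: subsetUr].
  split=> //.
    rewrite (leaf_eq LY); last exact: agXY a3.
    by rewrite /r e2 e3 (U_upd LY).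
  by rewrite (KX_agY a2).
have [a1 m1 k1 k1'] := rP u; have [a2 m2 k2 k2'] := rP (flp u).
by exists (r u), (r (flp u)); split; rewrite // k1 k2 k1' k2' /= eqxx (negbTE ne).
Qed.

(** At [z] the value of [Y] is a permutation [G] of the value of [X]. It carries the partition by
    the first bit to a partition [Q], and the mismatch says that [Q] is not [None]; so
    [leaf_dichotomy] applies to [Q] and [None]. *)
Lemma mism_dichotomy z : agree S0 c z -> mism z ->
  (forall x, agree X z x -> lgd M w c Y PY bY x) \/ (forall y, agree Y z y -> lgd M w c X PX bX y).
Proof.
move=> az hm; have [i iX] := leaf_ex LX.
pose G u := UY (setX z i u); have injG : injective G := UY_setX_inj az iX.
have [Q [k [d [e hG]]]] := perm_affine injG.
pose b' l := bX l (+) (d && sumb X l) (+) e.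
have Qn : Q != None.
  apply: contraNneq (mism_del az iX hm (false, false)) => eQ.
  have [h1 _] := hG (false, false); have [h2 _] := hG (flp (false, false)).
  by rewrite eQ /= in h1 h2; rewrite -/(G _) -/(G (flp _)) /= h1 h2.
have UG a : agree X z a -> UY a = G (KX a).
  move=> aa; apply/esym/UY_fun.
  - by apply: (agX az); apply: setX_agree.
  - by apply: agree_trans (agree_sym (setX_agree z _ iX)) aa.
  by have [-> _] := setXP z (KX a) iX.
have HG a : agree X z a -> kval PX Q X k b' a = UY a.
  move=> aa; rewrite UG //; have [h1 h2] := hG (KX a).
  have Ea : KX a = dec None (sumb X (fun j => lf (PX j) (a j)) (+) false)
         (sumb X (fun j => mf (PX j) (a j)) (+) bX (bits PX a)) by [].
  rewrite -(dec_lm Q (G (KX a))) h1 h2 Ea /= addbF /kval /b'; congr dec.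
  have -> : sumb X (bits PX a) = sumb X (fun j => lf (PX j) (a j)).
    by apply: eq_sumb => j _; rewrite ffunE.
  by rewrite !addbA.
pose g a b := f (mix X a b).
have mp a b : agree X z a -> agree Y z b ->
   [/\ agree S0 c (mix X a b), KY (mix X a b) = KY b & UY (mix X a b) = UY a].
  move=> aa ab; split.
  - move=> j jS; rewrite mixE; case: ifP => jX; first by have := XS0 jX; rewrite (negbTE jS).
    by rewrite ab ?az //; apply: contraNN jS => /YS0.
  - by apply: (kv_dep _ (leaf_dep LY)) => j jY; rewrite mixE (negbTE (notYX jY)).
  apply/esym/(leaf_off LY) => j jY; rewrite mixE; case: ifP => // /negbT jX.
  by rewrite ab // aa.
have cX : conn b' X (bits PX z).
  have hc := conn_dep (bits PX z) (leaf_dep LX) (leaf_conn LX).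
  move=> T sT T0 TX; have [i' [j [l [iT jT al dl]]]] := hc T sT T0 TX.
  exists i', j, l; split=> //; have iX' := subsetP sT _ iT.
  have jX : j \in X by move: jT; rewrite inE => /andP[].
  move: dl; rewrite /dd /b' !sumb_flip // negbK; clear.
  move: (bX l) (bX (flipb l i')) (bX (flipb l j)) (bX (flipb (flipb l i') j)) (sumb X l).
  by case: d; case: e; do 5!case.
have cY := conn_dep (bits PY z) (leaf_dep LY) (leaf_conn LY).
have iw j : j \in S0 -> j != w by rewrite !inE => /andP[].
have [|||h|h] := @leaf_dichotomy I PX PY X Y Q None k false b' bY z z Qn g _ _ _ (leaf_card LX) (leaf_card LY) cX cY.
- move=> a b aa ab; have [a1 e1 e2] := mp a b aa ab.
  by rewrite /g (phiM hM LY) // e1 e2 HG // eq_sym.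
- move=> a b j aa ab jX u v; rewrite /g => er; apply: (phi_inj (w0 := c w) hM (iw _ (XS0 jX)) (x := mix X a b)).
  have E t : upd (mix X a b) j t = mix X (upd a j t) b.
    by apply/ffunP => m; rewrite !(updE, mixE); case: eqP => // ->; rewrite jX.
  by rewrite !E.
- move=> a b j aa ab jY u v; rewrite /g => er; apply: (phi_inj (w0 := c w) hM (iw _ (YS0 jY)) (x := mix X a b)).
  have E t : upd (mix X a b) j t = mix X a (upd b j t).
    by apply/ffunP => m; rewrite !(updE, mixE); case: eqP => // ->; rewrite (negbTE (notYX jY)).
  by rewrite !E.
- right=> y ay p q ap aq ek.
  have M' r : agree X y r -> f r = g (mix X r z) y.
    move=> ar; rewrite /g; congr (phi M w (c w) _); apply/ffunP => j; rewrite !mixE.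
    by have [jX|jX] := boolP (j \in X); rewrite // ar.
  have K' r : KX (mix X r z) = KX r by apply: (kv_dep _ (leaf_dep LX)) => j jX; rewrite mixE jX.
  rewrite !M' //; apply: h => //; try exact: agree_mix.
  by rewrite !HG ?UG ?K' ?ek //; exact: agree_mix.
left=> x ax p q ap aq ek.
have M' r : agree Y x r -> f r = g x (mix Y r z).
  move=> ar; rewrite /g; congr (phi M w (c w) _); apply/ffunP => j; rewrite !mixE.
  have [jX|jX] := boolP (j \in X); first by rewrite ar // notXY.
  by case: ifP => // /negbT jY; rewrite ar // ax.
have K' r : KY (mix Y r z) = KY r by apply: (kv_dep _ (leaf_dep LY)) => j jX; rewrite mixE jX.
rewrite !M' //; apply: h => //; try exact: agree_mix.
by have := K' p; have := K' q; rewrite /kv => -> ->.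
Qed.
End TwoLeavesCode.

Lemma bal_sub g h k : bal g -> bal h -> (forall a, g a = k -> h a) -> forall a, g a = k (+) ~~ h a.
Proof.
move=> bg bh hh.
have H : all (fun a => (g a == k) ==> h a) vs by apply/allP => a _; apply/implyP => /eqP /hh.
suff /allP H' : all (fun a => g a == k (+) ~~ h a) vs by move=> a; apply/eqP/H'/mem_vs.
move: bg bh H {hh}; rewrite /bal /=; bal_tac g; bal_tac h; case: k; by do 8!case.
Qed.
Lemma bal_pair g : bal g -> exists a b, [/\ a != b, g a & g b].
Proof.
move=> bg; suff /hasP[a _ /hasP[b _ /and3P[? ? ?]]] :
  has (fun a => has (fun b => [&& a != b, g a & g b]) vs) vs by exists a, b.
move: bg; rewrite /bal /=; bal_tac g; by do 4!case.
Qed.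

(** * The failures of the two leaves exclude each other *)

Section NoBoth.
Variable I : finType.
Notation pt := {ffun I -> V}.
Notation bt := {ffun I -> bool}.
Implicit Types (x y z p : pt) (l : bt) (Z : {set I}).
Variables (M : pt -> bool) (S : {set I}) (w : I) (c : pt).
Hypotheses (hM : mds M) (wS : w \in S).
Local Notation S0 := (S :\ w).

Section OneSide.
Variables (X : {set I}) (PX : I -> option bool) (bX : bt -> bool) (UX : pt -> V).
Variables (Y : {set I}) (PY : I -> option bool) (bY : bt -> bool) (UY : pt -> V).
Hypothesis LX : leaf M S0 c X PX bX UX.
Hypothesis LY : leaf M S0 c Y PY bY UY.
Hypothesis dXY : [disjoint X & Y].
Local Notation KX := (kv PX X bX).
Local Notation KY := (kv PY Y bY).
Local Notation gY := (lgd M w c Y PY bY).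
Variables (Z : {set I}) (c0 : pt).
Hypotheses (sZ : Z \subset S0) (dZX : [disjoint Z & X]) (dZY : [disjoint Z & Y]) (ac0 : agree S0 c c0).
Local Notation R := (agree (X :|: Y :|: Z) c0).

Lemma R_face x : R x -> agree S0 c x.
Proof.
move=> h; apply: agree_trans ac0 _; apply: agree_sub h.
by rewrite !subUset (leaf_sub LX) (leaf_sub LY).
Qed.
Lemma R_upd x i a : i \in X :|: Y :|: Z -> R x -> R (upd x i a).
Proof. exact: agree_upd. Qed.
Lemma Z_in s : s \in Z -> [/\ s \in S0, s \notin X & s \notin Y].
Proof. by move=> sZ'; rewrite (subsetP sZ _ sZ') (disjointFr dZX sZ') (disjointFr dZY sZ'). Qed.
Lemma ZR s : s \in Z -> s \in X :|: Y :|: Z. Proof. by move=> h; rewrite inE h orbT. Qed.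
Lemma XR s : s \in X -> s \in X :|: Y :|: Z. Proof. by move=> h; rewrite !inE h. Qed.

Definition gam i z u := (UY (setX X PX bX z i u)).1.
Definition bad i z u := ~ gY (setX X PX bX z i u).

Lemma setX_upd z s a i u : i \in X -> s \in Z ->
  setX X PX bX (upd z s a) i u = upd (setX X PX bX z i u) s a.
Proof.
move=> iX sZ'; have [_ sX sY] := Z_in sZ'.
have [e1 e2] := setXP PX bX (upd z s a) u iX; have [e3 e4] := setXP PX bX z u iX.
have si : s != i by apply: contraNneq sX => ->.
rewrite e2 [in RHS]e4 [in RHS]updC 1?eq_sym //; congr upd.
apply: (@leaf_lat I X PX bX (upd z s a) i iX); rewrite -e2 e1.
by rewrite [in RHS]updC // (K_upd LX) // -e4 e3.
Qed.

Lemma R_setX z i u : i \in X -> R z -> R (setX X PX bX z i u).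
Proof. by move=> iX az; have [_ ->] := setXP PX bX z u iX; apply: R_upd => //; apply: XR. Qed.

Lemma gam_balanced i : i \in X -> balanced_on Z c0 (gam i).
Proof.
move=> iX; have RZ z : agree Z c0 z -> R z by apply: agree_sub; apply: subsetUr.
split=> [z /RZ/R_face az|z s u /RZ az sZ'].
  exact: bal_inj (UY_setX_inj hM LX LY dXY az iX).
have [sS sX sY] := Z_in sZ'.
have := bal_inj (U_inj hM LY (R_face (R_setX u iX az)) sS sY).
by rewrite /bal; congr (_ == _); apply: eq_count => a; rewrite /gam setX_upd.
Qed.

Lemma bad_closed i : i \in X -> closed_on Z c0 (gam i) (bad i).
Proof.
move=> iX; have RZ z : agree Z c0 z -> R z by apply: agree_sub; apply: subsetUr.
split=> [z u v /RZ az nu e gv|z s u a /RZ az sZ' nu e gv]; apply: nu.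
  have [_ e1] := setXP PX bX z u iX; have [_ e2] := setXP PX bX z v iX.
  rewrite /gam in e; rewrite e1; rewrite e2 in gv; apply: (lgd_move hM LY) gv; rewrite -?e1 -?e2 //.
  - exact: R_face.
  - exact: (XS0 LX).
  - exact: (notXY dXY).
have [sS sX sY] := Z_in sZ'; rewrite setX_upd // in gv; rewrite /gam setX_upd // in e.
rewrite -(upd_eq (setX X PX bX z i u) s); apply: (lgd_move hM LY) gv => //.
  by apply: R_face; apply: R_setX.
by rewrite upd_eq.
Qed.

Lemma setX_self x i : i \in X -> setX X PX bX x i (KX x) = x.
Proof. by move=> iX; apply: thru_self iX; apply: leaf_lat. Qed.

(** One such layer comes from [shadow_meets] and a second one from [shadow_moves]. *)
Lemma bad_layers s z : s \in Z -> R z -> mism M X PX bX Y PY bY z -> ~ gY c0 ->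
  exists a b, a != b /\ forall d, d = a \/ d = b ->
    exists z' x', [/\ R z', R x', z' s = d, x' s = d & mism M X PX bX Y PY bY z' /\ ~ gY x'].
Proof.
move=> sZ' Rz mz nx; have [i iX] := leaf_ex LX.
have RZ z' : agree Z c0 z' -> R z' by apply: agree_sub; apply: subsetUr.
have dz : del (gam i) (mix Z z c0) (false, false).
  apply: (mism_del hM LX LY dXY (R_face (RZ _ (agree_mix _ _))) iX).
  have ag j : j \notin X :|: Y -> z j = mix Z z c0 j.
    by move=> jXY; rewrite mixE; case: ifP => // /negbT jZ; rewrite Rz // inE negb_or jXY.
  by have [p [q [ap aq Mp Mq ne]]] := mz; exists p, q; split=> // j jXY; rewrite ?ap ?aq // ag.
have b0 : bad i c0 (KX c0) by rewrite /bad setX_self.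
have B := gam_balanced iX; have C := bad_closed iX.
have [z1 [u1 [az1 n1 d1]]] := shadow_meets B C (agree_refl _) (agree_mix _ _) b0 dz.
have [a [v [na n2 d2]]] := shadow_moves B C az1 sZ' n1 d1.
have az2 : agree Z c0 (upd z1 s a) by apply: agree_upd.
have P z' u : agree Z c0 z' -> bad i z' u -> del (gam i) z' u ->
   exists z'' x', [/\ R z'', R x', z'' s = z' s, x' s = z' s & mism M X PX bX Y PY bY z'' /\ ~ gY x'].
  move=> az nu du; exists z', (setX X PX bX z' i u); split=> //; first exact: RZ.
  - by apply: R_setX => //; apply: RZ.
  - by apply: (setX_agree PX bX z' u iX); have [_ ->] := Z_in sZ'.
  by split=> //; apply: (del_mism LX LY dXY (R_face (RZ _ az)) iX du).
exists (z1 s), a; split; first by rewrite eq_sym.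
move=> d [->|->]; first exact: P n1 d1.
have := P _ _ az2 n2 d2; by rewrite updE eqxx.
Qed.

Section Formula.
Variable ch : I -> V -> bool.
Hypothesis bch : forall s, s \in Z -> bal (ch s).
Hypothesis hch : forall x s, R x -> ~ gY x -> s \in Z -> ch s (x s).
Local Notation par := (fun x => sumb Z (fun s => ~~ ch s (x s))).

(** The values of the coordinate that keep the first bit keep the failure, so [ch] contains them;
    both sets have two elements, hence they coincide. *)
Lemma bad_line x s a : R x -> ~ gY x -> s \in Z -> (UY (upd x s a)).1 = (UY x).1 (+) ~~ ch s a.
Proof.
move=> Rx nx sZ'; have [sS sX sY] := Z_in sZ'.
have bg := bal_inj (U_inj hM LY (R_face Rx) sS sY).
apply: (bal_sub bg (bch sZ')) => b eb.
have -> : b = upd x s b s by rewrite updE eqxx.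
apply: hch => //; first by apply: R_upd => //; apply: ZR.
move=> h; apply: nx; rewrite -(upd_eq x s).
apply: (lgd_move hM LY (R_face Rx) sS sY _ h).
by rewrite upd_eq.
Qed.

Lemma bad_spread x y : R x -> ~ gY x -> agree Z x y -> (forall s, s \in Z -> ch s (y s)) ->
  ~ gY y /\ (UY y).1 = (UY x).1.
Proof.
move=> Rx nx; have [n] := ubnP #|[set s | y s != x s]|; elim: n y => // n IH y hn axy hy.
case: (pickP (fun s => y s != x s)) => [s hs|h]; last first.
  suff -> : y = x by [].
  by apply/ffunP => s; apply/eqP; have := h s; move/negbFE.
have sZ' : s \in Z by apply: contraNT hs => /axy->.
have [sS sX sY] := Z_in sZ'.
pose y' := upd y s (x s).
have Ry' : R y' by apply: R_upd (ZR sZ') _; apply: agree_trans Rx _; apply: agree_sub axy; apply: subsetUr.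
have [|||n1 e1] := IH y'.
- rewrite ltnS in hn; apply: leq_trans hn; apply: proper_card; apply/properP; split.
    by apply/subsetP => t; rewrite !inE updE; have [->|] := eqVneq t s; rewrite ?eqxx.
  by exists s; rewrite inE; [exact: hs | rewrite updE eqxx eqxx].
- exact: agree_upd.
- by move=> t tZ; rewrite updE; case: eqP => [->|_]; [apply: hch | apply: hy].
have ey : y = upd y' s (y s) by rewrite upd_upd upd_eq.
have ee : (UY y).1 = (UY y').1 by rewrite {1}ey bad_line // hy // addbF.
split; last by rewrite ee.
rewrite ey => h; apply: n1; rewrite -(upd_eq y' s).
by apply: (lgd_move hM LY (R_face Ry') sS sY _ h); rewrite -ey upd_eq.
Qed.

Lemma par_upd y s a : s \in Z -> sumb Z (fun t => ~~ ch t (upd y s a t)) = ~~ ch s a (+) sumb (Z :\ s) (fun t => ~~ ch t (y t)).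
Proof.
move=> sZ'; rewrite (sumbD1 _ sZ') updE eqxx; congr addb; apply: eq_sumb => t.
by rewrite !inE updE => /andP[/negbTE->].
Qed.

Lemma formula_Z x y : R x -> ~ gY x -> agree Z x y -> (UY y).1 = (UY x).1 (+) par y.
Proof.
move=> Rx nx; have [n] := ubnP #|[set s in Z | ~~ ch s (y s)]|; elim: n y => // n IH y hn axy.
case: (pickP (fun s => (s \in Z) && ~~ ch s (y s))) => [s /andP[sZ' hs]|h]; last first.
  have hy s : s \in Z -> ch s (y s) by move=> sZ'; have := h s; rewrite sZ' => /negbFE.
  have [_ ->] := bad_spread Rx nx axy hy; rewrite -[LHS]addbF; congr addb.
  by apply/esym; rewrite /sumb big1 // => s sZ'; rewrite hy.
have [sS sX sY] := Z_in sZ'; have Ry : R y.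
  by apply: agree_trans Rx _; apply: agree_sub axy; apply: subsetUr.
have [a [b [ab ca cb]]] := bal_pair (bch sZ').
have E d : ch s d -> (UY (upd y s d)).1 = (UY x).1 (+) sumb Z (fun t => ~~ ch t (upd y s d t)).
  move=> cd; apply: IH; last exact: agree_upd.
  rewrite ltnS in hn; apply: leq_trans hn; apply: proper_card; apply/properP; split.
    by apply/subsetP => t; rewrite !inE updE; have [->|] := eqVneq t s; rewrite ?cd ?andbF.
  by exists s; rewrite !inE ?sZ' ?hs // updE eqxx cd.
have bg := bal_inj (U_inj hM LY (R_face Ry) sS sY).
have := bal_rest bg (a := a) (b := b) (c := y s).
rewrite /= (E a ca) (E b cb) !par_upd // ca cb upd_eq /= => -> //.
- by rewrite (sumbD1 _ sZ') hs -addbN.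
- by apply: contraNneq hs => ->.
by apply: contraNneq hs => ->.
Qed.

(** A second value [u1] of [X] has the same first bit as that of [c0] and fails as well, so
    [formula_Z] covers both. Balance gives the opposite bit at the other two values, whence
    [rho]. *)
Lemma formula : ~ gY c0 -> exists t rho, forall y, R y -> (UY y).1 = t (+) rho (KX y) (+) par y.
Proof.
move=> nc; have [i iX] := leaf_ex LX; have RZ y : agree Z c0 y -> R y by apply: agree_sub; apply: subsetUr.
have bc := (gam_balanced iX).1 c0 (agree_refl _).
have [u1 n1 e1] := bal_other (KX c0) bc.
pose x1 := setX X PX bX c0 i u1.
have Rx1 : R x1 by apply: R_setX.
have nx1 : ~ gY x1.
  apply: ((bad_closed iX).1 c0 (KX c0) u1 (agree_refl _)) => //.
  by rewrite /bad setX_self.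
have ex1 : (UY x1).1 = (UY c0).1 by move: e1; rewrite /gam setX_self.
exists (UY c0).1, (fun u => (u != KX c0) && (u != u1)) => y Ry.
pose y' := mix Z y c0; have ay' : agree Z c0 y' by apply: agree_mix.
have py' : par y' = par y by apply: eq_sumb => s sZ'; rewrite mixE sZ'.
have Ky' : KX y' = KX c0.
  apply: (kv_dep _ (leaf_dep LX)) => j jX; rewrite mixE; case: ifP => // jZ.
  by rewrite (disjointFl dZX jX) in jZ.
have E0 : (UY (setX X PX bX y' i (KX c0))).1 = (UY c0).1 (+) par y.
  by rewrite -Ky' setX_self // (formula_Z (x := c0)) // py'.
have E1 : (UY (setX X PX bX y' i u1)).1 = (UY c0).1 (+) par y.
  rewrite -ex1 -py' (formula_Z (x := x1)) //.
    congr addb; apply: eq_sumb => s sZ'; congr (~~ ch _ _).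
    by apply: (setX_agree PX bX y' u1 iX); have [_ ->] := Z_in sZ'.
  move=> j jZ; have [_ ea] := setXP PX bX y' u1 iX; have [_ eb] := setXP PX bX c0 u1 iX.
  have ei : setX X PX bX y' i u1 i = x1 i.
    apply: (@leaf_lat I X PX bX c0 i iX); rewrite -eb.
    have <- : KX (upd y' i (setX X PX bX y' i u1 i)) = KX (upd c0 i (setX X PX bX y' i u1 i)).
      apply: (kv_dep _ (leaf_dep LX)) => k kX; rewrite !updE; case: eqP => // _.
      by rewrite mixE (disjointFl dZX kX).
    by rewrite -ea; have [-> _] := setXP PX bX y' u1 iX; have [-> _] := setXP PX bX c0 u1 iX.
  rewrite ea updE; case: eqP => [->|/eqP/negbTE ji]; first exact: ei.
  by rewrite mixE (negbTE jZ) /x1 eb updE ji.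
have EU : (UY y).1 = (UY (setX X PX bX y' i (KX y))).1.
  pose y2 := mix X y y'.
  have -> : UY y = UY y2.
    apply: (leaf_off LY) => j jY; rewrite mixE; case: ifP => // /negbT jX.
    rewrite mixE; case: ifP => // /negbT jZ; apply/esym/Ry.
    by rewrite !inE !negb_or jX jY.
  congr (_.1); apply/esym/(UY_fun LX LY dXY).
  - by apply: R_face; apply: R_setX => //; apply: RZ.
  - apply: agree_trans (agree_sym (setX_agree PX bX y' _ iX)) _.
    exact: agree_mix.
  have [-> _] := setXP PX bX y' (KX y) iX.
  by apply: (kv_dep _ (leaf_dep LX)) => j jX; rewrite mixE jX.
rewrite EU; have [->|k0] := eqVneq (KX y) (KX c0); first by rewrite E0 /= addbF.
have [->|k1] := eqVneq (KX y) u1; first by rewrite E1 /= addbF.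
have B := bal_inj (UY_setX_inj hM LX LY dXY (R_face (RZ _ ay')) iX).
have := bal_rest B (a := KX c0) (b := u1) (c := KX y).
rewrite E0 E1 eq_sym n1 k0 k1 => -> //.
by rewrite addbT addNb.
Qed.
End Formula.
End OneSide.
End NoBoth.

Lemma mism_sym (I : finType) (M : {ffun I -> V} -> bool) X PX bX Y PY bY z :
  mism M X PX bX Y PY bY z -> mism M Y PY bY X PX bX z.
Proof.
move=> [p [q [ap aq Mp Mq ne]]]; exists p, q; split=> //.
- by rewrite setUC.
- by rewrite setUC.
by rewrite eq_sym.
Qed.

Section NoBoth.
Variable I : finType.
Notation pt := {ffun I -> V}.
Notation bt := {ffun I -> bool}.
Implicit Types (x y z p : pt) (l : bt) (Z : {set I}).
Variables (M : pt -> bool) (S : {set I}) (w : I) (c : pt).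
Hypotheses (hM : mds M) (wS : w \in S).
Local Notation S0 := (S :\ w).
Variables (X : {set I}) (PX : I -> option bool) (bX : bt -> bool) (UX : pt -> V).
Variables (Y : {set I}) (PY : I -> option bool) (bY : bt -> bool) (UY : pt -> V).
Hypothesis LX : leaf M S0 c X PX bX UX.
Hypothesis LY : leaf M S0 c Y PY bY UY.
Hypothesis dXY : [disjoint X & Y].
Local Notation KX := (kv PX X bX).
Local Notation KY := (kv PY Y bY).
Local Notation gY := (lgd M w c Y PY bY).
Local Notation gX := (lgd M w c X PX bX).

(** Induction forbids a layer in a direction [s] of [Z] that contains a mismatch and both failures.
    Each failure, together with a mismatch, occupies at least two values of [s], so the two kinds
    live on complementary pairs given by [ch s]. In the sum of the resulting formulas for the two
    first bits the coordinates in [Z] cancel, leaving a function [A] of the value of [X] plus a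
    function [B] of the value of [Y] that is constant on the code. Then [A] is constant, and the
    partitions would match at [z]. *)
Lemma no_both Z z x x' : Z \subset S0 -> [disjoint Z & X] -> [disjoint Z & Y] -> agree S0 c z ->
  mism M X PX bX Y PY bY z ->
  agree (X :|: Y :|: Z) z x -> agree (X :|: Y :|: Z) z x' -> ~ gY x -> ~ gX x' -> False.
Proof.
have [n] := ubnP #|Z|; elim: n Z z x x' => // n IH Z z x x' hn sZ dZX dZY az mz ax ax' nx nx'.
have [Z0|/set0Pn[s0 s0Z]] := eqVneq Z set0.
  rewrite Z0 setU0 in ax ax'.
  have [h|h] := mism_dichotomy hM LX LY dXY az mz.
    apply: nx; apply: (@lgd_agree _ _ _ _ _ _ _ (mix X x z)); last first.
      by apply: h; apply: agree_mix.
    move=> j jY; rewrite mixE; case: ifP => // /negbT jX; rewrite ax //.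
    by rewrite inE negb_or jX.
  apply: nx'; apply: (@lgd_agree _ _ _ _ _ _ _ (mix Y x' z)); last first.
    by apply: h; apply: agree_mix.
  move=> j jX; rewrite mixE; case: ifP => // /negbT jY; rewrite ax' //.
  by rewrite inE negb_or jX.
set F := X :|: Y :|: Z in ax ax'.
have sF : F \subset S0 by rewrite !subUset (leaf_sub LX) (leaf_sub LY).
have FC : Y :|: X :|: Z = F by rewrite [Y :|: X]setUC.
have fx y : agree F z y -> agree S0 c y by move=> h; apply: agree_trans az (agree_sub sF h).
have toR y y' : agree F z y -> agree F z y' -> agree F y y'.
  by move=> h h'; apply: agree_trans (agree_sym h) h'.
have ofR y y' : agree F z y -> agree F y y' -> agree F z y' by move=> h h'; apply: agree_trans h h'.
have key s y1 y2 y3 : s \in Z -> agree F z y1 -> agree F z y2 -> agree F z y3 ->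
    y2 s = y1 s -> y3 s = y1 s -> mism M X PX bX Y PY bY y1 -> ~ gY y2 -> ~ gX y3 -> False.
  move=> sZ' a1 a2 a3 e2 e3.
  have sub : Z :\ s \subset Z by apply: subsetDl.
  have ag y y' : agree F y y' -> y' s = y s -> agree (X :|: Y :|: (Z :\ s)) y y'.
    move=> h e j jn; have [->//|js] := eqVneq j s; apply: h.
    by move: jn; rewrite !inE js.
  move=> m1 n2 n3; refine (IH (Z :\ s) y1 y2 y3 _ _ _ _ _ m1 _ _ n2 n3).
  - by move: hn; rewrite (cardsD1 s Z) sZ'.
  - exact: subset_trans sub sZ.
  - exact: disjointWl sub dZX.
  - exact: disjointWl sub dZY.
  - exact: fx.
  - by apply: ag => //; apply: toR.
  by apply: ag => //; apply: toR.
have dYX : [disjoint Y & X] by rewrite disjoint_sym.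
have chi s : exists ch : V -> bool, s \in Z -> [/\ bal ch,
    forall y, agree F z y -> ~ gY y -> ch (y s) & forall y, agree F z y -> ~ gX y -> ~~ ch (y s)].
  have [sZ'|sZ'] := boolP (s \in Z); last by exists xpredT.
  have [a [b [ab hab]]] := @bad_layers _ M S w c hM X PX bX UX Y PY bY UY LX LY dXY Z x sZ dZX dZY (fx _ ax) s z sZ' (toR _ _ ax (agree_refl z)) mz nx.
  have [a' [b' [ab' hab']]] := @bad_layers _ M S w c hM Y PY bY UY X PX bX UX LY LX dYX Z x' sZ dZY dZX (fx _ ax') s z sZ'
    (agree_sym (eq_ind_r (fun F => agree F z x') ax' FC)) (mism_sym mz) nx'.
  rewrite FC in hab'.
  have N1 y d : agree F z y -> ~ gY y -> d = a' \/ d = b' -> y s != d.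
    move=> ay ny hd; have [z1 [x1 [b1 b2 e1 e2 [m1 n1]]]] := hab' d hd.
    apply/eqP => e; apply: (key s z1 y x1) => //.
    - exact: ofR b1.
    - exact: ofR b2.
    - by rewrite e.
    - by rewrite e1.
    exact: mism_sym.
  have N2 y d : agree F z y -> ~ gX y -> d = a \/ d = b -> y s != d.
    move=> ay ny hd; have [z1 [x1 [b1 b2 e1 e2 [m1 n1]]]] := hab d hd.
    apply/eqP => e; apply: (key s z1 x1 y) => //.
    - exact: ofR b1.
    - exact: ofR b2.
    - by rewrite e1.
    by rewrite e.
  have na d : d = a \/ d = b -> d != a' /\ d != b'.
    move=> hd; have [z1 [x1 [b1 b2 e1 e2 [m1 n1]]]] := hab d hd.
    by split; rewrite -e2; apply: (N1 x1) => //; [exact: ofR b2 | left | exact: ofR b2 | right].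
  have [ha1 ha2] := na a (or_introl (erefl _)); have [hb1 hb2] := na b (or_intror (erefl _)).
  exists (fun v => (v == a) || (v == b)) => _; split.
  - by move: ab; clear; rewrite /bal; case: a => [[] []]; case: b => [[] []].
  - move=> y ay ny; have := N1 y a' ay ny (or_introl (erefl _)); have := N1 y b' ay ny (or_intror (erefl _)).
    move: ab ab' ha1 ha2 hb1 hb2; clear; move: (y s).
    by case: a => [[] []]; case: b => [[] []] //; case: a' => [[] []] //; case: b' => [[] []] //; case=> [[] []].
  move=> y ay ny; rewrite negb_or (N2 y a) ?(N2 y b) //; [by right | by left].
have [ch hch] := fin_all_exists chi.
have bch s : s \in Z -> bal (ch s) by move/hch=> [].
have [t [rho ft]] : exists t rho, forall y, agree F x y ->
    (UY y).1 = t (+) rho (KX y) (+) sumb Z (fun s => ~~ ch s (y s)).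
  apply: (@formula _ M S w c hM X PX bX UX Y PY bY UY LX LY dXY Z x sZ dZX dZY (fx _ ax) ch bch) => //.
  by move=> y s ay ny sZ'; have [_ h _] := hch s sZ'; apply: h => //; apply: ofR ax ay.
have [t' [rho' ft']] : exists t rho, forall y, agree F x' y ->
    (UX y).1 = t (+) rho (KY y) (+) sumb Z (fun s => ~~ ~~ ch s (y s)).
  rewrite -FC.
  apply: (@formula _ M S w c hM Y PY bY UY X PX bX UX LY LX dYX Z x' sZ dZY dZX (fx _ ax') (fun s v => ~~ ch s v)) => //.
    by move=> s sZ'; apply/bal_neg/bch.
  by rewrite FC => y s ay ny sZ'; have [_ _ h] := hch s sZ'; apply: h => //; apply: ofR ax' ay.
pose A u := u.1 (+) rho u; pose B v := v.1 (+) rho' v.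
have ev y : agree F z y -> M y -> (KY y).1 = t (+) rho (KX y) (+) sumb Z (fun s => ~~ ch s (y s)).
  move=> ay My; have : KY y == UY y by rewrite -(leaf_eq LY) //; apply: fx.
  by move/eqP->; apply: ft; apply: toR.
have ev' y : agree F z y -> M y -> (KX y).1 = t' (+) rho' (KY y) (+) sumb Z (fun s => ch s (y s)).
  move=> ay My; have : KX y == UX y by rewrite -(leaf_eq LX) //; apply: fx.
  move/eqP->; rewrite ft'; last exact: toR.
  by congr (_ (+) _); apply: eq_sumb => s _; rewrite negbK.
have AB y : agree F z y -> M y -> A (KX y) (+) B (KY y) = t (+) t' (+) sumb Z (fun=> true).
  move=> ay My; rewrite /A /B ev // ev' //.
  have -> : sumb Z (fun=> true) = sumb Z (fun s => ch s (y s)) (+) sumb Z (fun s => ~~ ch s (y s)).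
    by rewrite /sumb -big_split; apply: eq_bigr => s _ /=; case: (ch s _).
  move: (rho _) (rho' _) (sumb _ _) (sumb _ _).
  by clear; case: t => -[]; case: t' => -[] [] [].
have s0X : s0 \notin X by rewrite (disjointFr dZX s0Z).
have s0Y : s0 \notin Y by rewrite (disjointFr dZY s0Z).
have [i iX] := leaf_ex LX.
(* [Z] is not empty: the coordinate [s0] completes every choice of the value on [X] to a codeword
   while the value on [Y] stays fixed. *)
have Ac u v : A u = A v.
  have P d : exists y, [/\ agree F z y, M y, KX y = d & KY y = KY z].
    have [e1 e2] := setXP PX bX z d iX.
    have [a ha] := hM.1 (setX X PX bX z i d) s0.
    exists (upd (setX X PX bX z i d) s0 a); split=> //.
    - apply: agree_upd; first by rewrite !inE s0Z orbT.
      by rewrite e2; apply: agree_upd => //; rewrite !inE iX.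
    - by rewrite (K_upd LX).
    rewrite (K_upd LY) //; apply: KY_agX LY dXY _ _ _.
    exact: setX_agree.
  have [y [ay My e1 e2]] := P u; have [y' [ay' My' e1' e2']] := P v.
  have := AB y ay My; rewrite -(AB y' ay' My') e1 e2 e1' e2'.
  by move/addIb.
have [p [q [ap aq Mp Mq]]] := mz.
have sXYF : X :|: Y \subset F by apply: subsetUl.
rewrite !ev //; try exact: (agree_sub sXYF).
have -> : sumb Z (fun s => ~~ ch s (q s)) = sumb Z (fun s => ~~ ch s (p s)).
  apply: eq_sumb => s sZ'; rewrite aq ?ap // inE negb_or (disjointFr dZX sZ') //.
    by rewrite (disjointFr dZY sZ').
  by rewrite (disjointFr dZY sZ').
have := Ac (KX p) (KX q); rewrite /A.
move: (KX p).1 (KX q).1 (rho _) (rho _) (sumb _ _); clear.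
by case: t; do 5!case.
Qed.

Lemma all_good z : agree S0 c z -> mism M X PX bX Y PY bY z ->
  (forall x, agree S0 c x -> gY x) \/ (forall x, agree S0 c x -> gX x).
Proof.
move=> az mz; have [h|h] := classic (forall x, agree S0 c x -> gX x); [by right | left=> x ax].
apply: NNPP => nx; apply: h => x' ax'; apply: NNPP => nx'.
pose Z := S0 :\: (X :|: Y).
have E : X :|: Y :|: Z = S0.
  rewrite /Z -{2}(setUidPr (_ : X :|: Y \subset S0)); last by rewrite subUset (leaf_sub LX) (leaf_sub LY).
  by apply/setP => j; rewrite !inE; case: (j \in X); case: (j \in Y).
apply: (@no_both Z z x x') => //.
- exact: subsetDl.
- by rewrite -setI_eq0; apply/eqP/setP => j; rewrite !inE; case: (j \in X); rewrite ?andbF.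
- by rewrite -setI_eq0; apply/eqP/setP => j; rewrite !inE; case: (j \in Y); rewrite ?andbF ?orbT.
- by rewrite E; apply: agree_trans (agree_sym az) ax.
by rewrite E; apply: agree_trans (agree_sym az) ax'.
Qed.
End NoBoth.

Lemma perm_coord (G : V -> V) P : injective G -> exists Q k d e, forall u,
  lf P (G u) = lf Q u (+) k /\ mf P (G u) = mf Q u (+) (d && lf Q u) (+) e.
Proof.
move=> inj; pose bs := [:: true; false].
suff /hasP[Q _ /hasP[k _ /hasP[d _ /hasP[e _ /allP h]]]] :
   has (fun Q => has (fun k => has (fun d => has (fun e => all (fun u =>
     (lf P (G u) == lf Q u (+) k) && (mf P (G u) == mf Q u (+) (d && lf Q u) (+) e)) vs) bs) bs) bs) parts.
  by exists Q, k, d, e => u; have /andP[/eqP ? /eqP ?] := h u (mem_vs u).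
have : uniq [seq G u | u <- vs] by rewrite map_inj_uniq.
rewrite /=; move: (G (false, false)) (G (false, true)) (G (true, false)) (G (true, true)).
by case: P => [[]|]; case=> [[] []] [[] []] [[] []] [[] []].
Qed.

Definition linsq s := has (fun P1 => has (fun P2 => has (fun P3 => has (fun k =>
  all (fun r => all (fun t => lf P1 r (+) lf P2 t (+) lf P3 (at2 s r t) == k) vs) vs)
  [:: true; false]) parts) parts) parts.
Lemma linsq_zsq : all linsq zsq. Proof. by vm_compute. Qed.

(** Permuting the columns by [ka] puts [zr] on the diagonal, the enumeration gives the relation, and
    [perm_coord] undoes the permutation. *)
Lemma latin_semilinear (g : V -> V -> V) :
  (forall a, injective (g a)) -> (forall b, injective (g^~ b)) ->
  exists P1 P2 P3 k, forall a b, lf P1 a (+) lf P2 b (+) lf P3 (g a b) = k.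
Proof.
move=> g1 g2; pose ka a := invF (@g1 a) zr.
have gka a : g a (ka a) = zr by apply: f_invF.
have ik : injective ka by move=> a b e; apply: (g2 (ka a)); rewrite /= gka e gka.
have : sq (fun a r => g a (ka r)) \in zsq.
  apply: sqP => [r t|r|t].
  - by rewrite -(gka r) (inj_eq (@g1 r)) (inj_eq ik).
  - exact: inj_comp.
  exact: g2.
move/(allP linsq_zsq)/hasP => [P1 _ /hasP[P2 _ /hasP[P3 _ /hasP[k _ /allP h]]]].
have [Q [k' [d [e hQ]]]] := perm_coord P2 (can_inj (f_invF ik)).
exists P1, Q, P3, (k (+) k') => a b.
have /allP/(_ _ (mem_vs (invF ik b))) /eqP := h a (mem_vs a).
rewrite at2_sq f_invF => <-; have [-> _] := hQ b.
rewrite -!addbA; congr addb; rewrite [k' (+) _]addbC -addbA addbb addbF //.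
Qed.

(** * Semilinear codes *)

Section Semi.
Variable I : finType.
Notation pt := {ffun I -> V}.
Notation bt := {ffun I -> bool}.
Implicit Types (x y z p c : pt) (l : bt) (S : {set I}).
Variable M : pt -> bool.
Hypothesis hM : mds M.

Definition semi S c := exists P s, forall x, agree S c x -> M x -> sumb S (fun i => lf (P i) (x i)) = s.

Lemma set3_ex (S : {set I}) : #|S| = 3 -> exists i j k, [/\ i != j, i != k, j != k & S = [set i; j; k]].
Proof.
move=> c3; have /card_gt0P[i iS] : 0 < #|S| by rewrite c3.
have c2 : #|S :\ i| = 2 by have := cardsD1 i S; rewrite iS c3 => -[].
have /card_gt0P[j jS] : 0 < #|S :\ i| by rewrite c2.
have c1 : #|S :\ i :\ j| = 1 by have := cardsD1 j (S :\ i); rewrite jS c2 => -[].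
have /cards1P[k ek] : #|S :\ i :\ j| == 1 by rewrite c1.
have kS : k \in S :\ i :\ j by rewrite ek set11.
move: kS jS; rewrite !inE => /and3P[kj ki kS] /andP[ji jS].
exists i, j, k; split; rewrite 1?eq_sym //.
apply/eqP; rewrite eq_sym eqEcard !subUset !sub1set iS jS kS c3 /=.
by rewrite -setUA cardsU1 cards2 !inE negb_or eq_sym ji [j == k]eq_sym kj [i == k]eq_sym ki.
Qed.

Lemma sumb3 (i j k : I) (g : I -> bool) : i != j -> i != k -> j != k -> sumb [set i; j; k] g = g i (+) g j (+) g k.
Proof.
move=> ij ik jk; rewrite /sumb -setUA !big_setU1 ?inE ?negb_or ?ij ?ik //= big_set1.
by rewrite addbA.
Qed.

Lemma cmp_inj w x i : i != w -> injective (fun a => cmp M w (upd x i a)).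
Proof. by move=> iw a b e; apply: (phi_inj (w0 := zr) hM iw (x := x)); rewrite /phi e. Qed.

Lemma semi3 S c : #|S| = 3 -> semi S c.
Proof.
move=> /set3_ex[i [j [k [ij ik jk ->]]]].
pose g a b := cmp M k (upd (upd c i a) j b).
have [|b|P1 [P2 [P3 [s hs]]]] := @latin_semilinear g.
- by move=> a; apply: cmp_inj.
- by move=> a a'; rewrite /g !(updC _ _ _ ij); apply: cmp_inj.
exists (fun u => if u == i then P1 else if u == j then P2 else P3), s => x ax Mx.
rewrite sumb3 // eqxx !(eq_sym _ i) (negbTE ij) (negbTE ik) eqxx [k == j]eq_sym (negbTE jk) -(hs (x i) (x j)).
congr (_ (+) lf _ _); apply: (hM.2 x k); rewrite ?upd_eq //.
have := cmpP k hM (upd (upd c i (x i)) j (x j)); rewrite -/(g _ _); congr M.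
apply/ffunP => u; rewrite !updE; case: (u =P k) => // /eqP uk; case: (u =P j) => [->|/eqP uj] //.
by case: (u =P i) => [->|/eqP ui] //; rewrite ax // !inE !negb_or ui uj uk.
Qed.

Section Beta.
Variables (S : {set I}) (c : pt) (P : I -> option bool) (s : bool).
Hypothesis hs : forall x, agree S c x -> M x -> sumb S (fun i => lf (P i) (x i)) = s.

(** The sum forces the bit [lf] of the codeword in direction [i], so its entry is one of the two
    elements of that class: exactly one of [x] and [fm P x i] is a codeword. *)
Lemma fm_flip x i : i \in S -> agree S c x -> sumb S (fun i => lf (P i) (x i)) = s ->
  M (fm P x i) = ~~ M x.
Proof.
move=> iS ax es.
have [a ha] := hM.1 x i.
have la : lf (P i) a = lf (P i) (x i).
  have := hs (agree_upd a iS ax) ha; rewrite -es (sumb_upd (fun j => lf (P j))) // [in RHS](sumbD1 _ iS).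
  by move/addIb.
have [ea|ea] := eqVneq (mf (P i) a) (mf (P i) (x i)).
  have e : a = x i by apply: (lfm_inj la ea).
  have Mx : M x by rewrite -(upd_eq x i) -e.
  rewrite Mx; apply/negP => h; move: Mx; rewrite -{1}(upd_eq x i) => h'.
  have := congr1 (mf (P i)) (hM.2 _ _ _ _ h h'); rewrite mf_dec; by case: (mf _ _).
have ea' : a = dec (P i) (lf (P i) (x i)) (~~ mf (P i) (x i)).
  by rewrite -(dec_lm (P i) a) la; congr dec; move: ea; case: (mf _ _); case: (mf _ _).
have -> : M (fm P x i) by rewrite /fm -ea'.
apply/esym/negP; rewrite -{1}(upd_eq x i) => h.
by have e := hM.2 _ _ _ _ h ha; rewrite e eqxx in ea.
Qed.

(** Where the sum of the bits [lf] is right, flipping one second bit toggles membership; so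
    membership plus the sum of the second bits depends only on the bits [lf]. *)
Lemma semi_beta i0 : i0 \in S -> exists be : bt -> bool, (forall l l', {in S, l =1 l'} -> be l = be l') /\
  forall x, agree S c x -> M x = (sumb S (fun i => lf (P i) (x i)) == s) && (sumb S (fun i => mf (P i) (x i)) == be (bits P x)).
Proof.
move=> i0S; pose om x := M x (+) sumb S (fun i => mf (P i) (x i)).
have omf x i : i \in S -> agree S c x -> sumb S (fun i => lf (P i) (x i)) = s -> om (fm P x i) = om x.
  move=> iS ax es; rewrite /om fm_flip // [in LHS](sumbD1 _ iS) [in RHS](sumbD1 _ iS) m_fm eqxx.
  rewrite (@eq_sumb _ (S :\ i) _ (fun i => mf (P i) (x i))).
    by rewrite addbT; case: (M x); case: (mf _ _); case: (sumb _ _).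
  by move=> j; rewrite !inE m_fm => /andP[/negbTE-> _]; rewrite addbF.
have omb x y : agree S c x -> agree S c y -> sumb S (fun i => lf (P i) (x i)) = s -> bits P x = bits P y -> om x = om y.
  move=> + ay; have [n] := ubnP #|[set k | mf (P k) (x k) != mf (P k) (y k)]|.
  elim: n x => // n IH x hn ax es eb.
  case: (pickP (fun k => mf (P k) (x k) != mf (P k) (y k))) => [k hk|h]; last first.
    by congr om; apply: (ptP eb) => k; apply/eqP; have := h k; move/negbFE.
  have kS : k \in S by apply: contraNT hk => kS; rewrite ax // ay.
  rewrite -(omf x k) //; apply: IH; rewrite ?bits_fm //.
  - rewrite ltnS in hn; apply: leq_trans hn; apply: proper_card; apply/properP; split.
      apply/subsetP => u; rewrite !inE m_fm; have [->|_] := eqVneq u k; rewrite ?addbF //.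
    exists k; rewrite inE; first exact: hk.
    by rewrite m_fm eqxx; move: hk; case: (mf _ _); case: (mf _ _).
  - exact: agree_upd.
  rewrite -es; apply: eq_sumb => u _; have := congr1 (fun l : bt => l u) (bits_fm P x k).
  by rewrite !ffunE.
pose cl l := mix S (ptof P l c) c.
exists (fun l => ~~ om (cl l)); split.
  move=> l l' e; congr (~~ om _); apply/ffunP => k; rewrite !mixE; case: ifP => // kS.
  by rewrite !ffunE e.
move=> x ax; have [es|ns] := eqVneq (sumb S (fun i => lf (P i) (x i))) s; last first.
  by apply/negP => /(hs ax) e; rewrite e eqxx in ns.
have eb : bits P x = bits P (cl (bits P x)).
  apply/ffunP => k; rewrite !ffunE; case: ifP => kS; first by rewrite lf_dec.
  by rewrite ax // kS.
have := omb _ _ ax (agree_mix _ _) es eb; rewrite -/(cl _) => <-.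
by rewrite /om; case: (M x); case: (sumb _ _).
Qed.
End Beta.
End Semi.

(** * Codes with four coordinates *)

(* Up to a permutation of the values, the quasigroups of type Z_4 in two variables. *)
Definition kk (r : bool) (Q Q' : option bool) (u v : V) : V :=
  (lf Q u (+) lf Q' v, mf Q u (+) mf Q' v (+) (lf Q u && lf Q' v) (+) (r && lf Q u)).

(** For a code with four coordinates, given as the graph of [T]: one leaf on the first two
    arguments, another on the third argument and the value, and a mismatch between them. *)
Definition rect (T : V -> V -> V -> V) := exists r1 Q1 Q2 r2 Q3 Q4, [/\
  forall x y x' y' t, kk r1 Q1 Q2 x y = kk r1 Q1 Q2 x' y' -> T x y t = T x' y' t,
  forall x y t t', kk r2 Q3 Q4 t (T x y t) = kk r2 Q3 Q4 t' (T x y t') &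
  exists x y t x' y' t', ((kk r1 Q1 Q2 x y).1 == (kk r1 Q1 Q2 x' y').1) !=
     ((kk r2 Q3 Q4 t (T x y t)).1 == (kk r2 Q3 Q4 t' (T x' y' t')).1)].

Section Leaves.
Variable I : finType.
Notation pt := {ffun I -> V}.
Notation bt := {ffun I -> bool}.
Implicit Types (x y z p c : pt) (l : bt) (S : {set I}).
Variable M : pt -> bool.
Hypothesis hM : mds M.

Lemma leaf_intro S c (X : {set I}) P be : X \subset S -> 1 < #|X| -> conn be X (bits P c) ->
  (forall l l', {in X, l =1 l'} -> be l = be l') ->
  (forall x y, agree S c x -> agree X x y -> kv P X be x = kv P X be y -> M x -> M y) ->
  exists U, leaf M S c X P be U.
Proof.
move=> sX X2 cX dX h; have /card_gt0P[i iX] : 0 < #|X| by apply: ltnW.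
pose K := kv P X be; have lK : lat K X by apply: lat_kval.
pose x0 x := mix X c x; pose y0 x := upd (x0 x) i (cmp M i (x0 x)).
have ag x : agree X x (y0 x) by apply: agree_upd => //; apply: agree_mix.
exists (fun x => K (y0 x)); split=> //.
  move=> x y axy; suff e : x0 x = x0 y by rewrite /y0 e.
  by apply/ffunP => k; rewrite !mixE; case: ifP => // /negbT /axy.
have fS x y : agree S c x -> agree X x y -> agree S c y.
  by move=> ax a; apply: agree_trans ax (agree_sub sX a).
move=> x ax; apply/idP/eqP => [Mx|e]; last first.
  apply: (h (y0 x) x); rewrite ?e //; [exact: fS (ag x) | exact/agree_sym/ag | exact: cmpP].
have [e1 e2] := thruP (x0 x) (K x) lK iX.
rewrite -/K -{1}e1; congr K; rewrite /y0 e2; congr upd.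
apply: (hM.2 (x0 x) i); last exact: cmpP.
rewrite -e2; apply: h Mx => //.
by rewrite e2; apply: agree_upd => //; apply: agree_mix.
Qed.

Definition two_leaves S c := exists X PX bX UX Y PY bY UY z,
  [/\ leaf M S c X PX bX UX, leaf M S c Y PY bY UY, [disjoint X & Y], agree S c z & mism M X PX bX Y PY bY z].

Lemma sumb2 (i j : I) (g : I -> bool) : i != j -> sumb [set i; j] g = g i (+) g j.
Proof. by move=> ij; rewrite /sumb big_setU1 ?inE //= big_set1. Qed.

Lemma pair_block (i j : I) r1 Q1 Q2 (G1 G2 : V -> V) : i != j -> injective G1 -> injective G2 ->
  exists P be k, [/\ forall l l', {in [set i; j], l =1 l'} -> be l = be l', forall l0, conn be [set i; j] l0 &
   forall x, kv P [set i; j] be x = ((kk r1 Q1 Q2 (G1 (x i)) (G2 (x j))).1 (+) k, (kk r1 Q1 Q2 (G1 (x i)) (G2 (x j))).2)].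
Proof.
move=> ij g1 g2; have [R1 [k1 [d1 [e1 h1]]]] := perm_coord Q1 g1.
have [R2 [k2 [d2 [e2 h2]]]] := perm_coord Q2 g2.
have ji : (j == i) = false by rewrite eq_sym (negbTE ij).
pose be l := ((l i (+) k1) && (l j (+) k2)) (+) (r1 && (l i (+) k1)) (+) (d1 && l i) (+) (d2 && l j) (+) e1 (+) e2.
exists (fun u => if u == i then R1 else R2), be, (k1 (+) k2); split.
- by move=> l l' e; rewrite /be !e // !inE eqxx ?orbT.
- move=> l0; apply: pair_conn => //; rewrite /dd /be !ffunE !eqxx ji (negbTE ij); clear.
  by case: r1; case: k1; case: k2; case: d1; case: d2; case: e1; case: e2; case: (l0 i); case: (l0 j).
move=> x; have [a1 a2] := h1 (x i); have [b1 b2] := h2 (x j).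
rewrite /kv /kval !sumb2 // eqxx ji /be !ffunE eqxx ji /kk a1 a2 b1 b2 /=; clear.
congr pair.
  by case: k1; case: k2; case: (lf _ _); case: (lf _ _).
move: (lf R1 _) (lf R2 _) (mf R1 _) (mf R2 _).
by case: r1; case: k1; case: k2; case: d1; case: d2; case: e1; case: e2; do 4!case.
Qed.

Lemma kk_inj r Q Q' u : injective (kk r Q Q' u).
Proof.
move=> v v'; rewrite /kk => -[] /addbI e; rewrite e => /addIb /addIb /addbI; exact: lfm_inj.
Qed.

Lemma rect_two_leaves (i j k w : I) (G1 G2 G3 G4 : V -> V) T c (S : {set I}) :
  S = [set i; j; k; w] -> uniq [:: i; j; k; w] ->
  injective G1 -> injective G2 -> injective G3 -> injective G4 ->
  (forall x, agree S c x -> M x = (G4 (x w) == T (G1 (x i)) (G2 (x j)) (G3 (x k)))) ->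
  rect T -> two_leaves S c.
Proof.
move=> eS /= /and4P[]; rewrite !inE !negb_or => /and3P[ij ik iw] /andP[jk jw] kw _ g1 g2 g3 g4 hMT.
move=> [r1 [Q1 [Q2 [r2 [Q3 [Q4 [g12 g34 [a [b [t [a' [b' [t' mm]]]]]]]]]]]]].
have [P [be [d [dep cn kE]]]] := pair_block r1 Q1 Q2 ij g1 g2.
have [P' [be' [d' [dep' cn' kE']]]] := pair_block r2 Q3 Q4 kw g3 g4.
have fS (X : {set I}) x y : X \subset S -> agree S c x -> agree X x y -> agree S c y.
  by move=> sX ax h; apply: agree_trans ax (agree_sub sX h).
have s1 : [set i; j] \subset S by rewrite eS subUset !sub1set !inE !eqxx ?orbT.
have s2 : [set k; w] \subset S by rewrite eS subUset !sub1set !inE !eqxx ?orbT.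
have [||U LU] := @leaf_intro S c [set i; j] P be s1 _ (cn _) dep.
- by rewrite cards2 ij.
- move=> x y ax axy; rewrite !kE => -[/addIb e1 e2]; rewrite !hMT //; last exact: fS ax axy.
  move/eqP=> e; rewrite !(axy k, axy w) ?inE ?negb_or ?(eq_sym _ i) ?(eq_sym _ j) ?ik ?jk ?iw ?jw // e.
  by apply/eqP/g12; rewrite [LHS]/kk e1 e2.
have [||U' LU'] := @leaf_intro S c [set k; w] P' be' s2 _ (cn' _) dep'.
- by rewrite cards2 kw.
- move=> x y ax axy; rewrite !kE' => -[/addIb e1 e2]; rewrite !hMT //; last exact: fS ax axy.
  move/eqP=> e; rewrite !(axy i, axy j) ?inE ?negb_or ?ik ?jk ?iw ?jw //.
  apply/eqP; apply: (@kk_inj r2 Q3 Q4 (G3 (y k))); rewrite -(g34 _ _ (G3 (x k))) -e.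
  by rewrite [RHS]/kk e1 e2.
have dj : [disjoint [set i; j] & [set k; w]].
  rewrite -setI_eq0; apply/eqP/setP => u; rewrite !inE; apply/negP => /andP[/orP[]/eqP-> /orP[]/eqP e]; subst.
  - by rewrite eqxx in ik.
  - by rewrite eqxx in iw.
  - by rewrite eqxx in jk.
  by rewrite eqxx in jw.
pose p u v s := upd (upd (upd (upd c i (invF g1 u)) j (invF g2 v)) k (invF g3 s)) w (invF g4 (T u v s)).
have pE u v s : [/\ p u v s i = invF g1 u, p u v s j = invF g2 v, p u v s k = invF g3 s & p u v s w = invF g4 (T u v s)].
  by rewrite /p !updE !eqxx !(negbTE ij) !(negbTE ik) !(negbTE iw) !(negbTE jk) !(negbTE jw) (negbTE kw).
have ap u v s : agree S c (p u v s).
  by do 4!(apply: agree_upd; first by rewrite eS !inE eqxx ?orbT).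
have Mp u v s : M (p u v s).
  by rewrite hMT //; have [-> -> -> ->] := pE u v s; rewrite !f_invF.
have E : [set i; j] :|: [set k; w] = S by rewrite eS setUA.
exists [set i; j], P, be, U, [set k; w], P', be', U', c; split=> //.
exists (p a b t), (p a' b' t'); rewrite E; split=> //.
rewrite !kE !kE' /=; have [-> -> -> ->] := pE a b t; have [-> -> -> ->] := pE a' b' t'; rewrite !f_invF.
by rewrite !(inj_eq (@addIb _)).
Qed.
End Leaves.

Definition lin4 s := has (fun Q1 => has (fun Q2 => has (fun Q3 => has (fun Q4 => has (fun k =>
  lall (fun x => lall (fun y => lall (fun t =>
    lf Q1 x (+) lf Q2 y (+) lf Q3 t (+) lf Q4 (at3 s x y t) == k) vs) vs) vs)
  [:: true; false]) parts) parts) parts) parts.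
Definition rectb (T : V -> V -> V -> V) := has (fun r1 => has (fun Q1 => has (fun Q2 =>
  if lall (fun x => lall (fun y => lall (fun x' => lall (fun y' =>
    if kk r1 Q1 Q2 x y == kk r1 Q1 Q2 x' y' then lall (fun t => T x y t == T x' y' t) vs else true) vs) vs) vs) vs
  then has (fun r2 => has (fun Q3 => has (fun Q4 =>
    if lall (fun x => lall (fun y => lall (fun t => lall (fun t' =>
       kk r2 Q3 Q4 t (T x y t) == kk r2 Q3 Q4 t' (T x y t')) vs) vs) vs) vs
    then has (fun x => has (fun y => has (fun t => has (fun x' => has (fun y' => has (fun t' =>
      ((kk r1 Q1 Q2 x y).1 == (kk r1 Q1 Q2 x' y').1) != ((kk r2 Q3 Q4 t (T x y t)).1 == (kk r2 Q3 Q4 t' (T x' y' t')).1))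
      vs) vs) vs) vs) vs) vs
    else false) parts) parts) [:: true; false]
  else false) parts) parts) [:: true; false].
(** The three tests with [rectb] are the three ways to split four coordinates into two pairs. *)
Definition ok4 s := if lin4 s then true else if rectb (at3 s) then true else
  if rectb (fun x t y => at3 s x y t) then true else rectb (fun y t x => at3 s x y t).
Lemma exts_ok4 : all (fun e => all ok4 (exts e)) [:: true; false].
Proof. by vm_compute. Qed.

Lemma rectbP T : rectb T -> rect T.
Proof.
case/hasP => r1 _ /hasP[Q1 _ /hasP[Q2 _]]; case: ifP => // h1 /hasP[r2 _ /hasP[Q3 _ /hasP[Q4 _]]]; case: ifP => // h2.
case/hasP => x _ /hasP[y _ /hasP[t _ /hasP[x' _ /hasP[y' _ /hasP[t' _ mm]]]]].
exists r1, Q1, Q2, r2, Q3, Q4; split.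
- move=> u v u' v' s e; move: h1.
  rewrite lallE => /allP/(_ u (mem_vs _)); rewrite lallE => /allP/(_ v (mem_vs _)).
  rewrite lallE => /allP/(_ u' (mem_vs _)); rewrite lallE => /allP/(_ v' (mem_vs _)).
  by rewrite e eqxx lallE => /allP/(_ s (mem_vs _))/eqP.
- move=> u v s s'; move: h2.
  rewrite lallE => /allP/(_ u (mem_vs _)); rewrite lallE => /allP/(_ v (mem_vs _)).
  by rewrite lallE => /allP/(_ s (mem_vs _)); rewrite lallE => /allP/(_ s' (mem_vs _))/eqP.
by exists x, y, t, x', y', t'.
Qed.

Section Base.
Variable I : finType.
Notation pt := {ffun I -> V}.
Notation bt := {ffun I -> bool}.
Implicit Types (x y z p c : pt) (l : bt) (S : {set I}).
Variable M : pt -> bool.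
Hypothesis hM : mds M.

Lemma set4_ex (S : {set I}) : #|S| = 4 -> exists i j k w, uniq [:: i; j; k; w] /\ S = [set i; j; k; w].
Proof.
move=> c4; have /card_gt0P[w wS] : 0 < #|S| by rewrite c4.
have c3 : #|S :\ w| = 3 by have := cardsD1 w S; rewrite wS c4 => -[].
have [i [j [k [ij ik jk e]]]] := set3_ex c3.
have eS : S = [set i; j; k; w] by rewrite -(setD1K wS) e setUC.
exists i, j, k, w; split=> //.
have /and3P[wi wj wk] : [&& w != i, w != j & w != k].
  have : w \notin S :\ w by rewrite !inE eqxx.
  by rewrite e !inE !negb_or -andbA.
by rewrite /= !inE !negb_or ij ik jk !(eq_sym _ w) wi wj wk.
Qed.

Lemma lin4_semi (i j k w : I) (G1 G2 G3 G4 : V -> V) T c (S : {set I}) :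
  S = [set i; j; k; w] -> uniq [:: i; j; k; w] ->
  injective G1 -> injective G2 -> injective G3 -> injective G4 ->
  (forall x, agree S c x -> M x = (G4 (x w) == T (G1 (x i)) (G2 (x j)) (G3 (x k)))) ->
  lin4 (tab T) -> semi M S c.
Proof.
move=> eS /= /and4P[]; rewrite !inE !negb_or => /and3P[ij ik iw] /andP[jk jw] kw _ g1 g2 g3 g4 hMT.
case/hasP=> Q1 _ /hasP[Q2 _ /hasP[Q3 _ /hasP[Q4 _ /hasP[s _ h]]]].
have H a b t : lf Q1 a (+) lf Q2 b (+) lf Q3 t (+) lf Q4 (T a b t) = s.
  move: h; rewrite lallE => /allP/(_ a (mem_vs _)); rewrite lallE => /allP/(_ b (mem_vs _)).
  by rewrite lallE => /allP/(_ t (mem_vs _)); rewrite at3_tab => /eqP.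
have [R1 [k1 [d1 [e1 h1]]]] := perm_coord Q1 g1; have [R2 [k2 [d2 [e2 h2]]]] := perm_coord Q2 g2.
have [R3 [k3 [d3 [e3 h3]]]] := perm_coord Q3 g3; have [R4 [k4 [d4 [e4 h4]]]] := perm_coord Q4 g4.
exists (fun u => if u == i then R1 else if u == j then R2 else if u == k then R3 else R4).
exists (s (+) k1 (+) k2 (+) k3 (+) k4) => x ax; rewrite hMT // => /eqP e.
rewrite /sumb eS -!setUA !big_setU1 ?inE ?negb_or ?ij ?ik ?iw ?jk ?jw ?kw //= big_set1.
rewrite eqxx !(eq_sym _ i) (negbTE ij) (negbTE ik) (negbTE iw) !(eq_sym _ j) eqxx (negbTE jk) (negbTE jw).
rewrite eqxx eq_sym (negbTE kw).
have := H (G1 (x i)) (G2 (x j)) (G3 (x k)); rewrite -e.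
have [-> _] := h1 (x i); have [-> _] := h2 (x j); have [-> _] := h3 (x k); have [-> _] := h4 (x w).
move=> <-; move: (lf _ _) (lf _ _) (lf _ _) (lf _ _); clear.
by case: k1; case: k2; case: k3; case: k4; do 4!case.
Qed.

Lemma rect_perm1 (T : V -> V -> V -> V) G1 G2 G3 G4 (i j k w : I) c (S : {set I}) :
  S = [set i; j; k; w] -> uniq [:: i; j; k; w] ->
  injective G1 -> injective G2 -> injective G3 -> injective G4 ->
  (forall x, agree S c x -> M x = (G4 (x w) == T (G1 (x i)) (G2 (x j)) (G3 (x k)))) ->
  rect (fun a t b => T a b t) -> two_leaves M S c.
Proof.
move=> eS hu g1 g2 g3 g4 hMT.
apply: (@rect_two_leaves _ _ hM i k j w G1 G3 G2 G4) => //; first by rewrite eS [_ :|: [set k]]setUAC.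
move: hu => /=; rewrite !inE !negb_or => /and4P[/and3P[-> -> ->] /andP[jk ->] -> _].
by rewrite eq_sym jk.
Qed.

Lemma rect_perm2 (T : V -> V -> V -> V) G1 G2 G3 G4 (i j k w : I) c (S : {set I}) :
  S = [set i; j; k; w] -> uniq [:: i; j; k; w] ->
  injective G1 -> injective G2 -> injective G3 -> injective G4 ->
  (forall x, agree S c x -> M x = (G4 (x w) == T (G1 (x i)) (G2 (x j)) (G3 (x k)))) ->
  rect (fun b t a => T a b t) -> two_leaves M S c.
Proof.
move=> eS hu g1 g2 g3 g4 hMT.
apply: (@rect_two_leaves _ _ hM j k i w G2 G3 G1 G4) => //.
  by rewrite eS; apply/setP => u; rewrite !inE; case: (u == i); case: (u == j); case: (u == k).
move: hu => /=; rewrite !inE !negb_or => /and4P[/and3P[ij ik ->] /andP[-> ->] -> _].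
by rewrite eq_sym ij eq_sym ik.
Qed.

(** A hyperplane has three coordinates and is semilinear. The relabellings [G1], [G2], [G3] turn it
    into the graph of [hc e], where [e] is its only mixed difference, and [G4] places it at [zr];
    the code then appears in the list [exts e]. *)
Lemma semi_or_leaves4 S c : #|S| = 4 -> semi M S c \/ two_leaves M S c.
Proof.
move=> /set4_ex[i [j [k [w [hu eS]]]]].
have := hu; rewrite /= !inE !negb_or => /and4P[/and3P[ij ik iw] /andP[jk jw] kw _].
have c3 : #|[set i; j; k]| = 3 by rewrite -setUA cardsU1 cards2 !inE negb_or ij ik jk.
have [P [s hs]] := semi3 hM c c3.
have [|be [dep hbe]] := semi_beta hM hs (i0 := i); first by rewrite !inE eqxx.
pose pb u v : bt := [ffun l => if l == i then u else if l == j then v else u (+) v (+) s].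
pose ga u v := be (pb u v).
pose e := ga false false (+) ga false true (+) ga true false (+) ga true true.
pose al := ga true false (+) ga false false; pose al' := ga false true (+) ga false false.
pose ka := ga false false.
have gaE u v : ga u v = (e && (u && v)) (+) (al && u) (+) (al' && v) (+) ka.
  rewrite /e /al /al' /ka; case: u; case: v; move: (ga _ _) (ga _ _) (ga _ _) (ga _ _); do 4!case=> //.
pose G1 a : V := (lf (P i) a, mf (P i) a (+) (al && lf (P i) a)).
pose G2 a : V := (lf (P j) a, mf (P j) a (+) (al' && lf (P j) a)).
pose G3 a : V := (lf (P k) a (+) s, mf (P k) a (+) ka).
pose G4 (a : V) : V := vx a (c w).
have g1 : injective G1 by move=> a b [h]; rewrite h => /addIb; apply: lfm_inj.
have g2 : injective G2 by move=> a b [h]; rewrite h => /addIb; apply: lfm_inj.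
have g3 : injective G3 by move=> a b [] /addIb h /addIb; apply: lfm_inj.
have g4 : injective G4 by apply: vx_inj.
have hM3 x : agree [set i; j; k] c x -> M x = (hc e (G1 (x i)) (G2 (x j)) == G3 (x k)).
  move=> ax; rewrite hbe // !sumb3 //.
  rewrite /hc /G1 /G2 /G3 /=.
  have [es|ns] := eqVneq (lf (P i) (x i) (+) lf (P j) (x j) (+) lf (P k) (x k)) s; last first.
    apply/esym/negP => /eqP [e1 _]; move: ns; rewrite e1 addbC addbA addbb; by rewrite eqxx.
  have -> : be (bits P x) = ga (lf (P i) (x i)) (lf (P j) (x j)).
    apply: dep => u; rewrite !inE !ffunE; have [->|ui] := eqVneq u i => //.
    have [->|uj] := eqVneq u j => //= /eqP->; rewrite -es.
    by move: (lf _ _) (lf _ _) (lf _ _); do 3!case.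
  rewrite gaE -es /=; move: (lf _ _) (lf _ _) (lf _ _) (mf _ _) (mf _ _) (mf _ _); clear.
  generalize e al al' ka; do 10!case=> //.
pose q a b t := upd (upd (upd c i (invF g1 a)) j (invF g2 b)) k (invF g3 t).
pose T a b t := phi M w (c w) (q a b t).
have qE a b t : [/\ q a b t i = invF g1 a, q a b t j = invF g2 b & q a b t k = invF g3 t].
  by rewrite /q !updE !eqxx (negbTE ij) (negbTE ik) (negbTE jk).
have hMT x : agree S c x -> M x = (G4 (x w) == T (G1 (x i)) (G2 (x j)) (G3 (x k))).
  move=> ax; rewrite /G4 /T /phi (inj_eq (@vx_inj _)).
  have -> : cmp M w (q (G1 (x i)) (G2 (x j)) (G3 (x k))) = cmp M w x.
    rewrite /cmp; congr odflt; apply: eq_pick => a; congr M; apply/ffunP => u.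
    rewrite !updE !invF_f; case: eqP => // /eqP uw; case: eqP => [->//|/eqP uk].
    case: eqP => [->//|/eqP uj]; case: eqP => [->//|/eqP ui].
    by rewrite ax // eS !inE !negb_or ui uj uk uw.
  apply/idP/eqP => [Mx|ew]; first by apply: (hM.2 x w); rewrite ?upd_eq //; apply: cmpP.
  by rewrite -(upd_eq x w) ew; apply: cmpP.
have aq a b t : agree [set i; j; k] c (q a b t).
  by do 3!(apply: agree_upd; first by rewrite !inE eqxx ?orbT).
have qw a b t : upd (q a b t) w (c w) = q a b t.
  rewrite -{2}(upd_eq (q a b t) w); congr upd; rewrite /q !updE.
  by rewrite !(eq_sym w) (negbTE iw) (negbTE jw) (negbTE kw).
have Text : tab T \in exts e.
  have qi a a' b t : q a' b t = upd (q a b t) i (invF g1 a').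
    apply/ffunP => u; rewrite !updE; case: (u =P k) => [->|_]; first by rewrite eq_sym (negbTE ik).
    case: (u =P j) => [->|_]; first by rewrite eq_sym (negbTE ij).
    by case: eqP.
  have qj a b b' t : q a b' t = upd (q a b t) j (invF g2 b').
    apply/ffunP => u; rewrite !updE; case: (u =P k) => [->|_]; first by rewrite eq_sym (negbTE jk).
    by case: (u =P j).
  have qk a b t t' : q a b t' = upd (q a b t) k (invF g3 t').
    by apply/ffunP => u; rewrite !updE; case: (u =P k).
  apply: extsP => [a b t|a b|a t|b t].
  - rewrite /T phi0 // qw (hM3 _ (aq a b t)); have [-> -> ->] := qE a b t.
    by rewrite !f_invF eq_sym.
  - move=> t t'; rewrite /T (qk a b t t') {1}(qk a b t t) => /(phi_inj hM kw) h.
    by rewrite -(f_invF g3 t) h f_invF.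
  - move=> b b'; rewrite /T (qj a b b' t) {1}(qj a b b t) => /(phi_inj hM jw) h.
    by rewrite -(f_invF g2 b) h f_invF.
  move=> a a'; rewrite /T (qi a a' b t) {1}(qi a a b t) => /(phi_inj hM iw) h.
  by rewrite -(f_invF g1 a) h f_invF.
have /allP/(_ _ Text) : all ok4 (exts e) by have /and3P[h1 h2 _] := exts_ok4; case: (e).
rewrite /ok4; case: ifP => [h _|_]; first by left; apply: (lin4_semi eS hu g1 g2 g3 g4 hMT h).
have X (T1 T2 : V -> V -> V -> V) : (forall a b t, T1 a b t = T2 a b t) -> rect T1 -> rect T2.
  move=> E [r1 [Q1 [Q2 [r2 [Q3 [Q4 [h1 h2 [a [b [t [a' [b' [t' h3]]]]]]]]]]]]].
  exists r1, Q1, Q2, r2, Q3, Q4; split=> [a1 b1 a1' b1' t1|a1 b1 t1 t1'|].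
  - by rewrite -!E; apply: h1.
  - by rewrite -!E; apply: h2.
  by exists a, b, t, a', b', t'; rewrite -!E.
case: ifP => [/rectbP h _|_].
  right; apply: (rect_two_leaves hM eS hu g1 g2 g3 g4 hMT); apply: X h => a b t; exact: at3_tab.
case: ifP => [/rectbP h _|_].
  right; apply: (rect_perm1 eS hu g1 g2 g3 g4 hMT); apply: X h => a b t; exact: at3_tab.
move=> /rectbP h.
right; apply: (rect_perm2 eS hu g1 g2 g3 g4 hMT); apply: X h => a b t; exact: at3_tab.
Qed.
End Base.

(** * Bit functions without mixed differences *)

Section Affine.
Variable I : finType.
Notation bt := {ffun I -> bool}.
Implicit Types (l : bt).

Lemma sumb_flip1 (F : {set I}) (ep : I -> bool) l u : u \in F ->
  sumb F (fun i => ep i && flipb l u i) = ep u (+) sumb F (fun i => ep i && l i).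
Proof.
move=> uF; rewrite !(sumbD1 _ uF) ffunE eqxx.
have -> : sumb (F :\ u) (fun i => ep i && flipb l u i) = sumb (F :\ u) (fun i => ep i && l i).
  by apply: eq_sumb => j; rewrite !inE ffunE => /andP[/negbTE->].
by rewrite addbA; congr addb; case: (ep u); case: (l u).
Qed.

Lemma agree_bits_ind (F : {set I}) l0 (Pr : bt -> Prop) : Pr l0 ->
  (forall l u, agree F l0 l -> u \in F -> Pr l -> Pr (flipb l u)) -> forall l, agree F l0 l -> Pr l.
Proof.
move=> h0 hs l; have [n] := ubnP #|[set k | l k != l0 k]|; elim: n l => // n IH l hn al.
case: (pickP (fun k => l k != l0 k)) => [k hk|h]; last first.
  by suff -> : l = l0 by []; apply/ffunP => k; apply/eqP; have := h k; move/negbFE.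
have kF : k \in F by apply: contraNT hk => kF; rewrite al.
rewrite -(flipbK l k); apply: hs => //; first exact: agree_flip.
apply: IH; last exact: agree_flip.
rewrite ltnS in hn; apply: leq_trans hn; apply: proper_card; apply/properP; split.
  apply/subsetP => u; rewrite !inE ffunE; have [->|_] := eqVneq u k => //.
exists k; rewrite inE; first exact: hk.
by rewrite ffunE eqxx; move: hk; case: (l k); case: (l0 k).
Qed.

Lemma dd_affine (be : bt -> bool) (F : {set I}) l0 :
  (forall u v l, u \in F -> v \in F -> u != v -> agree F l0 l -> dd be u v l = false) ->
  exists ep ka, forall l, agree F l0 l -> be l = sumb F (fun u => ep u && l u) (+) ka.
Proof.
move=> h; pose ep u := be l0 (+) be (flipb l0 u).
have hep u l : u \in F -> agree F l0 l -> be (flipb l u) = ep u (+) be l.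
  move=> uF; move: l; apply: agree_bits_ind => [|l v al vF IH].
    by rewrite /ep addbAC addbb.
  have [->|uv] := eqVneq v u.
    by rewrite flipbK -{1}(flipbK l u); rewrite flipbK IH addbA addbb.
  have := h u v l uF vF _ al; rewrite eq_sym uv => /(_ isT).
  rewrite /dd [flipb (flipb l v) u]flipbC IH.
  move: (be l) (be (flipb l v)) (be (flipb (flipb l u) v)) (ep u); by do 4!case.
exists ep, (be l0 (+) sumb F (fun u => ep u && l0 u)); apply: agree_bits_ind => [|l u al uF IH].
  by rewrite addbC -addbA addbb addbF.
by rewrite hep // IH sumb_flip1 // addbA.
Qed.
End Affine.

(** * A code all of whose hyperplanes are semilinear *)

Section Systems.
Variable I : finType.
Notation pt := {ffun I -> V}.
Notation bt := {ffun I -> bool}.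
Implicit Types (x y z p c : pt) (l : bt) (S F : {set I}) (P R : I -> option bool).
Variable M : pt -> bool.
Hypothesis hM : mds M.

Definition valid F c P := exists s, forall x, agree F c x -> M x -> sumb F (fun i => lf (P i) (x i)) = s.

Lemma cmp_M w x : M x -> cmp M w x = x w.
Proof. by move=> Mx; apply: (hM.2 x w); rewrite ?upd_eq //; apply: cmpP. Qed.

Lemma valid_sub F F' c c' P : F' \subset F -> agree F c c' -> valid F c P -> valid F' c' P.
Proof.
move=> sF ac [s hs]; exists (s (+) sumb (F :\: F') (fun i => lf (P i) (c' i))) => x ax Mx.
rewrite -(hs x) //; last by apply: agree_trans ac (agree_sub sF ax).
rewrite /sumb (big_setID F' (A := F)) /= (setIidPr sF) -/(sumb _ _) -/(sumb (F :\: F') _).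
have -> : sumb (F :\: F') (fun i => lf (P i) (x i)) = sumb (F :\: F') (fun i => lf (P i) (c' i)).
  by apply: eq_sumb => i; rewrite inE => /andP[h _]; rewrite ax.
by rewrite addbK.
Qed.

Lemma valid_ext F c P R : {in F, P =1 R} -> valid F c P -> valid F c R.
Proof.
by move=> e [s hs]; exists s => x ax Mx; rewrite -(hs x) //; apply: eq_sumb => i iF; rewrite e.
Qed.

(** With the other coordinates frozen, the code is a permutation [G] from the coordinate [u] to the
    coordinate [v]; both [P v] and [R v] are the image of the common partition at [u]. *)
Lemma valid_eq F c P R u v : valid F c P -> valid F c R -> u \in F -> v \in F -> P u = R u -> P v = R v.
Proof.
move=> [s hs] [r hr] uF vF e; have [<-//|uv] := eqVneq u v.
pose G a := cmp M v (upd c u a).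
have gi : injective G by apply: cmp_inj.
pose rest T := sumb (F :\ u :\ v) (fun i => lf (T i) (c i)).
have E T w : (forall x, agree F c x -> M x -> sumb F (fun i => lf (T i) (x i)) = w) ->
   forall a, lf (T v) (G a) = lf (T u) a (+) (w (+) rest T).
  move=> hT a; pose x := upd (upd c u a) v (G a).
  have ax : agree F c x by do 2!(apply: agree_upd => //).
  rewrite -(hT x ax (cmpP _ hM _)).
  rewrite (sumbD1 _ uF) (sumbD1 _ (_ : v \in F :\ u)); last by rewrite !inE eq_sym uv.
  rewrite /x !updE !eqxx (negbTE uv).
  have -> : sumb (F :\ u :\ v) (fun i => lf (T i) (x i)) = rest T.
    by apply: eq_sumb => i; rewrite !inE !updE => /and3P[/negbTE-> /negbTE->].
  by move: (lf _ _) (lf _ _) (rest T); do 3!case.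
apply/eqP/negPn/negP => ne.
have [b nb eb] := partner_ex (P v) zr.
have := lf_sep ne nb eb; have [a0 ea] : exists a, G a = zr by exists (invF gi zr); apply: f_invF.
have [a1 eb'] : exists a, G a = b by exists (invF gi b); apply: f_invF.
have := E _ _ hr a0; have := E _ _ hr a1; have := E _ _ hs a0; have := E _ _ hs a1.
rewrite ea eb' eb e => -> /addIb-> -> ->; by rewrite eqxx.
Qed.

Lemma valid_kval F c P t : t \in F -> 1 < #|F| -> valid F c P ->
  exists s ga, (forall l l', {in F :\ t, l =1 l'} -> ga l = ga l') /\
   forall x, agree F c x -> cmp M t x = kval P (P t) (F :\ t) s ga x.
Proof.
move=> tF F2 [s hs]; have [be [dep hbe]] := semi_beta hM hs tF.
pose lt l := sumb (F :\ t) l (+) s.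
(* On the code the bit at [t] is determined by the other bits, so it can be eliminated from [be]. *)
pose ga l := be [ffun u => if u == t then lt l else l u].
exists s, ga; split.
  move=> l l' e; apply: dep => u uF; rewrite !ffunE; case: eqP => [_|/eqP ut]; last by rewrite e // !inE ut.
  by rewrite /lt; congr addb; apply: eq_sumb => j jF; rewrite e.
move=> x ax; pose y := upd x t (cmp M t x).
have ay : agree F c y by apply: agree_upd.
have := cmpP t hM x; rewrite -/y hbe // => /andP[/eqP e1 /eqP e2].
have yt : y t = cmp M t x by rewrite updE eqxx.
have yo u : u != t -> y u = x u by move=> h; rewrite updE (negbTE h).
have E (g : I -> V -> bool) : sumb F (fun i => g i (y i)) = g t (cmp M t x) (+) sumb (F :\ t) (fun i => g i (x i)).
  rewrite (sumbD1 _ tF) yt; congr addb; apply: eq_sumb => u; rewrite !inE => /andP[ut _]. by congr (g u _); exact: yo.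
rewrite (E (fun i => lf (P i))) in e1; rewrite (E (fun i => mf (P i))) in e2.
apply: (@lfm_inj (P t)).
  rewrite lf_kval -e1; by rewrite addbC addbK.
rewrite mf_kval.
have -> : ga (bits P x) = be (bits P y).
  apply: dep => u uF; rewrite [LHS]ffunE [RHS]ffunE; case: eqP => [->|/eqP ut]; last by rewrite yo ?ffunE.
  rewrite yt /lt -e1 addbC; have -> : sumb (F :\ t) (bits P x) = sumb (F :\ t) (fun i => lf (P i) (x i)).
    by apply: eq_sumb => j _; rewrite ffunE.
  by rewrite addbK.
by rewrite -e2 addbC addbK.
Qed.

(** On the plane [u], [v] the code looks like addition in Z_4. Any partition at [t] other than [P t]
    reads a bit containing the product of two low bits, which is no sum of functions of one
    variable. *)
Lemma valid_rigid F c P t s ga u v x R : t \in F -> u \in F -> v \in F -> u != t -> v != t ->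
  (forall x, agree F c x -> cmp M t x = kval P (P t) (F :\ t) s ga x) ->
  agree F c x -> dd ga u v (bits P x) -> valid [set t; u; v] x R -> R t = P t.
Proof.
move=> tF uF vF ut vt hk ax hd [r hr].
have uv : u != v by apply: contraTneq hd => ->; rewrite dd_same.
apply/eqP/negPn/negP; rewrite eq_sym => ne.
have uE : u \in F :\ t by rewrite !inE ut. have vE : v \in F :\ t by rewrite !inE vt.
have Qn : P t != R t by [].
have [A1 [A2 [B1 B2 hh]]] := @canonical_plane I P (P t) (F :\ t) s ga x u v (R t) uE vE hd Qn.
pose y a b := upd (upd x u (A1 a)) v (A2 b).
have ay a b : agree F c (y a b) by do 2!(apply: agree_upd => //).
have key a b : (hc true a b).2 = r (+) lf (R u) (A1 a) (+) lf (R v) (A2 b).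
  have -> : (hc true a b).2 = lf (R t) (cmp M t (y a b)) by rewrite -hh -hk //; exact: ay.
  pose z := upd (y a b) t (cmp M t (y a b)).
  have az : agree [set t; u; v] x z.
    apply: agree_upd; first by rewrite !inE eqxx.
    do 2!(apply: agree_upd; first by rewrite !inE eqxx ?orbT).
    by [].
  have := hr z az (cmpP t hM _); rewrite sumb3 //; try by rewrite eq_sym.
  move=> <-.
  rewrite /z /y !updE !eqxx (negbTE ut) (negbTE vt) (negbTE uv).
  by move: (lf _ _) (lf _ _) (lf _ _); do 3!case.
have k1 := key zr zr; have k2 := key (true, false) zr; have k3 := key zr (true, false).
have k4 := key (true, false) (true, false); move: k1 k2 k3 k4; rewrite /hc /=.
move: (lf _ _) (lf _ _) (lf _ _) (lf _ _); clear; case: r; by do 4!case.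
Qed.

Lemma lf_mix (Q0 : option bool) e : exists Q, forall a, lf Q a = mf Q0 a (+) (e && lf Q0 a).
Proof.
case: Q0 => [[]|]; case: e; try by [exists None => - [[] []]]; try by [exists (Some true) => - [[] []]];
  by exists (Some false) => - [[] []].
Qed.

(** Without mixed differences [ga] is affine, so the second bit of the coordinate [t] is also a sum
    of bits of the single coordinates, and every partition at [t] can be used. *)
Lemma valid_free F c P t s ga Q : t \in F ->
  (forall x, agree F c x -> cmp M t x = kval P (P t) (F :\ t) s ga x) ->
  (forall u v l, u \in F :\ t -> v \in F :\ t -> u != v -> agree (F :\ t) (bits P c) l -> dd ga u v l = false) ->
  valid F c P -> (forall l l', {in F :\ t, l =1 l'} -> ga l = ga l') -> exists R, valid F c R /\ R t = Q.
Proof.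
move=> tF hk h vP dep; have [<-|ne] := eqVneq (P t) Q; first by exists P.
have [ep [ka hg]] := dd_affine h; have [d hd] := lf_other ne.
have hR u : exists Q1, forall a, lf Q1 a = mf (P u) a (+) ((ep u (+) d) && lf (P u) a) by apply: lf_mix.
have [R hR'] := fin_all_exists hR.
exists (fun u => if u == t then Q else R u); split; last by rewrite eqxx.
exists (ka (+) (d && s)) => x ax Mx; rewrite (sumbD1 _ tF) eqxx hd -(cmp_M t Mx) hk // lf_kval mf_kval.
pose l := [ffun u => if u \in F :\ t then bits P x u else bits P c u].
have al : agree (F :\ t) (bits P c) l by move=> u uF; rewrite ffunE (negbTE uF).
have -> : ga (bits P x) = ga l by apply: dep => u uF; rewrite [RHS]ffunE uF.
rewrite hg //.
have -> : sumb (F :\ t) (fun u => lf (if u == t then Q else R u) (x u)) =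
  sumb (F :\ t) (fun i => mf (P i) (x i)) (+) sumb (F :\ t) (fun u => ep u && l u) (+) (d && sumb (F :\ t) (fun i => lf (P i) (x i))).
  have -> : d && sumb (F :\ t) (fun i => lf (P i) (x i)) = sumb (F :\ t) (fun i => d && lf (P i) (x i)).
    by case: (d); rewrite //= /sumb big1.
  rewrite /sumb -!big_split; apply: eq_bigr => u uF; have /andP[ut _] : (u != t) && (u \in F) by rewrite -in_setD1.
  rewrite (negbTE ut) hR' /l !ffunE uF /= -addbA; congr addb.
  by case: (ep u); case: (d); case: (lf _ _).
move: (sumb _ _) (sumb _ _) (sumb _ _); clear.
by case: ka; case: d; case: s; do 3!case.
Qed.
End Systems.

Lemma ex_notin (I : finType) (S : {set I}) (r : seq I) : size r < #|S| -> exists2 t, t \in S & t \notin r.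
Proof.
move=> h; apply/exists_inP; apply: contraTT h; rewrite negb_exists -leqNgt => /forallP h.
apply: leq_trans (card_size r); apply: subset_leq_card; apply/subsetP => t tS.
by have := h t; rewrite tS negbK.
Qed.

Section Hyperplanes.
Variable I : finType.
Notation pt := {ffun I -> V}.
Notation bt := {ffun I -> bool}.
Implicit Types (x y p c : pt) (l : bt) (F : {set I}) (P R : I -> option bool).
Variable M : pt -> bool.
Hypothesis hM : mds M.
Variables (S : {set I}) (c : pt).
Hypothesis S5 : 4 < #|S|.
Local Notation valid := (valid M).

(** The constants of the parallel hyperplanes are a function of the coordinate [i]. Comparison with
    a single coordinate [j] shows that this function is, up to a constant, the bit of some partition
    at [i]. *)
Lemma valid_semi i P : i \in S -> (forall c', agree S c c' -> valid (S :\ i) c' P) -> semi M S c.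
Proof.
move=> iS h; have [j jS] : exists2 t, t \in S & t \notin [:: i] by apply: ex_notin; apply: leq_trans S5.
rewrite inE => ji; have jSi : j \in S :\ i by rewrite !inE ji.
pose G a := cmp M j (upd c i a).
have gi : injective G by apply: cmp_inj; rewrite // eq_sym.
have [Q [k [_d [_e hQ]]]] := perm_coord (P j) gi.
pose rest := sumb (S :\ i :\ j) (fun u => lf (P u) (c u)).
exists (fun u => if u == i then Q else P u), (k (+) rest) => x ax Mx.
pose ca := upd c i (x i); have aca : agree S c ca by apply: agree_upd.
have [r hr] := h _ aca.
have E : sumb (S :\ i) (fun u => lf (P u) (x u)) = lf (P j) (G (x i)) (+) rest.
  rewrite (hr x) //; last first.
    move=> u; rewrite !inE negb_and negbK /ca updE => /orP[/eqP->|uS]; first by rewrite eqxx.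
    by case: eqP => [->|_] //; apply: ax.
  pose y := upd ca j (G (x i)).
  have ay : agree (S :\ i) ca y by apply: agree_upd.
  rewrite -(hr y ay (cmpP _ hM _)) (sumbD1 _ jSi) /y updE eqxx; congr addb.
  apply: eq_sumb => u; rewrite !inE !updE => /and3P[/negbTE-> /negbTE->] //.
rewrite (sumbD1 _ iS) eqxx.
have -> : sumb (S :\ i) (fun u => lf (if u == i then Q else P u) (x u)) = sumb (S :\ i) (fun u => lf (P u) (x u)).
  by apply: eq_sumb => u; rewrite !inE => /andP[/negbTE->].
rewrite E; have [-> _] := hQ (x i).
by move: (lf _ _); clear; case: k; case: rest; case.
Qed.

(** Hyperplanes in different directions intersect, and there agreement at one coordinate spreads by
    [valid_eq]. Two directions [v], [v'] are used because each of them misses one coordinate. *)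
Lemma valid_two v v' c1 c2 P i c' R u : v \in S -> v' \in S -> i \in S -> v != v' -> i != v -> i != v' ->
  agree S c c1 -> agree S c c2 -> agree S c c' -> valid (S :\ v) c1 P -> valid (S :\ v') c2 P ->
  valid (S :\ i) c' R -> u \in S -> u != i -> R u = P u -> valid (S :\ i) c' P.
Proof.
move=> vS v'S iS vv iv iv' a1 a2 a' h1 h2 hR uS ui e.
have step w c0 u0 z : w \in S -> i != w -> agree S c c0 -> valid (S :\ w) c0 P ->
    u0 \in S -> u0 != i -> u0 != w -> R u0 = P u0 -> z \in S -> z != i -> z != w -> R z = P z.
  move=> wS iw a0 h0 u0S u0i u0w e0 zS zi zw.
  pose d := upd c0 i (c' i).
  have d1 : agree (S :\ w) c0 d by apply: agree_upd; rewrite // !inE iw.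
  have d2 : agree (S :\ i) c' d.
    move=> j; rewrite !inE negb_and negbK updE; case: eqP => [->//|/eqP/negbTE ji] /= jS.
    by rewrite a0 // a'.
  have s1 : S :\ i :\ w \subset S :\ w by apply: setSD; apply: subsetDl.
  have s2 : S :\ i :\ w \subset S :\ i by apply: subsetDl.
  apply: (valid_eq hM (valid_sub s2 d2 hR) (valid_sub s1 d1 h0) (u := u0)) => //; rewrite !inE.
    by rewrite u0w u0i.
  by rewrite zw zi.
have [t tS] : exists2 t, t \in S & t \notin [:: i; v; v'] by apply: ex_notin; apply: leq_trans S5.
rewrite !inE !negb_or => /and3P[ti tv tv'].
have A : forall z, z \in S -> z != i -> R z = P z.
  have et : R t = P t.
    have [uv|uv] := eqVneq u v; last exact: (step v c1 u).
    by apply: (step v' c2 u) => //; rewrite uv.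
  move=> z zS zi; have [zv|zv] := eqVneq z v; last exact: (step v c1 t).
  by apply: (step v' c2 t) => //; rewrite zv.
by apply: valid_ext hR => z; rewrite !inE => /andP[zi zS]; apply: A.
Qed.

Lemma valid_glue v v' c1 c2 Z1 Z2 u : v \in S -> v' \in S -> v != v' -> agree S c c1 -> agree S c c2 ->
  valid (S :\ v) c1 Z1 -> valid (S :\ v') c2 Z2 -> u \in S -> u != v -> u != v' -> Z1 u = Z2 u ->
  exists P, [/\ valid (S :\ v) c1 P, valid (S :\ v') c2 P & forall w, w != v -> P w = Z1 w].
Proof.
move=> vS v'S vv a1 a2 h1 h2 uS uv uv' e.
exists (fun j => if j == v then Z2 v else Z1 j); split.
- by apply: valid_ext h1 => j; rewrite !inE => /andP[/negbTE->].
- apply: (valid_ext _ h2) => j; rewrite !inE => /andP[jv' jS]; case: eqP => [->//|/eqP jv].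
  pose d := upd c1 v' (c2 v').
  have d1 : agree (S :\ v) c1 d by apply: agree_upd; rewrite // !inE eq_sym vv.
  have d2 : agree (S :\ v') c2 d.
    move=> k; rewrite !inE negb_and negbK updE; case: eqP => [->//|/eqP/negbTE ji] /= kS.
    by rewrite a1 // a2.
  have s1 : S :\ v' :\ v \subset S :\ v by apply: setSD; apply: subsetDl.
  have s2 : S :\ v' :\ v \subset S :\ v' by apply: subsetDl.
  apply/esym/(valid_eq hM (valid_sub s1 d1 h1) (valid_sub s2 d2 h2) (u := u)) => //; rewrite !inE.
    by rewrite uv uv'.
  by rewrite jv jv'.
by move=> w /negbTE->.
Qed.

Hypothesis hyp : forall w c', w \in S -> agree S c c' -> semi M (S :\ w) c'.

Lemma hypv w c' : w \in S -> agree S c c' -> exists P, valid (S :\ w) c' P.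
Proof. by move=> wS ac; have [P [s hs]] := hyp wS ac; exists P, s. Qed.

Definition free F c1 := forall t Q, t \in F -> exists R, valid F c1 R /\ R t = Q.

Lemma free_semi : (forall w c', w \in S -> agree S c c' -> free (S :\ w) c') -> semi M S c.
Proof.
move=> hf.
have [i iS _] : exists2 t, t \in S & t \notin [::] by apply: ex_notin; apply: leq_trans S5.
have [v vS] : exists2 t, t \in S & t \notin [:: i] by apply: ex_notin; apply: leq_trans S5.
rewrite inE => vi.
have [v' v'S] : exists2 t, t \in S & t \notin [:: i; v] by apply: ex_notin; apply: leq_trans S5.
rewrite !inE negb_or => /andP[v'i v'v].
have [u uS] : exists2 t, t \in S & t \notin [:: i; v; v'] by apply: ex_notin; apply: leq_trans S5.
rewrite !inE !negb_or => /and3P[ui uv uv'].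
have [Z1 h1] := hypv vS (agree_refl c).
have [|Z2 [h2 e2]] := hf v' c v'S (agree_refl _) u (Z1 u); first by rewrite !inE uv'.
have vv : v != v' by rewrite eq_sym.
have [P [p1 p2 _]] := valid_glue vS v'S vv (agree_refl _) (agree_refl _) h1 h2 uS uv uv' (esym e2).
apply: (valid_semi (P := P) iS) => c' ac.
have [|R [hR eR]] := hf i c' iS ac u (P u); first by rewrite !inE ui.
by apply: (valid_two vS v'S iS vv _ _ (agree_refl _) (agree_refl _) ac p1 p2 hR uS ui eR); rewrite eq_sym.
Qed.

Lemma dirs_semi i v v' c1 c2 P : i \in S -> v \in S -> v' \in S -> v != v' -> i != v -> i != v' ->
  agree S c c1 -> agree S c c2 -> valid (S :\ v) c1 P -> valid (S :\ v') c2 P ->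
  (forall c' R, agree S c c' -> valid (S :\ i) c' R -> exists R' u, [/\ valid (S :\ i) c' R', u \in S, u != i & R' u = P u]) ->
  semi M S c.
Proof.
move=> iS vS v'S vv iv iv' a1 a2 p1 p2 h; apply: (valid_semi (P := P) iS) => c' ac.
have [R hR] := hypv iS ac; have [R' [u [hR' uS ui e]]] := h c' R ac hR.
exact: (valid_two vS v'S iS vv iv iv' a1 a2 ac p1 p2 hR' uS ui e).
Qed.
End Hyperplanes.

Lemma lf_pair (Q Q' : option bool) u v : Q != Q' -> exists b, lf Q b = u /\ lf Q' b = v.
Proof.
move=> ne; suff /hasP[b _ /andP[/eqP ? /eqP ?]] : has (fun b => (lf Q b == u) && (lf Q' b == v)) vs by exists b.
by case: Q ne => [[]|]; case: Q' => [[]|] //; case: u; case: v.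
Qed.

Section Hyperplanes.
Variable I : finType.
Notation pt := {ffun I -> V}.
Notation bt := {ffun I -> bool}.
Implicit Types (x y c : pt) (l : bt) (F : {set I}) (P R : I -> option bool).
Variable M : pt -> bool.
Hypothesis hM : mds M.
Local Notation valid := (valid M).

Lemma strict_dd F c P t s ga Q : t \in F -> 
  (forall x, agree F c x -> cmp M t x = kval P (P t) (F :\ t) s ga x) ->
  (forall l l', {in F :\ t, l =1 l'} -> ga l = ga l') -> valid F c P ->
  (exists R, valid F c R /\ R t = Q) \/
  exists u v l, [/\ u \in F :\ t, v \in F :\ t, u != v, agree (F :\ t) (bits P c) l & dd ga u v l].
Proof.
move=> tF hk dep vP; have [h|h] := classic (exists R, valid F c R /\ R t = Q); [by left|right].
apply: NNPP => h'; apply: h; apply: (valid_free hM Q tF hk) => // u v l uF vF uv al.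
by apply/negP => d; apply: h'; exists u, v, l.
Qed.

Lemma face_ptof F c P t l : agree (F :\ t) (bits P c) l -> agree F c (ptof P l c) /\ bits P (ptof P l c) = l.
Proof.
by move=> al; split; [apply: agree_sub (agree_ptof al); apply: subsetDl | apply: bits_ptof].
Qed.

Lemma face_upd F x y w : agree F x y -> y w = x w -> agree (F :\ w) x y.
Proof. by move=> a e u; rewrite !inE negb_and negbK => /orP[/eqP->|/a]. Qed.

Lemma trip_sub F t u v w : t \in F -> u \in F -> v \in F -> w != t -> w != u -> w != v -> [set t; u; v] \subset F :\ w.
Proof.
move=> tF uF vF wt wu wv; rewrite !subUset !sub1set !inE tF uF vF.
by rewrite [t == w]eq_sym [u == w]eq_sym [v == w]eq_sym wt wu wv.
Qed.

Variables (S : {set I}) (c : pt).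
Hypothesis S5 : 4 < #|S|.
Hypothesis hyp : forall w c', w \in S -> agree S c c' -> semi M (S :\ w) c'.

Lemma hyp_card w : w \in S -> 1 < #|S :\ w|.
Proof. by move=> wS; move: S5; rewrite (cardsD1 w S) wS; case: #|_| => [|[]]. Qed.

(** * Semilinear hyperplanes, one with a nonzero mixed difference *)

Section Strict.
Variables (k : I) (c1 : pt) (P0 : I -> option bool) (t : I) (s : bool) (ga : bt -> bool) (p q : I) (l : bt).
Hypotheses (kS : k \in S) (a1 : agree S c c1) (v0 : valid (S :\ k) c1 P0) (tK : t \in S :\ k).
Hypothesis hk : forall x, agree (S :\ k) c1 x -> cmp M t x = kval P0 (P0 t) (S :\ k :\ t) s ga x.
Hypotheses (pE : p \in S :\ k :\ t) (qE : q \in S :\ k :\ t) (pq : p != q).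
Hypotheses (al : agree (S :\ k :\ t) (bits P0 c1) l) (dl : dd ga p q l).

Let tS : t \in S. Proof. by move: tK; rewrite !inE => /andP[]. Qed.
Let kt : t != k. Proof. by move: tK; rewrite !inE => /andP[]. Qed.
Let inE' u : u \in S :\ k :\ t -> [/\ u \in S, u != k & u != t].
Proof. by rewrite !inE => /and3P[? ? ?]. Qed.

Lemma fS w c' y : agree S c c' -> agree (S :\ w) c' y -> agree S c y.
Proof. by move=> a h; apply: agree_trans a (agree_sub _ h); apply: subsetDl. Qed.

Lemma strict_sys y u v w R : agree (S :\ k) c1 y -> u \in S :\ k :\ t -> v \in S :\ k :\ t -> dd ga u v (bits P0 y) ->
  w \in S -> w != t -> w != u -> w != v -> valid (S :\ w) y R -> R t = P0 t.
Proof.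
move=> ay uE vE d wS wt wu wv hR; have [uS uk ut] := inE' uE; have [vS vk vt] := inE' vE.
apply: (valid_rigid hM tK _ _ ut vt hk ay d); rewrite ?inE ?uk ?vk //.
by apply: valid_sub hR => //; apply: trip_sub.
Qed.

Variable i : I.
Hypotheses (iS : i \in S) (ik : i != k) (it : i != t) (ip : i != p) (iq : i != q).
Let iE : i \in S :\ k :\ t. Proof. by rewrite !inE it ik. Qed.
Let x := ptof P0 l c1.
Let ax : agree (S :\ k) c1 x. Proof. by have [] := face_ptof al. Qed.
Let bx : bits P0 x = l. Proof. exact: bits_ptof. Qed.
Let axS : agree S c x. Proof. exact: fS a1 ax. Qed.

(** The mixed difference in [p], [q] survives at every value of the coordinate [i], so all
    hyperplanes in direction [i] carry the partition [P t]. The one at [x] then cannot be free at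
    [k], so it has a mixed difference with root [k]; rigidity at that difference makes [P] valid in
    a second direction [p']. *)
Lemma strict_case1 P : P t = P0 t -> valid (S :\ k) c1 P -> valid (S :\ i) x P ->
  dd ga p q (flipb l i) -> semi M S c.
Proof.
move=> et h1 h2 d2; have [pS pk pt] := inE' pE; have [qS qk qt] := inE' qE.
have T c' R : agree S c c' -> valid (S :\ i) c' R -> R t = P t.
  move=> ac hR; rewrite et; pose x' := upd x i (c' i).
  apply: (@strict_sys x' p q i) => //.
  - by apply: agree_upd; rewrite // !inE ik.
  - by rewrite bits_upd bx; case: ifP.
  apply: valid_sub hR => //; apply: face_upd; last by rewrite updE eqxx.
  by apply: agree_trans (agree_sym ac) _; apply: agree_upd.
have kSi : k \in S :\ i by rewrite !inE eq_sym ik.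
have [s' [ga' [dep' hk']]] := valid_kval hM kSi (hyp_card iS) h2.
have [Q Qk] : exists Q, Q != P k by case: (P k) => [[]|]; [exists None | exists None | exists (Some true)].
have [[R [hR eR]]|[u [v [l2 [uE vE uv al2 d]]]]] := strict_dd Q kSi hk' dep' h2.
  case/eqP: Qk; rewrite -eR; apply: (valid_eq hM hR h2 (u := t)) => //; last exact: T axS hR.
  by rewrite !inE eq_sym it.
pose y := ptof P l2 x; have [ay by_] : agree (S :\ i) x y /\ bits P y = l2 by apply: face_ptof al2.
have ayS : agree S c y by apply: fS axS ay.
move: (uE) (vE); rewrite !inE => /and3P[uk ui uS] /and3P[vk vi vS].
have [p' p'S] : exists2 t, t \in S & t \notin [:: i; k; u; v] by apply: ex_notin.
rewrite !inE !negb_or => /and4P[p'i p'k p'u p'v].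
have [Z hZ] := hypv hyp p'S ayS.
have eZ : Z k = P k.
  apply: (valid_rigid hM kSi _ _ uk vk hk' ay); rewrite ?by_ // ?inE ?ui ?vi //.
  by apply: valid_sub hZ => //; apply: trip_sub.
have hZ' : valid (S :\ p') y P.
  have ki : k != i by rewrite eq_sym.
  by apply: (valid_two hM S5 kS iS p'S ki p'k p'i a1 axS ayS h1 h2 hZ kS _ eZ); rewrite eq_sym.
apply: (dirs_semi hM S5 hyp iS kS p'S _ ik _ a1 ayS h1 hZ'); rewrite 1?eq_sym // => c' R ac hR.
by exists R, t; split=> //; [rewrite eq_sym | apply: T hR].
Qed.

(** The two hyperplanes in direction [w] given by one class of [P w] admit the system [P]. *)
Definition along w P := exists be, forall b, lf (P w) b = be -> exists y, [/\ agree S c y, y w = b & valid (S :\ w) y P].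

Lemma strict_along P w u l1 : P t = P0 t -> P w = P0 w -> valid (S :\ k) c1 P -> valid (S :\ i) x P ->
  w \in S :\ k :\ t -> u \in S :\ k :\ t -> w != u -> w != i -> u != i ->
  agree (S :\ k :\ t) (bits P0 c1) l1 -> dd ga u i l1 -> along w P.
Proof.
move=> et ew h1 h2 wE uE wu wi ui a d; have [wS wk wt] := inE' wE.
exists (l1 w) => b eb; pose y := upd (ptof P0 l1 c1) w b; have [a2 b2] := face_ptof a.
have ay : agree (S :\ k) c1 y by apply: agree_upd; rewrite // !inE wk.
have by_ : bits P0 y = l1 by rewrite bits_upd b2 -ew eb eqxx.
have ayS : agree S c y by apply: fS a1 ay.
exists y; split=> //; first by rewrite updE eqxx.
have [R hR] := hypv hyp wS ayS; have ki : k != i by rewrite eq_sym.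
have eR : R t = P t by rewrite et; apply: (@strict_sys y u i w) => //; rewrite by_.
apply: (valid_two hM S5 kS iS wS ki wk wi a1 axS ayS h1 h2 hR tS _ eR); by rewrite eq_sym.
Qed.

(** Suppose a system [R] of a hyperplane in direction [i] differs from [P] at every coordinate. A
    mixed difference of [R] with root [t] that avoids [p] or [q] can be placed, since the bits of
    two distinct partitions are independent, in a hyperplane where [P] is valid, and rigidity gives
    [R t = P t]. One in [p], [q] does not change with the bit at [k], hence moves into the
    hyperplane of [c1]. So no such difference exists, [R] is free at [t], and [P t] can be
    prescribed there. *)
Lemma strict_case2 P : P t = P0 t -> valid (S :\ k) c1 P -> along p P -> along q P -> semi M S c.
Proof.
move=> et h1 gp gq; have [pS pk pt] := inE' pE; have [qS qk qt] := inE' qE.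
have [bp hp] := gp; have [y0 [ay0 _ hy0]] := hp _ (lf_dec (P p) bp false).
apply: (dirs_semi hM S5 hyp iS kS pS _ ik ip a1 ay0 h1 hy0); rewrite 1?eq_sym // => c' R ac hR.
apply: NNPP => N.
have ne u : u \in S -> u != i -> R u != P u by move=> uS ui; apply/eqP => e; apply: N; exists R, u.
have ti : t != i by rewrite eq_sym.
have tSi : t \in S :\ i by rewrite !inE ti.
have [s2 [ga2 [dep2 hk2]]] := valid_kval hM tSi (hyp_card iS) hR.
have A w u v l' : along w P -> w \in S -> w != i -> w != t -> w != u -> w != v ->
   u \in S :\ i :\ t -> v \in S :\ i :\ t -> agree (S :\ i :\ t) (bits R c') l' -> dd ga2 u v l' = false.
  move=> [be hbe] wS wi wt wu wv uE vE a; apply/negP => d.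
  move: (uE) (vE); rewrite !inE => /and3P[ut ui uS] /and3P[vt vi vS].
  have [b [eb1 eb2]] := lf_pair (l' w) be (ne w wS wi).
  have [y [ay yw hy]] := hbe b eb2; have [a2 b2] := face_ptof a.
  pose z := upd (ptof R l' c') w b.
  have az : agree (S :\ i) c' z by apply: agree_upd; rewrite // !inE wi.
  have bz : bits R z = l' by rewrite bits_upd b2 eb1 eqxx.
  apply: (elimN eqP (ne t tS ti)); apply/esym.
  apply: (valid_rigid hM tSi _ _ ut vt hk2 az); rewrite ?bz // ?inE ?ui ?vi //.
  apply: valid_sub hy; first exact: trip_sub.
  apply: face_upd; last by rewrite updE eqxx yw.
  by apply: agree_trans (agree_sym ay) _; apply: fS ac az.
have pI : p \in S :\ i :\ t by rewrite !inE pt eq_sym ip.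
have qI : q \in S :\ i :\ t by rewrite !inE qt eq_sym iq.
have kI : k \in S :\ i :\ t by rewrite !inE [k == t]eq_sym kt eq_sym ik.
have B l' : agree (S :\ i :\ t) (bits R c') l' -> dd ga2 p q l' = false.
  move=> a'; apply/negP => d.
  have [l2 [a2 d2 e2]] : exists l2, [/\ agree (S :\ i :\ t) (bits R c') l2, dd ga2 p q l2 & l2 k = lf (R k) (c1 k)].
    have [e|e] := eqVneq (l' k) (lf (R k) (c1 k)); first by exists l'.
    have af u : u \in S :\ i :\ t -> agree (S :\ i :\ t) (bits R c') (flipb l' u) by move=> uI; apply: agree_flip.
    exists (flipb l' k); split; [exact: af | | by rewrite ffunE eqxx; move: e; case: (l' k); case: (lf _ _)].
    have := dd3 ga2 p q k l'; rewrite d !(A q p k) //; try exact: af; rewrite 1?eq_sym //.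
    by case: (dd _ _ _ _).
  have [a3 b3] := face_ptof a2; pose z := upd (ptof R l2 c') k (c1 k).
  have az : agree (S :\ i) c' z by apply: agree_upd; rewrite // !inE eq_sym ik.
  have bz : bits R z = l2 by rewrite bits_upd b3 e2 eqxx.
  apply: (elimN eqP (ne t tS ti)); apply/esym.
  apply: (valid_rigid hM tSi _ _ pt qt hk2 az); rewrite ?bz // ?inE ?[p == i]eq_sym ?[q == i]eq_sym ?ip ?iq //.
  apply: valid_sub h1; first by apply: trip_sub; rewrite // eq_sym.
  apply: face_upd; last by rewrite updE eqxx.
  by apply: agree_trans (agree_sym a1) _; apply: fS ac az.
have [|R' [hR' eR']] := valid_free hM (P t) tSi hk2 _ hR dep2; last by apply: N; exists R', t; split; rewrite // eq_sym.
move=> u v l' uI vI uv a'.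
have [pu|pu] := eqVneq p u.
  have [qv|qv] := eqVneq q v; first by rewrite -pu -qv B.
  by apply: (A q); rewrite // 1?eq_sym // -pu // eq_sym.
have [pv|pv] := eqVneq p v; last by apply: (A p); rewrite // 1?eq_sym.
have [qu|qu] := eqVneq q u; first by rewrite -pv -qu ddC B.
by apply: (A q); rewrite // 1?eq_sym // -pv // eq_sym.
Qed.

Lemma strict_semi : semi M S c.
Proof.
have [pS pk pt] := inE' pE; have [qS qk qt] := inE' qE.
have [R1 hR1] := hypv hyp iS axS.
have e1 : P0 t = R1 t by apply/esym/(@strict_sys x p q i); rewrite ?bx.
have ki : k != i by rewrite eq_sym.
have ti : t != i by rewrite eq_sym.
have [P [h1 h2 hP]] := valid_glue hM kS iS ki a1 axS v0 hR1 tS kt ti e1.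
have et := hP t kt.
have [d|d] := boolP (dd ga p q (flipb l i)); first exact: (strict_case1 et h1 h2 d).
have af u : u \in S :\ k :\ t -> agree (S :\ k :\ t) (bits P0 c1) (flipb l u) by move=> uE; apply: agree_flip.
(* Flipping the bit at [i] has killed the mixed difference in [p], [q], so the third difference is
   nonzero, and differences in [q], [i] and in [p], [i] occur as well. *)
apply: (strict_case2 et h1).
  have := dd3 ga q p i l; rewrite ![dd ga q p _]ddC dl (negbTE d).
  have [d1|_] := boolP (dd ga q i l) => D.
    by apply: (@strict_along P p q l) => //; [exact: hP | rewrite eq_sym | rewrite eq_sym].
  by apply: (@strict_along P p q (flipb l p)) => //; [exact: hP | rewrite eq_sym | rewrite eq_sym | exact: af].
have := dd3 ga p q i l; rewrite dl (negbTE d).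
have [d1|_] := boolP (dd ga p i l) => D.
  by apply: (@strict_along P q p l) => //; [exact: hP | rewrite eq_sym | rewrite eq_sym | rewrite eq_sym].
by apply: (@strict_along P q p (flipb l q)) => //; [exact: hP | rewrite eq_sym | rewrite eq_sym | rewrite eq_sym | exact: af].
Qed.
End Strict.

Lemma hyperplanes_semi : semi M S c.
Proof.
have [h|h] := classic (forall w c', w \in S -> agree S c c' -> free M (S :\ w) c'); first exact: free_semi h.
have [k [c1 [kS a1 nf]]] : exists k c1, [/\ k \in S, agree S c c1 & ~ free M (S :\ k) c1].
  by apply: NNPP => h'; apply: h => k c1 kS a1; apply: NNPP => nf; apply: h'; exists k, c1.
have [t [Q [tK nR]]] : exists t Q, t \in S :\ k /\ ~ exists R, valid (S :\ k) c1 R /\ R t = Q.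
  by apply: NNPP => h'; apply: nf => t Q tK; apply: NNPP => nf; apply: h'; exists t, Q.
have [P0 v0] := hypv hyp kS a1.
have [s [ga [dep hk]]] := valid_kval hM tK (hyp_card kS) v0.
have [//|[p [q [l [pE qE pq al dl]]]]] := strict_dd Q tK hk dep v0.
have [i iS] : exists2 j, j \in S & j \notin [:: k; t; p; q] by apply: ex_notin.
rewrite !inE !negb_or => /and4P[ik it ip iq].
exact: (strict_semi kS a1 v0 tK hk pE qE pq al dl iS ik it ip iq).
Qed.
End Hyperplanes.

(** * Splitting off a connected component of a bit function *)

Section Component.
Variable I : finType.
Notation bt := {ffun I -> bool}.
Implicit Types (l : bt).
Variables (ga : bt -> bool) (l0 : bt).

Definition mixb (F : {set I}) l l' : bt := [ffun j => if j \in F then l j else l' j].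
Definition splits (F C : {set I}) := forall l, agree F l0 l ->
  ga l = ga (mixb C l l0) (+) ga (mixb (F :\: C) l l0) (+) ga l0.

Lemma mixb_agree F l : agree F l0 (mixb F l l0).
Proof. by move=> j jF; rewrite ffunE (negbTE jF). Qed.
Lemma mixb_id F l : agree F l0 l -> mixb F l l0 = l.
Proof. by move=> a; apply/ffunP => j; rewrite ffunE; case: ifP => // /negbT/a. Qed.

Lemma diff_mixb (F U W : {set I}) u l : u \in U -> U :|: W = F ->
  (forall v l, v \in W -> agree F l0 l -> dd ga u v l = false) -> agree F l0 l ->
  ga l (+) ga (flipb l u) = ga (mixb U l l0) (+) ga (flipb (mixb U l l0) u).
Proof.
move=> uU eF h a; pose l1 := mixb U l l0.
have a1 : agree W l1 l.
  by move=> j jW; rewrite ffunE; case: ifP => // /negbT jU; rewrite a // -eF inE negb_or jU.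
have al1 : agree F l0 l1 by apply: (agree_sub _ (@mixb_agree U l)); rewrite -eF subsetUl.
rewrite -/l1; clearbody l1; move: l a1 {a}; apply: agree_bits_ind => [//|m v am vW IH].
have amF : agree F l0 m by apply: agree_trans al1 _; apply: agree_sub am; rewrite -eF subsetUr.
have := h v m vW amF; rewrite /dd [flipb (flipb m u) v]flipbC.
rewrite -IH; move: (ga m) (ga (flipb m u)) (ga (flipb m v)) (ga (flipb (flipb m v) u)); clear; by do 4!case.
Qed.

Lemma splits_cut (F U : {set I}) : U \subset F ->
  (forall u v l, u \in U -> v \in F :\: U -> agree F l0 l -> dd ga u v l = false) -> splits F U.
Proof.
move=> sU h; have eF : U :|: (F :\: U) = F by rewrite setDE setUIr setUCr setIT; apply/setUidPr.
have eF' : (F :\: U) :|: U = F by rewrite setUC.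
have M1 (A : {set I}) l u : u \in A -> mixb A (flipb l u) l0 = flipb (mixb A l l0) u.
  by move=> uA; apply/ffunP => j; rewrite !ffunE; case: eqP => [->|]; rewrite ?uA.
have M2 (A : {set I}) l u : u \notin A -> mixb A (flipb l u) l0 = mixb A l l0.
  by move=> uA; apply/ffunP => j; rewrite !ffunE; case: ifP => // jA; case: eqP => // e; rewrite -e jA in uA.
apply: agree_bits_ind => [|l u al uF IH].
  rewrite !mixb_id; [|exact: agree_refl|exact: agree_refl]; by case: (ga l0).
have E : forall a b c d : bool, a (+) b = c (+) d -> b = a (+) c (+) d by do 4!case.
have [uU|uU] := boolP (u \in U).
  have := diff_mixb uU eF (fun v m vW => h u v m uU vW) al => /E ->.
  rewrite IH M1 // M2 ?inE ?uU //.
  move: (ga _) (ga _) (ga _) (ga _); by do 4!case.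
have uW : u \in F :\: U by rewrite inE uU.
have := diff_mixb uW eF' (fun v m vW am => etrans (ddC _ _ _ _) (h v u m vW uW am)) al => /E ->.
rewrite IH M2 // M1 //.
move: (ga _) (ga _) (ga _) (ga _); by do 4!case.
Qed.

(** As long as the function splits, pass to the side containing both [p] and [q]; the nonzero
    difference between them cannot straddle the splitting. *)
Lemma component (F : {set I}) p q l : p \in F -> q \in F -> agree F l0 l -> dd ga p q l ->
  exists C : {set I}, [/\ C \subset F, 1 < #|C|, conn ga C l0 & splits F C].
Proof.
have [n] := ubnP #|F|; elim: n F l => // n IH F l hn pF qF al d.
have pq : p != q by apply: contraTneq d => ->; rewrite dd_same.
have [cF|nc] := classic (conn ga F l0).
  exists F; split=> //.
    by rewrite (cardsD1 p) pF ltnS; apply/card_gt0P; exists q; rewrite !inE eq_sym pq.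
  move=> m am; rewrite mixb_id // setDv; have -> : mixb set0 m l0 = l0 by apply/ffunP => j; rewrite ffunE inE.
  by rewrite -addbA addbb addbF.
have [U [sU U0 UF hU]] : exists U : {set I}, [/\ U \subset F, U != set0, U != F &
    forall u v l, u \in U -> v \in F :\: U -> agree F l0 l -> dd ga u v l = false].
  apply: NNPP => h; apply: nc => U sU U0 UF; apply: NNPP => h'; apply: h; exists U; split=> // u v m uU vU am.
  by apply/negP => d'; apply: h'; exists u, v, m.
have step (A : {set I}) : A \proper F -> (forall u v l, u \in A -> v \in F :\: A -> agree F l0 l -> dd ga u v l = false) ->
   p \in A -> q \in A -> exists C : {set I}, [/\ C \subset F, 1 < #|C|, conn ga C l0 & splits F C].
  move=> pA hA pA' qA; have sA := proper_sub pA.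
  have eF : A :|: (F :\: A) = F by rewrite setDE setUIr setUCr setIT; apply/setUidPr.
  have dA : dd ga p q (mixb A l l0).
    have D1 := diff_mixb pA' eF (fun v m vW => hA p v m pA' vW) al.
    have al' : agree F l0 (flipb l q) by apply: agree_flip.
    have D2 := diff_mixb pA' eF (fun v m vW => hA p v m pA' vW) al'.
    have M1 u m : u \in A -> mixb A (flipb m u) l0 = flipb (mixb A m l0) u.
      by move=> uA; apply/ffunP => j; rewrite !ffunE; case: eqP => [->|]; rewrite ?uA.
    move: d; rewrite /dd D1 [flipb (flipb l p) q]flipbC -addbA D2 M1 //.
    by rewrite [flipb (flipb (mixb A l l0) p) q]flipbC addbA.
  have [|C [sC C2 cC spC]] := IH A (mixb A l l0) _ pA' qA (@mixb_agree _ _) dA.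
    by rewrite ltnS in hn; apply: leq_trans hn; apply: proper_card.
  exists C; split=> //; first exact: subset_trans sC sA.
  move=> m am; rewrite (splits_cut sA hA) // spC; last exact: @mixb_agree.
  have -> : mixb C (mixb A m l0) l0 = mixb C m l0.
    by apply/ffunP => j; rewrite !ffunE; case: ifP => // jC; rewrite (subsetP sC _ jC).
  have mF : agree F l0 (mixb (F :\: C) m l0) by apply: (agree_sub _ (@mixb_agree _ m)); apply: subsetDl.
  rewrite (splits_cut sA hA mF).
  have -> : mixb A (mixb (F :\: C) m l0) l0 = mixb (A :\: C) (mixb A m l0) l0.
    apply/ffunP => j; rewrite !ffunE !inE; have [jA|jA] := boolP (j \in A); rewrite ?andbF //=.
    by rewrite (subsetP sA _ jA) andbT.
  have -> : mixb (F :\: A) (mixb (F :\: C) m l0) l0 = mixb (F :\: A) m l0.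
    apply/ffunP => j; rewrite !ffunE !inE; have [jA|jA] := boolP (j \in A) => //=.
    by have [jF|jF] := boolP (j \in F) => //=; rewrite (contraNN (subsetP sC _) jA).
  move: (ga _) (ga _) (ga _) (ga _); by do 4!case.
have ex u v : u \in F -> v \in F -> dd ga u v l -> (u \in U) = (v \in U).
  move=> uF vF d'; apply/idP/idP => hu; apply: contraT => hv.
    by have := hU u v l hu; rewrite inE hv vF d' => /(_ isT al).
  by have := hU v u l hu; rewrite inE hv uF ddC d' => /(_ isT al).
have e := ex p q pF qF d.
have [pU|pU] := boolP (p \in U).
  apply: (step U) => //; last by rewrite -e.
  by rewrite properEneq UF.
apply: (step (F :\: U)); last 2 first.
- by rewrite inE pU.
- by rewrite inE -e pU.
- rewrite properE subsetDl /=; apply/negP => h; have /set0Pn[u uU] := U0.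
  by have := subsetP h _ (subsetP sU _ uU); rewrite inE uU.
move=> u v m uA; rewrite !inE negb_and negbK => /andP[/orP[vU|/negbTE->] // vF] am.
by rewrite ddC; apply: hU.
Qed.
End Component.

(** * Existence of two leaves *)

Lemma flp_affine (g : V -> bool) : (forall u, g u != g (flp u)) ->
  exists d e, forall u, g u = u.2 (+) (d && u.1) (+) e.
Proof.
move=> h; exists (g (false, false) (+) g (true, false)), (g (false, false)).
have := h (false, false); have := h (true, false); rewrite /flp /= => h1 h2.
by move: h1 h2; case=> [] h1 h2 [[] []] /=; move: h1 h2; bal_tac g; do 4!case.
Qed.

Section Step.
Variable I : finType.
Notation pt := {ffun I -> V}.
Notation bt := {ffun I -> bool}.
Implicit Types (x y p q c : pt) (l : bt).
Variable M : pt -> bool.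
Hypothesis hM : mds M.

Lemma leaf_base S c c' X P be U : agree S c c' -> leaf M S c X P be U -> leaf M S c' X P be U.
Proof.
move=> a [h1 h2 h3 h4 h5 h6]; split=> //; first exact: conn_dep h4 h3.
by move=> x ax; apply: h6; apply: agree_trans a ax.
Qed.

Lemma two_leaves_base (S : {set I}) c c' : agree S c c' -> two_leaves M S c -> two_leaves M S c'.
Proof.
move=> a [X [PX [bX [UX [Y [PY [bY [UY [z [h1 h2 h3 h4 h5]]]]]]]]]].
exists X, PX, bX, UX, Y, PY, bY, UY, z; split; rewrite ?(leaf_base a) //.
- exact: leaf_base a h1.
- exact: leaf_base a h2.
exact: agree_trans (agree_sym a) h4.
Qed.

Lemma semi_base (S : {set I}) c c' : agree S c c' -> semi M S c -> semi M S c'.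
Proof. by move=> a [P [s h]]; exists P, s => x ax; apply: h; apply: agree_trans a ax. Qed.

(* If both partitions matched at every position, the mixed differences of the first leaf in the
   direction [x1] would vanish. *)
Lemma leaf_exchange (T : {set I}) c (x1 x2 : I) (pi : V -> bool) Y P be U Y' P' be' U' z : x2 \notin T ->
  leaf M T c Y P be U -> leaf M T c Y' P' be' U' -> [disjoint Y & Y'] -> agree T c z ->
  mism M Y P be Y' P' be' z -> x1 \in Y ->
  exists p q, [/\ agree T c p, agree (x1 |: Y') p q, M p, M q &
    (pi (p x1) == pi (q x1)) != ((kv P' Y' be' p).1 == (kv P' Y' be' q).1)].
Proof.
move=> x2T; have <- : (x2 |: T) :\ x2 = T by rewrite setU1K.
set S := x2 |: T => LY LY' dY az mz x1Y; apply: NNPP => no.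
have [k kY'] := leaf_ex LY'; have lK' : lat (kv P' Y' be') Y' by apply: lat_kval.
have YT := subsetP (leaf_sub LY); have Y'T := subsetP (leaf_sub LY').
pose r x := thru (kv P' Y' be') x k (U' x).
have rP x : agree (S :\ x2) c x -> [/\ agree (S :\ x2) c (r x), agree Y' x (r x), M (r x) & kv P' Y' be' (r x) = U' x].
  move=> ax; have [e1 e2] := thruP x (U' x) lK' kY'.
  have a1 : agree Y' x (r x) by rewrite /r e2; apply: agree_upd.
  have a2 : agree (S :\ x2) c (r x) by apply: agree_trans ax (agree_sub (leaf_sub LY') a1).
  split=> //; rewrite (leaf_eq LY') // e1 /r e2 (U_upd LY') //.
have star x y : agree (S :\ x2) c x -> agree [set x1] x y -> (pi (x x1) == pi (y x1)) = ((U' x).1 == (U' y).1).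
  move=> ax axy; have ay : agree (S :\ x2) c y.
    by apply: agree_trans ax (agree_sub _ axy); rewrite sub1set; apply: YT.
  have [r1 r2 r3 r4] := rP x ax; have [s1 s2 s3 s4] := rP y ay.
  have x1Y' : x1 \notin Y' by rewrite (disjointFr dY x1Y).
  apply: NNPP => ne; apply: no; exists (r x), (r y); split=> //; last by apply/eqP; rewrite r4 s4 r2 // s2.
  apply: agree_trans (agree_sub _ (agree_sym r2)) _; first by apply: subsetUr.
  apply: agree_trans (agree_sub _ axy) (agree_sub _ s2); [exact: subsetUl | exact: subsetUr].
pose G u := U' (setX Y P be z x1 u).
have mdel := mism_del hM LY LY' dY az x1Y mz.
have [d [e hG]] := flp_affine (g := fun u => (G u).1) mdel.
have UG x : agree Y z x -> U' x = G (kv P Y be x).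
  move=> aa; apply/esym/(UY_fun LY LY' dY).
  - by apply: (agX LY az); apply: setX_agree.
  - by apply: agree_trans (agree_sym (setX_agree P be z _ x1Y)) aa.
  by have [-> _] := setXP P be z (kv P Y be x) x1Y.
have cY := conn_dep (bits P z) (leaf_dep LY) (leaf_conn LY).
have [j [l [jY jx al dl]]] := conn_nonempty_edge x1Y (leaf_card LY) cY.
pose f x i := upd x i (dec (P i) (~~ lf (P i) (x i)) (mf (P i) (x i))).
have fb x i : bits P (f x i) = flipb (bits P x) i.
  by rewrite bits_upd lf_dec ffunE; case: (lf _ _).
have fm' x i u : mf (P u) (f x i u) = mf (P u) (x u) by rewrite updE; case: eqP => [->|//]; rewrite mf_dec.
have fl x i : i \in Y -> sumb Y (fun u => lf (P u) (f x i u)) = ~~ sumb Y (fun u => lf (P u) (x u)).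
  move=> iY; have E (w : pt) : sumb Y (fun u => lf (P u) (w u)) = sumb Y (bits P w) by apply: eq_sumb => u _; rewrite ffunE.
  by rewrite !E fb sumb_flip.
pose A := ptof P l z; have aA : agree Y z A by apply: agree_ptof.
have bA : bits P A = l by apply: bits_ptof.
have af x i : i \in Y -> agree Y z x -> agree Y z (f x i) by move=> iY; apply: agree_upd.
have fc : f (f A x1) j = f (f A j) x1.
  by rewrite /f [in LHS]updE (negbTE jx) [in RHS]updE eq_sym (negbTE jx) updC // eq_sym.
have s1 : (G (kv P Y be A)).1 (+) (G (kv P Y be (f A x1))).1 = (G (kv P Y be (f A j))).1 (+) (G (kv P Y be (f (f A j) x1))).1.
  have aAj := af _ _ jY aA; have aAx := af _ _ x1Y aA; have aAjx := af _ _ x1Y aAj.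
  rewrite -!UG //.
  have aS x : agree Y z x -> agree (S :\ x2) c x by move=> h; apply: agree_trans az (agree_sub (leaf_sub LY) h).
  have a1 x : agree [set x1] x (f x x1) by apply: agree_upd; rewrite // inE.
  have h1 := star A (f A x1) (aS _ aA) (a1 _); have h2 := star (f A j) (f (f A j) x1) (aS _ (af _ _ jY aA)) (a1 _).
  have e1 : f A j x1 = A x1 by rewrite updE eq_sym (negbTE jx).
  have e2 : f (f A j) x1 x1 = f A x1 x1 by rewrite /f !updE !eqxx [x1 == j]eq_sym (negbTE jx).
  by move: h1 h2; rewrite e1 e2 => ->; case: (_.1); case: (_.1); case: (_.1); case: (_.1).
have Ksum x : kv P Y be x = (sumb Y (fun u => lf (P u) (x u)), sumb Y (fun u => mf (P u) (x u)) (+) be (bits P x)).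
  by rewrite /kv /kval addbF.
move: s1 dl; rewrite !hG !Ksum /= !fl // !fb bA /dd.
have mE x i : sumb Y (fun u => mf (P u) (f x i u)) = sumb Y (fun u => mf (P u) (x u)) by apply: eq_sumb => u _.
rewrite !mE [flipb (flipb l x1) j]flipbC.
move: (sumb _ _) (sumb _ _) (be _) (be _) (be _) (be _); clear.
by case: d; case: e; do 6!case.
Qed.
End Step.

Section Step.
Variable I : finType.
Notation pt := {ffun I -> V}.
Notation bt := {ffun I -> bool}.
Implicit Types (x y p q c : pt) (l : bt).
Variable M : pt -> bool.
Hypothesis hM : mds M.

Lemma good_leaf (S X : {set I}) (w : I) c PX bX UX : w \in S -> leaf M (S :\ w) c X PX bX UX ->
  (forall x, agree (S :\ w) c x -> lgd M w c X PX bX x) -> exists U, leaf M S c X PX bX U.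
Proof.
move=> wS LX hg; have sX : X \subset S by apply: subset_trans (leaf_sub LX) (subsetDl _ _).
have wX : w \notin X by apply/negP => /(subsetP (leaf_sub LX)); rewrite !inE eqxx.
apply: (leaf_intro hM sX (leaf_card LX) (leaf_conn LX) (leaf_dep LX)) => x y ax axy eK Mx.
pose x' := upd x w (c w); pose y' := upd y w (c w).
have ax' : agree (S :\ w) c x'.
  move=> j; rewrite !inE negb_and negbK updE; case: eqP => [->//|_] /=; exact: ax.
have axy' : agree X x' y' by move=> j jX; rewrite !updE; case: eqP => // _; apply: axy.
have := hg x' ax' x' y' (agree_refl _) axy'; rewrite !(K_upd LX) // !phi_upd => /(_ eK)/vx_inj e.
have := cmp_M hM w Mx; rewrite e -axy // => ey.
by rewrite -(upd_eq y w) -ey; apply: cmpP.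
Qed.

Section Rest.
Variables (S X : {set I}) (c : pt) (PX : I -> option bool) (bX : bt -> bool) (UX : pt -> V) (x1 : I).
Hypotheses (LX : leaf M S c X PX bX UX) (x1X : x1 \in X).
Local Notation K := (kv PX X bX).
Local Notation S1 := (x1 |: (S :\: X)).

Let lK : lat K X. Proof. exact: lat_kval. Qed.
Definition pin a := K (upd c x1 a).
Lemma pin_inj : injective pin. Proof. exact: lK. Qed.
(** The leaf is collapsed to its coordinate [x1]: the others are reset to their values in [c], and
    [x1] receives the entry that keeps the value of [K]. *)
Definition zeta x : pt := upd (mix X c x) x1 (invF pin_inj (K x)).

Lemma XS u : u \in X -> u \in S. Proof. exact: (subsetP (leaf_sub LX)). Qed.
Lemma S1S : S1 \subset S. Proof. by rewrite subUset sub1set XS // subsetDl. Qed.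
Lemma pinE x : (forall u, u \in X -> u != x1 -> x u = c u) -> K x = pin (x x1).
Proof.
move=> h; apply: (kv_dep _ (leaf_dep LX)) => u uX; rewrite updE; case: eqP => [->//|/eqP ux].
exact: h.
Qed.
Lemma zeta_off x u : u \notin X -> zeta x u = x u.
Proof.
move=> uX; rewrite updE mixE (negbTE uX); case: eqP => // e; by rewrite e x1X in uX.
Qed.
Lemma zeta_x1 x : pin (zeta x x1) = K x.
Proof. by rewrite updE eqxx f_invF. Qed.
Lemma zeta_K x : K (zeta x) = K x.
Proof.
rewrite -[RHS]zeta_x1 pinE // => u uX ux; by rewrite updE (negbTE ux) mixE uX.
Qed.
Lemma zeta_face x : agree S c x -> agree S1 c (zeta x).
Proof.
move=> ax u; rewrite !inE negb_or negb_and negbK => /andP[ux].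
rewrite updE (negbTE ux) mixE; case: ifP => // /negbT uX /=; exact: ax.
Qed.
Lemma zeta_agree x : agree X x (zeta x).
Proof. by move=> u uX; apply: zeta_off. Qed.
Lemma zeta_M x : agree S c x -> M (zeta x) = M x.
Proof.
move=> ax; rewrite (leaf_eq LX); last by apply: agree_trans ax (agree_sub (leaf_sub LX) (@zeta_agree x)).
by rewrite (leaf_eq LX) // zeta_K (leaf_off LX (@zeta_agree x)).
Qed.

Lemma leaf_lift Y P be U : leaf M S1 c Y P be U -> x1 \notin Y -> exists U', leaf M S c Y P be U' /\ [disjoint X & Y].
Proof.
move=> LY x1Y; have YX u : u \in Y -> u \notin X.
  move=> uY; have := subsetP (leaf_sub LY) _ uY; rewrite !inE => /orP[/eqP e|/andP[]//].
  by rewrite -e uY in x1Y.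
have sY : Y \subset S by apply: subset_trans (leaf_sub LY) S1S.
have KY x : kv P Y be (zeta x) = kv P Y be x.
  by apply: (kv_dep _ (leaf_dep LY)) => u uY; rewrite zeta_off // YX.
have [|U' LU'] := leaf_intro hM sY (leaf_card LY) (leaf_conn LY) (leaf_dep LY); last first.
  exists U'; split=> //; rewrite -setI_eq0; apply/eqP/setP => u; rewrite !inE; apply/negP => /andP[uX /YX].
  by rewrite uX.
move=> x y ax axy eK; have ay : agree S c y by apply: agree_trans ax (agree_sub sY axy).
rewrite -(zeta_M ax) -(zeta_M ay) (leaf_eq LY); last exact: zeta_face.
rewrite (leaf_eq LY); last exact: zeta_face.
rewrite !KY eK; suff -> : U (zeta x) = U (zeta y) by [].
apply: (leaf_off LY) => u uY; rewrite !updE !mixE; case: eqP => [_|_]; last by case: ifP => // _; apply: axy.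
congr (invF pin_inj _); apply: (kv_dep _ (leaf_dep LX)) => v vX; apply: axy.
by apply: contraTN vX => /YX.
Qed.

Hypothesis S1c : 2 < #|S1|.

(** [Q] is the partition at [x1] that corresponds to the first bit of the value of [X]. A system of
    the smaller code with [Q] at [x1] lifts to the whole code. If there is none, mixed differences
    with root [x1] exist; a connected component of them is a second leaf [C], and the mismatch is
    the inequality of [P x1] and [Q]. *)
Lemma semi_rest : semi M S1 c -> semi M S c \/ two_leaves M S c.
Proof.
move=> [P [s0 hs0]]; have x1S1 : x1 \in S1 by rewrite !inE eqxx.
have eE : S1 :\ x1 = S :\: X by rewrite setU1K // !inE x1X.
have vP : valid M S1 c P by exists s0.
have [s [ga [dep hk]]] := valid_kval hM x1S1 (ltnW S1c) vP.
have [Q [k [_d [_e hQ]]]] := perm_coord None pin_inj.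
have viaQ R : valid M S1 c R -> R x1 = Q -> semi M S c.
  move=> [r hr] eR; exists (fun u => if u \in X then PX u else R u), (r (+) k) => x ax Mx.
  have := hr _ (zeta_face ax); rewrite zeta_M // => /(_ Mx).
  rewrite (sumbD1 _ x1S1) eR eE => <-.
  have [h1 _] := hQ (zeta x x1).
  have KE : (K x).1 = sumb X (fun u => lf (PX u) (x u)) by rewrite /kv /kval /= addbF.
  rewrite zeta_x1 [lf None _]KE in h1.
  rewrite /sumb (big_setID X) /= (setIidPr (leaf_sub LX)) -/(sumb _ _) -/(sumb (S :\: X) _) -/(sumb (S :\: X) _).
  have -> : sumb X (fun u => lf (if u \in X then PX u else R u) (x u)) = sumb X (fun u => lf (PX u) (x u)).
    by apply: eq_sumb => u ->.
  rewrite h1; have -> : sumb (S :\: X) (fun u => lf (if u \in X then PX u else R u) (x u)) = sumb (S :\: X) (fun i => lf (R i) (zeta x i)).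
    by apply: eq_sumb => u; rewrite inE => /andP[uX _]; rewrite zeta_off // (negbTE uX).
  by rewrite -!addbA; congr addb; rewrite addbC.
have [[R [vR eR]]|[p [q [l [pE qE pq al dl]]]]] := strict_dd hM Q x1S1 hk dep vP; first by left; apply: viaQ eR.
have [eQ|nQ] := eqVneq (P x1) Q; first by left; apply: viaQ eQ.
right; have [C [sC C2 cC spC]] := component pE qE al dl.
pose l0 := bits P c; pose gC l := ga (mixb C l l0).
have CE u : u \in C -> [/\ u \in S, u \notin X & u != x1].
  move=> /(subsetP sC); rewrite eE inE => /andP[uX uS]; split=> //; by apply: contraNneq uX => ->.
have depC : forall l l', {in C, l =1 l'} -> gC l = gC l'.
  by move=> m m' e; congr ga; apply/ffunP => j; rewrite !ffunE; case: ifP => // jC; apply: e.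
have cgC : conn gC C l0.
  move=> U sU U0 UC; have [i [j [m [iU jU am dm]]]] := cC U sU U0 UC.
  have jC : j \in C by move: jU; rewrite inE => /andP[].
  have iC := subsetP sU _ iU.
  exists i, j, m; split=> //; rewrite /dd /gC !mixb_id //; by do ?apply: agree_flip.
have sCS : C \subset S by apply/subsetP => u /CE[].
pose h x := kval P (P x1) (S1 :\ x1) s ga x.
have Mh x : agree S c x -> M x = (zeta x x1 == h x).
  move=> ax; have az := zeta_face ax.
  have -> : h x = h (zeta x).
    rewrite /h /kval; congr dec; [congr addb|congr addb].
    - by apply: eq_sumb => u; rewrite eE inE => /andP[uX _]; rewrite zeta_off.
    - by apply: eq_sumb => u; rewrite eE inE => /andP[uX _]; rewrite zeta_off.
    by apply: dep => u; rewrite eE inE => /andP[uX _]; rewrite [LHS]ffunE [RHS]ffunE zeta_off.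
  rewrite /h -hk // -(zeta_M ax); apply/idP/eqP => [Mz|e]; first by rewrite (cmp_M hM).
  by rewrite -(upd_eq (zeta x) x1) e; apply: cmpP.
have bC : conn gC C (bits P c) by [].
have hE x : h x = dec (P x1) (sumb C (fun u => lf (P u) (x u)) (+) (sumb (S1 :\ x1 :\: C) (fun u => lf (P u) (x u)) (+) s))
   ((sumb C (fun u => mf (P u) (x u)) (+) gC (bits P x)) (+) (sumb (S1 :\ x1 :\: C) (fun u => mf (P u) (x u)) (+)
     (ga (mixb (S1 :\ x1 :\: C) (bits P x) l0) (+) ga l0))).
  pose m := mixb (S1 :\ x1) (bits P x) l0.
  have -> : h x = dec (P x1) (sumb (S1 :\ x1) (fun u => lf (P u) (x u)) (+) s) (sumb (S1 :\ x1) (fun u => mf (P u) (x u)) (+) ga m).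
    by rewrite /h /kval; congr dec; congr addb; apply: dep => u uE; rewrite [RHS]ffunE uE.
  rewrite (spC m (@mixb_agree _ _ _ _)).
  have -> : ga (mixb C m l0) = gC (bits P x).
    by congr ga; apply/ffunP => j; rewrite !ffunE; case: ifP => // jC; rewrite (subsetP sC _ jC).
  have -> : mixb (S1 :\ x1 :\: C) m l0 = mixb (S1 :\ x1 :\: C) (bits P x) l0.
    by apply/ffunP => j; rewrite !ffunE; case: ifP => //; rewrite inE => /andP[_ ->].
  have E (g : I -> bool) : sumb (S1 :\ x1) g = sumb C g (+) sumb (S1 :\ x1 :\: C) g.
    by rewrite /sumb (big_setID C) /= (setIidPr sC).
  rewrite !E; congr dec; first by rewrite addbA.
  move: (sumb _ _) (sumb _ _) (gC _) (ga _) (ga _); by do 5!case.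
have KC x : kv P C gC x = (sumb C (fun u => lf (P u) (x u)), sumb C (fun u => mf (P u) (x u)) (+) gC (bits P x)).
  by rewrite /kv /kval addbF.
have [|UC LC] := leaf_intro hM sCS C2 bC depC.
  move=> x y ax axy; rewrite !KC => -[e1 e2]; have ay : agree S c y by apply: agree_trans ax (agree_sub sCS axy).
  rewrite !Mh // !hE e1 e2.
  have -> : zeta y x1 = zeta x x1.
    apply: pin_inj; rewrite !zeta_x1; apply: (kv_dep _ (leaf_dep LX)) => u uX; apply: axy.
    by apply: contraTN uX => /CE[].
  have E u : u \in S1 :\ x1 :\: C -> y u = x u by case/setDP => _ uC; apply: axy.
  have -> : sumb (S1 :\ x1 :\: C) (fun u => lf (P u) (y u)) = sumb (S1 :\ x1 :\: C) (fun u => lf (P u) (x u)).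
    by apply: eq_sumb => u /E->.
  have -> : sumb (S1 :\ x1 :\: C) (fun u => mf (P u) (y u)) = sumb (S1 :\ x1 :\: C) (fun u => mf (P u) (x u)).
    by apply: eq_sumb => u /E->.
  suff -> : mixb (S1 :\ x1 :\: C) (bits P y) l0 = mixb (S1 :\ x1 :\: C) (bits P x) l0 by [].
  by apply/ffunP => j; rewrite [LHS]ffunE [RHS]ffunE; case: ifP => // /E e; rewrite ffunE e ffunE.
have dXC : [disjoint X & C].
  by rewrite -setI_eq0; apply/eqP/setP => u; rewrite !inE; apply/negP => /andP[uX /CE[_]]; rewrite uX.
exists X, PX, bX, UX, C, P, gC, UC, c; split=> //.
have [i iC] : exists i, i \in C by apply/card_gt0P/ltnW.
have [iS iX ix1] := CE i iC.
(* The entries [zr] and [b] lie in one class of [P x1] and in different classes of [Q]: the first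
   bits of the values on [C] agree, those on [X] do not. *)
have [b nb eb] := partner_ex (P x1) zr.
have nlf := lf_sep nQ nb eb.
pose p' a := upd (upd c x1 a) i (cmp M i (upd c x1 a)).
have ap a : agree (X :|: C) c (p' a) by do 2!(apply: agree_upd; first by rewrite !inE ?x1X ?iC ?orbT).
have apS a : agree S c (p' a) by apply: agree_sub (ap a); rewrite subUset (leaf_sub LX).
have Mp a : M (p' a) by apply: cmpP.
have Kp a : K (p' a) = pin a.
  by apply: (kv_dep _ (leaf_dep LX)) => u uX; rewrite [LHS]updE; case: eqP => // e; rewrite -e uX in iX.
have zp a : zeta (p' a) x1 = a by apply: pin_inj; rewrite zeta_x1 Kp.
have hp a : h (p' a) = a by have := Mh _ (apS a); rewrite Mp zp => /esym/eqP.
have KCp a : (kv P C gC (p' a)).1 = lf (P x1) a (+) (sumb (S1 :\ x1 :\: C) (fun u => lf (P u) (c u)) (+) s).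
  have := congr1 (lf (P x1)) (hp a); rewrite hE lf_dec KC /= => <-.
  have -> : sumb (S1 :\ x1 :\: C) (fun u => lf (P u) (p' a u)) = sumb (S1 :\ x1 :\: C) (fun u => lf (P u) (c u)).
    apply: eq_sumb => u; rewrite 3!inE => /and3P[uC ux _].
    by rewrite !updE (negbTE ux); case: eqP => // e; rewrite -e (negbTE uC) in iC.
  by rewrite addbK.
exists (p' zr), (p' b); split=> //; rewrite !KCp eb eqxx !Kp.
have [h1 _] := hQ zr; have [h2 _] := hQ b.
rewrite -[(pin zr).1]/(lf None (pin zr)) -[(pin b).1]/(lf None (pin b)) h1 h2 (inj_eq (@addIb _)).
by rewrite (negbTE nlf).
Qed.
End Rest.

Lemma one_leaf_step (S X : {set I}) c PX bX UX : leaf M S c X PX bX UX -> 2 < #|S :\: X| ->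
  (forall T : {set I}, #|T| < #|S| -> 3 < #|T| -> semi M T c \/ two_leaves M T c) -> semi M S c \/ two_leaves M S c.
Proof.
move=> LX h3 IH; have [x1 x1X] : exists i, i \in X by apply/card_gt0P/ltnW/(leaf_card LX).
set S1 := x1 |: (S :\: X); have c1 : #|S1| = #|S :\: X|.+1 by rewrite cardsU1 !inE x1X.
have cS : #|S :\: X| + #|X| = #|S| by rewrite addnC -(cardsID X S) (setIidPr (leaf_sub LX)).
have X2 := leaf_card LX.
(* A second element of [X] lies outside [S1]; it serves as the auxiliary direction that the lemmas
   on leaves of a hyperplane expect. *)
have [x2 x2X] : exists2 t, t \in X & t \notin [:: x1] by apply: ex_notin.
rewrite inE => x21; have x2S1 : x2 \notin S1 by rewrite !inE negb_or x21 x2X.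
have [||h|[Y [P [be [U [Y' [P' [be' [U' [z [LY LY' dY az mz]]]]]]]]]]] := IH S1.
- by rewrite c1 -cS -addn1 ltn_add2l.
- by rewrite c1.
- by apply: (semi_rest LX x1X); rewrite ?c1 // ltnW.
right; have sS := S1S LX x1X.
have azS : agree S c z by apply: agree_sub az.
have ex A PA bA UA B PB bB UB : leaf M S1 c A PA bA UA -> leaf M S1 c B PB bB UB -> [disjoint A & B] ->
    mism M A PA bA B PB bB z -> x1 \in A -> two_leaves M S c.
  move=> LA LB dAB mAB x1A; have x1B : x1 \notin B by rewrite (disjointFr dAB x1A).
  have [UB' [LB' dXB]] := leaf_lift LX x1X LB x1B.
  have [p [q [ap apq Mp Mq ne]]] := leaf_exchange hM (fun a => (pin X c PX bX x1 a).1) x2S1 LA LB dAB az mAB x1A.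
  exists X, PX, bX, UX, B, PB, bB, UB', p; split=> //; first exact: agree_sub ap.
  have aq : agree S1 c q.
    apply: agree_trans ap (agree_sub _ apq); rewrite subUset sub1set !inE eqxx /=.
    exact: leaf_sub LB.
  exists p, q; split=> //.
    by apply: agree_sub apq; apply: setSU; rewrite sub1set.
  have KE y : agree S1 c y -> kv PX X bX y = pin X c PX bX x1 (y x1).
    move=> ay; apply: (pinE LX) => u uX ux; apply: ay; by rewrite !inE negb_or ux uX.
  by rewrite !KE.
have [x1Y|x1Y] := boolP (x1 \in Y); first exact: (ex _ _ _ _ _ _ _ _ LY LY' dY mz x1Y).
have [x1Y'|x1Y'] := boolP (x1 \in Y').
  by apply: (ex _ _ _ _ _ _ _ _ LY' LY _ (mism_sym mz) x1Y'); rewrite disjoint_sym.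
have [V1 [LV _]] := leaf_lift LX x1X LY x1Y; have [V2 [LV' _]] := leaf_lift LX x1X LY' x1Y'.
by exists Y, P, be, V1, Y', P', be', V2, z.
Qed.

Theorem semi_or_two_leaves (S : {set I}) c : 3 < #|S| -> semi M S c \/ two_leaves M S c.
Proof.
have [n] := ubnP #|S|; elim: n S c => // n IH S c hn h3.
have [e4|n4] := eqVneq #|S| 4; first exact: semi_or_leaves4.
have S5 : 4 < #|S| by rewrite ltn_neqAle eq_sym n4.
have [h|nh] := classic (forall w c', w \in S -> agree S c c' -> semi M (S :\ w) c').
  by left; apply: hyperplanes_semi.
have [w [c' [wS ac ns]]] : exists w c', [/\ w \in S, agree S c c' & ~ semi M (S :\ w) c'].
  by apply: NNPP => h; apply: nh => w c' wS ac; apply: NNPP => ns; apply: h; exists w, c'.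
have cw : #|S| = #|S :\ w|.+1 by rewrite (cardsD1 w) wS.
suff [h|h] : semi M S c' \/ two_leaves M S c'; [left|right|].
- exact: semi_base (agree_sym ac) h.
- exact: two_leaves_base (agree_sym ac) h.
have h1 : #|S :\ w| < n by rewrite -ltnS -cw.
have h2 : 3 < #|S :\ w| by rewrite -ltnS -cw.
case: (IH (S :\ w) c' h1 h2) => [h|]; first by case: ns.
move=> [X [PX [bX [UX [Y [PY [bY [UY [z [LX LY dXY az mz]]]]]]]]]].
have IH' (T : {set I}) : #|T| < #|S| -> 3 < #|T| -> semi M T c' \/ two_leaves M T c'.
  by move=> hT; apply: IH; apply: leq_trans hT _; rewrite -ltnS.
have big (A B : {set I}) : A \subset S :\ w -> B \subset S :\ w -> [disjoint A & B] -> 1 < #|B| -> 2 < #|S :\: A|.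
  move=> sA sB dAB B2; apply: leq_trans (subset_leq_card (_ : w |: B \subset _)).
    rewrite cardsU1; have -> : w \notin B by apply/negP => /(subsetP sB); rewrite !inE eqxx.
    by [].
  rewrite subUset sub1set !inE wS andbT; apply/andP; split.
    by apply/negP => /(subsetP sA); rewrite !inE eqxx.
  apply/subsetP => u uB; rewrite inE (disjointFl dAB uB) /=.
  by have := subsetP sB _ uB; rewrite !inE => /andP[].
have [h|h] := all_good hM LX LY dXY az mz.
  have [U LU] := good_leaf wS LY h; apply: one_leaf_step LU _ IH'.
  by apply: big (leaf_sub LY) (leaf_sub LX) _ (leaf_card LX); rewrite disjoint_sym.
have [U LU] := good_leaf wS LX h; apply: one_leaf_step LU _ IH'.
exact: big (leaf_sub LX) (leaf_sub LY) dXY (leaf_card LY).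
Qed.
End Step.

(** * Counting *)

(** Counting by covering lists, because the properties to be counted are propositions rather than
    decidable predicates; repetitions only weaken a bound. *)
Definition cov (T : eqType) (R : T -> Prop) (b : nat) :=
  exists2 r : seq T, size r <= b & forall x, R x -> x \in r.

Lemma cov_sub (T : eqType) (R R' : T -> Prop) a b : (forall x, R x -> R' x) -> a <= b -> cov R' a -> cov R b.
Proof. by move=> h hab [r hr cr]; exists r => [|x /h/cr//]; apply: leq_trans hab. Qed.
Lemma cov_or (T : eqType) (P Q R : T -> Prop) a b : cov P a -> cov Q b ->
  (forall x, R x -> P x \/ Q x) -> cov R (a + b).
Proof.
move=> [r hr cr] [s hs cs] h; exists (r ++ s); first by rewrite size_cat leq_add.
by move=> x /h[/cr|/cs]; rewrite mem_cat => ->; rewrite ?orbT.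
Qed.
Lemma cov_fin (T : finType) (U : eqType) (f : T -> U) (R : U -> Prop) :
  (forall y, R y -> exists x, y = f x) -> cov R #|T|.
Proof.
by move=> h; exists (codom f) => [|y /h[x ->]]; rewrite ?size_codom // codom_f.
Qed.
Lemma cov_dep (T U : eqType) (P : T -> Prop) (Q : T -> U -> Prop) (R : U -> Prop) a b : cov P a ->
  (forall x, P x -> cov (Q x) b) -> (forall z, R z -> exists x, P x /\ Q x z) -> cov R (a * b).
Proof.
move=> [r hr cr] hQ hR.
have [s hs cs] : exists2 s : seq U, size s <= size r * b & forall x z, x \in r -> P x -> Q x z -> z \in s.
  elim: {hr cr} r => [|x r [s hs cs]]; first by exists [::].
  have [px|np] := classic (P x); last first.
    exists s => [|y z]; first by apply: leq_trans hs _; rewrite /= mulSn leq_addl.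
    by rewrite inE => /orP[/eqP->//|]; apply: cs.
  have [s' hs' cs'] := hQ x px; exists (s' ++ s).
    by rewrite size_cat mulSn leq_add.
  move=> y z; rewrite inE mem_cat => /orP[/eqP->|yr] py qz; first by rewrite cs'.
  by rewrite (cs y z) // orbT.
exists s => [|z /hR[x [px qz]]]; first by apply: leq_trans hs _; rewrite leq_mul2r hr orbT.
exact: cs (cr x px) px qz.
Qed.

Section Sub.
Variables (I : finType) (X : {set I}).
Notation sub := {i : I | i \in X}.
Definition ext (T : Type) (d : T) (f : {ffun sub -> T}) (i : I) : T := if insub i is Some j then f j else d.
Definition res (T : Type) (f : I -> T) : {ffun sub -> T} := [ffun j => f (val j)].
Lemma ext_res (T : Type) (d : T) f i : i \in X -> ext d (res f) i = f i.
Proof. by move=> iX; rewrite /ext insubT ffunE. Qed.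
Lemma ext_off (T : Type) (d : T) f i : i \notin X -> ext d f i = d.
Proof. by move=> iX; rewrite /ext insubN. Qed.
Lemma ext_val (T : Type) (d : T) f (j : sub) : ext d f (val j) = f j.
Proof. by rewrite /ext valK. Qed.
Lemma card_sub : #|{: sub}| = #|X|. Proof. by rewrite card_sig; apply: eq_card. Qed.
Definition resb (be : {ffun I -> bool} -> bool) : {ffun {ffun sub -> bool} -> bool} :=
  [ffun m => be [ffun i => ext false m i]].
Lemma resbE be (l : {ffun I -> bool}) : (forall l l' : {ffun I -> bool}, {in X, l =1 l'} -> be l = be l') -> resb be (res l) = be l.
Proof. by move=> h; rewrite ffunE; apply: h => i iX; rewrite ffunE ext_res. Qed.
End Sub.

Lemma kval_eq (I : finType) P P' Q (F : {set I}) s be be' x : {in F, P =1 P'} ->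
  be (bits P x) = be' (bits P' x) -> kval P Q F s be x = kval P' Q F s be' x.
Proof.
move=> hP hb; rewrite /kval hb; congr dec; congr addb; apply: eq_sumb => i iF; by rewrite hP.
Qed.

Lemma card_ob : #|{: option bool}| = 3. Proof. by rewrite card_option card_bool. Qed.

Notation code I := {ffun {ffun I -> V} -> bool}.
Definition c0 (I : finType) : {ffun I -> V} := [ffun=> zr].
Definition L k := 3 ^ k * 2 ^ (2 ^ k + 1).
Definition rooted (I : finType) (M : code I) x1 Q := exists P, valid M setT (c0 I) P /\ P x1 = Q.
Definition nonsemi (I : finType) (M : code I) := mds M /\ ~ semi M setT (c0 I).
Definition unrooted (I : finType) (x1 : I) Q (M : code I) := mds M /\ ~ rooted M x1 Q.
Definition NB k b := forall I : finType, #|I| = k.+1 -> cov (@nonsemi I) b.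
Definition WB k b := forall (I : finType) (x1 : I) Q, #|I| = k.+1 -> cov (unrooted x1 Q) b.

Lemma agreeT (I : finType) (x y : {ffun I -> V}) : agree setT x y. Proof. by move=> i; rewrite inE. Qed.

Lemma code_cmp (I : finType) (M : code I) x1 (x : {ffun I -> V}) : mds M -> M x = (x x1 == cmp M x1 x).
Proof.
move=> hM; apply/idP/eqP => [Mx|e]; first by rewrite (cmp_M hM).
by rewrite -(upd_eq x x1) e; apply: cmpP.
Qed.

Lemma semi_rooted (I : finType) (M : code I) x1 : semi M setT (c0 I) -> exists Q, rooted M x1 Q.
Proof. by move=> [P [s h]]; exists (P x1), P; split=> //; exists s. Qed.

Definition kcode (I : finType) x1 P Q s ga : code I :=
  [ffun x : {ffun I -> V} => x x1 == kval P Q (setT :\ x1) s ga x].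

Lemma rooted_kcode (I : finType) (M : code I) x1 Q : 1 < #|I| -> mds M -> rooted M x1 Q ->
  exists P s (ga : {ffun I -> bool} -> bool), [/\ forall l l' : {ffun I -> bool}, {in setT :\ x1, l =1 l'} -> ga l = ga l', P x1 = Q, M = kcode x1 P Q s ga &
   (forall u v l, u \in setT :\ x1 -> v \in setT :\ x1 -> u != v -> dd ga u v l = false) -> forall Q', rooted M x1 Q'].
Proof.
move=> hI hM [P [vP eQ]]; have x1T : x1 \in [set: I] by rewrite inE.
have [|s [ga [dep hk]]] := valid_kval hM x1T _ vP; first by rewrite cardsT.
exists P, s, ga; split=> //.
  by apply/ffunP => x; rewrite ffunE (code_cmp x1) // hk ?eQ //; apply: agreeT.
move=> h Q'; have [R hR] := valid_free hM Q' x1T hk (fun u v l uF vF uv _ => h u v l uF vF uv) vP dep.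
by exists R.
Qed.

Lemma card_setT1 (I : finType) (x1 : I) k : #|I| = k.+1 -> #|[set: I] :\ x1| = k.
Proof. by move=> h; have := cardsD1 x1 [set: I]; rewrite cardsT h inE add1n => -[]. Qed.

Lemma cov_rooted (I : finType) x1 Q k : 0 < k -> #|I| = k.+1 ->
  cov (fun M : code I => mds M /\ rooted M x1 Q) (L k).
Proof.
move=> k0 hI; pose E := [set: I] :\ x1; pose s := {i : I | i \in E}.
pose T := ({ffun s -> option bool} * bool * {ffun {ffun s -> bool} -> bool})%type.
have cT : #|{: T}| = L k.
  rewrite !card_prod !card_ffun card_ob !card_bool card_sub (card_setT1 x1 hI) /L.
  by rewrite expnD expn1 -mulnA [2 * _]mulnC.
rewrite -cT; apply: (@cov_fin _ _ (fun t : T => kcode x1 (ext Q t.1.1) Q t.1.2 (fun l => t.2 (res E l)))).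
move=> M [hM hr]; have [|P [s0 [ga [dep eQ -> _]]]] := rooted_kcode _ hM hr; first by rewrite hI.
exists (res E P, s0, resb E ga); apply/ffunP => x; rewrite !ffunE /=; congr (_ == _).
apply: kval_eq => [i iE|]; first by rewrite ext_res.
rewrite -(resbE _ dep); congr (resb _ _ _); apply/ffunP => j; rewrite !ffunE.
by rewrite ext_res // (valP j).
Qed.

Lemma parts_other (Q : option bool) : exists Q1 Q2, forall Q' : option bool, Q' != Q -> Q' = Q1 \/ Q' = Q2.
Proof.
case: Q => [[]|]; [exists None, (Some false) | exists None, (Some true) | exists (Some true), (Some false)];
  by case=> [[]|] //; auto.
Qed.

Lemma WB_NB k b : 0 < k -> NB k b -> WB k (2 * L k + b).
Proof.
move=> k0 hN I x1 Q hI; have [Q1 [Q2 hQ]] := parts_other Q; rewrite mul2n -addnn.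
apply: (cov_or (cov_or (cov_rooted x1 Q1 k0 hI) (cov_rooted x1 Q2 k0 hI) (fun x h => h)) (hN I hI)).
move=> M [hM nr]; have [h|h] := classic (semi M setT (c0 I)); last by right.
left; have [Q' hr] := semi_rooted x1 h.
have [|e|e] := hQ Q'; first by apply/eqP => e; apply: nr; rewrite -e.
  by left; rewrite -e.
by right; rewrite -e.
Qed.

(** Half of what [WB_NB] would give. A code with another root partition but not with [Q] has a
    nonzero mixed difference, so its function of two bits contains their product and only the three
    affine coefficients are free: 9 * 2 * 8 = 144 for each of the two other partitions. *)
Lemma WB2 : WB 2 288.
Proof.
move=> I x1 Q hI; have hI1 : 1 < #|I| by rewrite hI.
have /cards2P[u [v [uv eE]]] : #|[set: I] :\ x1| == 2 by rewrite (card_setT1 x1 hI).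
have vu : v != u by rewrite eq_sym.
pose par Q' (P : option bool * option bool) := fun i => if i == x1 then Q' else if i == u then P.1 else P.2.
pose gam (t : bool * bool * bool) := fun l : {ffun I -> bool} => (l u && l v) (+) (t.1.1 && l u) (+) (t.1.2 && l v) (+) t.2.
pose T := ((option bool * option bool) * bool * (bool * bool * bool))%type.
have cT : #|{: T}| = 144 by rewrite !card_prod card_ob !card_bool.
have uE : u \in [set: I] :\ x1 by rewrite eE !inE eqxx.
have vE : v \in [set: I] :\ x1 by rewrite eE !inE eqxx orbT.
have /andP[ux _] : (u != x1) && (u \in [set: I]) by rewrite -in_setD1.
have /andP[vx1 _] : (v != x1) && (v \in [set: I]) by rewrite -in_setD1.
have C Q' : cov (fun M : code I => unrooted x1 Q M /\ rooted M x1 Q') 144.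
  rewrite -cT; apply: (@cov_fin _ _ (fun t : T => kcode x1 (par Q' t.1.1) Q' t.1.2 (gam t.2))).
  move=> M [[hM nr] hr]; have [P [s [ga [dep eQ eM hfree]]]] := rooted_kcode hI1 hM hr.
  pose pb a b : {ffun I -> bool} := [ffun i => if i == u then a else if i == v then b else false].
  have Eg l : ga l = ga (pb (l u) (l v)).
    by apply: dep => i; rewrite eE !inE !ffunE => /orP[/eqP->|/eqP->]; rewrite eqxx // (negbTE vu).
  pose A := ga (pb false false); pose B := ga (pb true false); pose D := ga (pb false true).
  have nz : ga (pb true true) = ~~ (A (+) B (+) D).
    apply/eqP/negPn/negP => ne; apply: nr; apply: hfree => i j l iE jE ij.
    have hd : dd ga u v l = false.
      have fu m : pb (flipb m u u) (flipb m u v) = pb (~~ m u) (m v) by rewrite !ffunE eqxx (negbTE vu).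
      have fv m : pb (flipb m v u) (flipb m v v) = pb (m u) (~~ m v) by rewrite !ffunE eqxx (negbTE uv).
      rewrite /dd Eg (Eg (flipb l u)) (Eg (flipb l v)) (Eg (flipb (flipb l u) v)) fu !fv.
      have -> : flipb l u u = ~~ l u by rewrite ffunE eqxx.
      have -> : flipb l u v = l v by rewrite ffunE (negbTE vu).
      move: ne; rewrite /A /B /D; case: (l u); case: (l v) => /=;
      move: (ga _) (ga _) (ga _) (ga _); by do 4!case.
    move: iE jE; rewrite eE !inE => /orP[/eqP ei|/eqP ei] /orP[/eqP ej|/eqP ej]; rewrite ei ej ?eqxx // in ij *.
    by rewrite ddC.
  exists ((P u, P v), s, (A (+) B, A (+) D, A)); rewrite eM; apply/ffunP => x; rewrite !ffunE; congr (_ == _).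
  apply: kval_eq => [i iE|].
    move: iE; rewrite eE /par !inE => /orP[/eqP->|/eqP->]; rewrite ?(negbTE ux) ?(negbTE vx1) ?eqxx ?(negbTE vu) //.
  rewrite Eg /gam !ffunE /par ?(negbTE ux) ?(negbTE vx1) ?eqxx ?(negbTE vu) /=.
  rewrite -/A; case: (lf _ _); case: (lf _ _) => /=; rewrite ?nz -/A -/B -/D; clear;
    move: A B D; by do 3!case.
have [Q1 [Q2 hQ]] := parts_other Q.
apply: (cov_sub _ (leqnn _) (cov_or (C Q1) (C Q2) (fun x h => h))).
move=> M hm; have hM := hm.1; have [Q' hr] : exists Q', rooted M x1 Q'.
  by apply: semi_rooted; apply: semi3; rewrite ?cardsT.
have [|e|e] := hQ Q'; first by apply/eqP => e; apply: hm.2; rewrite -e.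
  by left; rewrite -e.
by right; rewrite -e.
Qed.

Lemma cov_map (T U : eqType) (f : T -> U) (P : T -> Prop) b : cov P b -> cov (fun y => exists x, P x /\ y = f x) b.
Proof.
move=> [r hr cr]; exists (map f r) => [|y [x [px ->]]]; first by rewrite size_map.
exact/map_f/cr.
Qed.

Lemma lf_zr Q : lf Q zr = false. Proof. by case: Q => [[]|]. Qed.
Lemma mf_zr Q : mf Q zr = false. Proof. by case: Q => [[]|]. Qed.

Section LeafData.
Variable I : finType.
Notation pt := {ffun I -> V}.
Notation bt := {ffun I -> bool}.
Implicit Types (x y : pt) (l : bt).

Definition bit (x1 : I) (t : bool) : bt := [ffun j => (j == x1) && t].

(* A leaf normalised so that its root takes the value of the coordinate [x1] when the other
   coordinates of the leaf vanish. *)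
Definition hdata (X : {set I}) (x1 : I) (d : {ffun pt -> V} * option bool) :=
  exists P (be : bt -> bool), [/\ forall l l' : bt, {in X, l =1 l'} -> be l = be l', conn be X (bit x1 false),
    forall t, be (bit x1 t) = false, d.2 = P x1 & forall x, d.1 x = kval P (P x1) X false be x].

Lemma sumb_c0 (F : {set I}) (g : I -> V -> bool) : (forall i, g i zr = false) -> sumb F (fun i => g i (c0 I i)) = false.
Proof. by move=> h; rewrite /sumb big1 // => i _; rewrite ffunE h. Qed.

Variables (M : code I) (X : {set I}) (P : I -> option bool) (be : bt -> bool) (U : pt -> V) (x1 : I).
Hypotheses (hM : mds M) (LX : leaf M setT (c0 I) X P be U) (x1X : x1 \in X).

Lemma leaf_hdata : exists d, [/\ hdata X x1 d, d.2 = P x1 & forall x, zeta (c0 I) P be x1X x x1 = d.1 x /\ lf (P x1) (d.1 x) = sumb X (fun i => lf (P i) (x i))].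
Proof.
(* The correction sees [l] only through its sum over [X], so mixed differences are unchanged; it
   makes [be'] vanish on the bits supported at [x1]. *)
pose be' l := be l (+) be (bit x1 (sumb X l)).
have sX (x : pt) : sumb X (bits P x) = sumb X (fun i => lf (P i) (x i)) by apply: eq_sumb => i _; rewrite ffunE.
have sbit t : sumb X (bit x1 t) = t.
  rewrite (sumbD1 _ x1X) ffunE eqxx /= -[RHS]addbF; congr addb.
  by rewrite /sumb big1 // => i; rewrite !inE ffunE => /andP[/negbTE->].
have bc0 : bits P (c0 I) = bit x1 false by apply/ffunP => i; rewrite !ffunE lf_zr andbF.
pose h : {ffun pt -> V} := [ffun x => kval P (P x1) X false be' x].
have hE x : h x = kval P (P x1) X false be' x by rewrite ffunE.
exists (h, P x1); split=> //.
  exists P, be'; split=> //.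
  - move=> l l' e; rewrite /be' (leaf_dep LX e); congr (_ (+) be (bit _ _)); exact: eq_sumb.
  - move=> W sW W0 WX; have := leaf_conn LX; rewrite bc0 => /(_ W sW W0 WX) [i [j [l [iW jW al dl]]]].
    exists i, j, l; split=> //; have iX := subsetP sW _ iW; have jX : j \in X by move: jW; rewrite inE => /andP[].
    move: dl; rewrite /dd /be' !sumb_flip // negbK.
    move: (be l) (be (flipb l i)) (be (flipb l j)) (be (flipb (flipb l i) j)) (be (bit _ (sumb X l))) (be (bit _ (~~ sumb X l))).
    by do 6!case.
  - by move=> t; rewrite /be' sbit addbb.
move=> x; have -> : (h, P x1).1 = h by [].
rewrite hE; split; last by rewrite lf_kval addbF.
apply: (@pin_inj I X (c0 I) P be x1 x1X); rewrite zeta_x1.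
set a := kval _ _ _ _ _ _.
have Ky y : kv P X be y = (sumb X (fun i => lf (P i) (y i)), sumb X (fun i => mf (P i) (y i)) (+) be (bits P y)).
  by rewrite /kv /kval addbF.
rewrite /pin !Ky (sumb_upd (fun i => lf (P i))) // (sumb_upd (fun i => mf (P i))) //.
have -> : sumb (X :\ x1) (fun i => lf (P i) (c0 I i)) = false.
  by apply: (@sumb_c0 _ (fun i => lf (P i))) => i; apply: lf_zr.
have -> : sumb (X :\ x1) (fun i => mf (P i) (c0 I i)) = false.
  by apply: (@sumb_c0 _ (fun i => mf (P i))) => i; apply: mf_zr.
rewrite !addbF; have ea : lf (P x1) a = sumb X (fun i => lf (P i) (x i)) by rewrite lf_kval addbF.
have -> : bits P (upd (c0 I) x1 a) = bit x1 (lf (P x1) a).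
  by apply/ffunP => i; rewrite !ffunE; case: eqP => [->|_]; rewrite ?ffunE ?lf_zr.
rewrite ea; congr pair; rewrite mf_kval /be' sX -!addbA addbb addbF //.
Qed.

Local Notation S1 := (x1 |: ([set: I] :\: X)).
Definition emb (y : {ffun {i : I | i \in S1} -> V}) : pt := [ffun i => ext zr y i].
Definition rest : code {i : I | i \in S1} := [ffun y => M (emb y)].

Lemma emb_upd (y : {ffun {i : I | i \in S1} -> V}) j a : emb (upd y j a) = upd (emb y) (val j) a.
Proof.
apply/ffunP => i; rewrite updE !ffunE /ext; have [->|ne] := eqVneq i (val j).
  by rewrite valK ffunE eqxx.
by case: insubP => // k kS ek; rewrite ffunE -(inj_eq val_inj) ek (negbTE ne).
Qed.

Lemma rest_mds : mds rest.
Proof.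
split=> [y j|y j a b]; last by rewrite !ffunE !emb_upd; apply: hM.2.
by have [a ha] := hM.1 (emb y) (val j); exists a; rewrite ffunE emb_upd.
Qed.

Lemma rest_zeta x : M x = rest [ffun j => upd x x1 (zeta (c0 I) P be x1X x x1) (val j)].
Proof.
have restE (y : {ffun {i : I | i \in S1} -> V}) : rest y = M (emb y) by rewrite ffunE.
rewrite restE -(zeta_M LX x1X (@agreeT _ _ x)); congr (M _); apply/ffunP => i; rewrite [RHS]ffunE.
have [iS|iS] := boolP (i \in S1); last first.
  rewrite ext_off //; have := zeta_face P be x1X (@agreeT _ (c0 I) x) iS; by rewrite [c0 I i]ffunE.
rewrite /ext insubT [RHS]ffunE [RHS]updE /=; case: eqP => [->//|/eqP ix]; apply: zeta_off => //.
by move: iS; rewrite !inE (negbTE ix) /= andbT.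
Qed.

Lemma S1x : x1 \in S1. Proof. by rewrite !inE eqxx. Qed.

Lemma sumb_sub (F : {set I}) (g : I -> bool) : sumb [set: {i : I | i \in F}] (fun j => g (val j)) = sumb F g.
Proof.
rewrite /sumb [RHS]big_sub; apply: eq_bigl => j; by rewrite inE.
Qed.

(** The bit [lf (P x1)] of the root value is the sum of the bits over the leaf, so a semilinear
    relation of the smaller code with [P x1] at the root would extend to the whole code. *)
Lemma rest_unrooted : ~ semi M setT (c0 I) -> unrooted (Sub x1 S1x) (P x1) rest.
Proof.
move=> ns; split; first exact: rest_mds.
move=> [R [[r hr] eR]]; apply: ns.
have [d [_ ed hd]] := leaf_hdata.
pose R' i := ext None [ffun j => R j] i.
exists (fun i => if i \in X then P i else R' i), r => x _ Mx; move: Mx; rewrite rest_zeta => /(hr _ (@agreeT _ _ _)).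
set y := upd x x1 _ => e.
have {}e : sumb S1 (fun i => lf (R' i) (y i)) = r.
  by rewrite -e -sumb_sub; apply: eq_sumb => j _; congr (lf _ _); [rewrite /R' ext_val ffunE | rewrite [RHS]ffunE].
have R1 : R' x1 = P x1 by have := ext_val None [ffun j => R j] (Sub x1 S1x); rewrite [RHS]ffunE eR.
move: e; rewrite (sumbD1 _ S1x) R1 /y updE eqxx.
have [-> ->] := hd x.
have -> : S1 :\ x1 = setT :\: X by rewrite setU1K // !inE x1X.
move=> <-; rewrite /sumb (big_setID X) /= setTI; congr addb; first by apply: eq_bigr => i ->.
apply: eq_bigr => i; rewrite !inE andbT => iX; rewrite (negbTE iX) updE; case: eqP => // e.
by rewrite e x1X in iX.
Qed.
End LeafData.

Definition has_leaf (I : finType) (X : {set I}) (M : code I) :=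
  nonsemi M /\ exists P be U, leaf M setT (c0 I) X P be U.

Lemma cov_leaf (I : finType) (X : {set I}) (x1 : I) a b k : x1 \in X -> #|I| = (k + #|X|)%N ->
  cov (hdata X x1) a -> WB k b -> cov (has_leaf X) (a * b).
Proof.
move=> x1X hI hd hW; pose S1 := x1 |: ([set: I] :\: X).
have cJ : #|{: {i : I | i \in S1}}| = k.+1.
  rewrite card_sub cardsU1 !inE x1X /=; congr _.+1; have := cardsID X [set: I]; rewrite setTI cardsT hI addnC.
  by move/addIn.
pose Phi (d : {ffun {ffun I -> V} -> V} * option bool) (M1 : code {i : I | i \in S1}) : code I :=
  [ffun x => M1 [ffun j => upd x x1 (d.1 x) (val j)]].
apply: (cov_dep hd (b := b) (Q := fun d M => exists M1, unrooted (Sub x1 (S1x X x1)) d.2 M1 /\ M = Phi d M1)).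
  by move=> d _; apply: cov_map; apply: hW.
move=> M [[hM ns] [P [be [U LX]]]]; have [d [h1 h2 h3]] := leaf_hdata LX x1X.
exists d; split=> //; exists (rest M X x1); split; first by rewrite h2; exact: (rest_unrooted hM LX x1X ns).
by apply/ffunP => x; rewrite (rest_zeta LX x1X) [RHS]ffunE; have [-> _] := h3 x.
Qed.

(** 18 = 3^2 * 2: two of the four values of [be] vanish by the normalisation, and the nonzero mixed
    difference ties the remaining two together. *)
Lemma cov_h2 (I : finType) (X : {set I}) (x1 : I) : x1 \in X -> #|X| = 2 -> cov (hdata X x1) 18.
Proof.
move=> x1X c2; have /cards1P[u eu] : #|X :\ x1| == 1 by have /eqP := cardsD1 x1 X; rewrite x1X c2 eqSS eq_sym.
have /andP[ux uX] : (u != x1) && (u \in X) by rewrite -in_setD1 eu set11.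
pose T := (option bool * option bool * bool)%type.
have cT : #|{: T}| = 18 by rewrite !card_prod card_ob card_bool.
rewrite -cT; pose par (t : T) i := if i == x1 then t.1.1 else t.1.2.
pose bt' (t : T) (l : {ffun I -> bool}) := l u && (l x1 (+) t.2).
apply: (@cov_fin _ _ (fun t : T => ([ffun x => kval (par t) t.1.1 X false (bt' t) x], t.1.1))).
move=> [h Q] [P [be [dep cn b0 /= -> hk]]].
pose pb a b : {ffun I -> bool} := [ffun i => if i == x1 then a else if i == u then b else false].
have XE i : i \in X -> i = x1 \/ i = u.
  move=> iX; have [->|ix] := eqVneq i x1; [by left|right].
  have : i \in X :\ x1 by rewrite !inE ix.
  by rewrite eu inE => /eqP.
have Eg l : be l = be (pb (l x1) (l u)).
  by apply: dep => i /XE[]->; rewrite !ffunE eqxx // (negbTE ux).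
have z0 : be (pb false false) = false.
  by rewrite -(b0 false); apply: dep => i /XE[]->; rewrite !ffunE eqxx ?(negbTE ux).
have z1 : be (pb true false) = false.
  by rewrite -(b0 true); apply: dep => i /XE[]->; rewrite !ffunE eqxx ?(negbTE ux).
have nz : be (pb true true) = ~~ be (pb false true).
  have X2 : 1 < #|X| by rewrite c2.
  have [j [l [jX jx _]]] := conn_nonempty_edge x1X X2 cn.
  have -> : j = u by have [e|//] := XE j jX; rewrite e eqxx in jx.
  have fu m : pb (flipb m x1 x1) (flipb m x1 u) = pb (~~ m x1) (m u) by rewrite !ffunE eqxx (negbTE ux).
  have fv m : pb (flipb m u x1) (flipb m u u) = pb (m x1) (~~ m u) by rewrite !ffunE eqxx eq_sym (negbTE ux).
  rewrite /dd Eg (Eg (flipb l x1)) (Eg (flipb l u)) (Eg (flipb (flipb l x1) u)) fu !fv.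
  have -> : flipb l x1 x1 = ~~ l x1 by rewrite ffunE eqxx.
  have -> : flipb l x1 u = l u by rewrite ffunE (negbTE ux).
  by case: (l x1); case: (l u) => /=; rewrite z0 z1; case: (be _); case: (be _).
exists (P x1, P u, be (pb false true)); congr pair; apply/ffunP => x; rewrite hk ffunE.
apply: kval_eq => [i /XE[]->|]; rewrite /par /= ?eqxx ?(negbTE ux) //.
rewrite Eg /bt' !ffunE eqxx (negbTE ux) /=.
by case: (lf _ _); case: (lf _ _).
Qed.

(** The 2 subtracted in the exponent stands for the two values of [be] fixed by the
    normalisation. *)
Lemma cov_hm (I : finType) (X : {set I}) (x1 : I) m : x1 \in X -> #|X| = m ->
  cov (hdata X x1) (3 ^ m * 2 ^ (2 ^ m - 2)).
Proof.
move=> x1X cm; pose s := {i : I | i \in X}.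
pose A : {set {ffun s -> bool}} := ~: [set res X (bit x1 false); res X (bit x1 true)].
pose T := ({ffun s -> option bool} * {ffun {l : {ffun s -> bool} | l \in A} -> bool})%type.
have cA : #|A| = 2 ^ m - 2.
  have := cardsC [set res X (bit x1 false); res X (bit x1 true)].
  rewrite -/A cards2 card_ffun card_bool card_sub cm.
  have -> : res X (bit x1 false) != res X (bit x1 true).
    apply/eqP => /ffunP/(_ (Sub x1 x1X)); by rewrite !ffunE /= eqxx.
  by move <-; rewrite addKn.
have cT : #|{: T}| = 3 ^ m * 2 ^ (2 ^ m - 2).
  by rewrite card_prod !card_ffun card_ob card_bool !card_sub cm cA.
rewrite -cT; apply: (@cov_fin _ _ (fun t : T => ([ffun x => kval (ext None t.1) (ext None t.1 x1) X false
   (fun l => ext false t.2 (res X l)) x], ext None t.1 x1))).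
move=> [h Q] [P [be [dep cn b0 /= -> hk]]].
exists (res X P, res A (resb X be)); rewrite /= ext_res //; congr pair; apply/ffunP => x; rewrite hk ffunE.
apply: kval_eq => [i iX|]; first by rewrite ext_res.
have -> : res X (bits (ext None (res X P)) x) = res X (bits P x).
  by apply/ffunP => j; rewrite !ffunE ext_res // (valP j).
have [lA|lA] := boolP (res X (bits P x) \in A); first by rewrite ext_res // resbE.
rewrite ext_off // -(resbE _ dep).
move: lA; rewrite !inE negbK => /orP[]/eqP->; rewrite resbE //.
Qed.

Lemma cov_set (T : finType) (A : {set T}) : cov (fun x : T => x \in A) #|A|.
Proof. by exists (enum A) => [|x]; rewrite ?mem_enum // cardE. Qed.

Lemma nonsemi_leaves (I : finType) (M : code I) : 3 < #|I| -> nonsemi M ->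
  exists X Y : {set I}, [/\ 1 < #|X|, 1 < #|Y|, [disjoint X & Y], has_leaf X M & has_leaf Y M].
Proof.
move=> h3 hm; have [hM ns] := hm; have [|//|] := @semi_or_two_leaves I M hM setT (c0 I); first by rewrite cardsT.
move=> [X [PX [bX [UX [Y [PY [bY [UY [z [LX LY dXY _ _]]]]]]]]]].
exists X, Y; split=> //; [exact: leaf_card LX | exact: leaf_card LY | |].
  by split=> //; exists PX, bX, UX.
by split=> //; exists PY, bY, UY.
Qed.

Lemma disj_card (I : finType) (X Y : {set I}) : [disjoint X & Y] -> #|X| + #|Y| <= #|I|.
Proof.
rewrite -setI_eq0 => /eqP e; have := cardsUI X Y; rewrite e cards0 addn0 => <-; exact: max_card.
Qed.

Lemma NB2 : NB 2 0.
Proof. by move=> I hI; exists [::] => // M [hM []]; apply: semi3; rewrite ?cardsT. Qed.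

Lemma cov_pair (I : finType) (X : {set I}) k b : #|X| = 2 -> #|I| = k.+2 -> WB k b -> cov (has_leaf X) (18 * b).
Proof.
move=> cX hI hW; have /card_gt0P[x1 x1X] : 0 < #|X| by rewrite cX.
by apply: (cov_leaf x1X _ (cov_h2 x1X cX) hW); rewrite cX addn2.
Qed.

Lemma cov_block (I : finType) (X : {set I}) k b : 0 < #|X| -> #|I| = (k + #|X|)%N -> WB k b ->
  cov (has_leaf X) (3 ^ #|X| * 2 ^ (2 ^ #|X| - 2) * b).
Proof. by move=> /card_gt0P[x1 x1X] hI hW; apply: (cov_leaf x1X hI (cov_hm x1X (erefl _)) hW). Qed.

(** Both leaves are pairs and fill the four coordinates, so one of them contains [i0]; only its
    second element has to be chosen. *)
Lemma NB3 : NB 3 (3 * (18 * 288)).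
Proof.
move=> I hI; have /card_gt0P[i0 _] : 0 < #|I| by rewrite hI.
have c3 := card_setT1 i0 hI; rewrite -{1}c3.
apply: (cov_dep (cov_set _) (Q := fun j => has_leaf [set i0; j])).
  by move=> j; rewrite !inE andbT => ji; apply: (cov_pair _ hI WB2); rewrite cards2 eq_sym ji.
move=> M hM; have [|X [Y [X2 Y2 dXY LX LY]]] := nonsemi_leaves _ hM; first by rewrite hI.
have := disj_card dXY; rewrite hI => c4.
have fin (Z : {set I}) : #|Z| = 2 -> i0 \in Z -> has_leaf Z M -> exists x, x \in [set: I] :\ i0 /\ has_leaf [set i0; x] M.
  move=> cZ iZ hZ; have /cards1P[j ej] : #|Z :\ i0| == 1 by have := cardsD1 i0 Z; rewrite iZ cZ => /eqP; rewrite eqSS eq_sym.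
  exists j; split; last by rewrite -ej setD1K.
  have : j \in Z :\ i0 by rewrite ej set11.
  by rewrite !inE andbT => /andP[].
have cX : #|X| = 2 by lia. have cY : #|Y| = 2 by lia.
have [iX|iX] := boolP (i0 \in X); first exact: fin iX LX.
have [iY|iY] := boolP (i0 \in Y); first exact: fin iY LY.
have := subset_leq_card (subsetT (i0 |: (X :|: Y))).
rewrite cardsU1 !inE negb_or iX iY /= cardsT hI.
by have := cardsUI X Y; move: dXY; rewrite -setI_eq0 => /eqP->; rewrite cards0 addn0 cX cY => ->.
Qed.

(** Of two disjoint leaves in five coordinates at least one is a pair, which leaves 10 choices. *)
Lemma NB4 b : WB 3 b -> NB 4 (10 * (18 * b)).
Proof.
move=> hW I hI; pose A := [set X : {set I} | #|X| == 2].
have cA : #|A| = 10 by rewrite card_draws hI.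
rewrite -{1}cA; apply: (cov_dep (cov_set _) (Q := fun X => has_leaf X)).
  by move=> X; rewrite inE => /eqP cX; exact: (@cov_pair I X _ _ cX hI hW).
move=> M hM; have [|X [Y [X2 Y2 dXY LX LY]]] := nonsemi_leaves _ hM; first by rewrite hI.
have := disj_card dXY; rewrite hI => c5.
have [e|ne] := eqVneq #|X| 2; first by exists X; rewrite inE e.
by exists Y; split=> //; rewrite inE; apply/eqP; lia.
Qed.

(** Either one leaf is among the 15 pairs, or both are triples and one of them is among the 10 that
    contain [i0]; 1728 = 3^3 * 2^(2^3 - 2). *)
Lemma NB5 b b' : WB 4 b -> WB 3 b' -> NB 5 (15 * (18 * b) + 10 * (1728 * b')).
Proof.
move=> hW hW' I hI; have /card_gt0P[i0 _] : 0 < #|I| by rewrite hI.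
pose A := [set X : {set I} | #|X| == 2].
have cA : #|A| = 15 by rewrite card_draws hI.
pose B := [set Z : {set I} | Z \subset [set: I] :\ i0 & #|Z| == 2].
have cB : #|B| = 10 by rewrite cards_draws (card_setT1 i0 hI).
have cZ (Z : {set I}) : Z \in B -> i0 \notin Z /\ #|i0 |: Z| = 3.
  rewrite inE => /andP[/subsetP sZ /eqP e]; have iZ : i0 \notin Z by apply/negP => /sZ; rewrite !inE eqxx.
  by rewrite cardsU1 iZ e.
have h1 : cov (fun M : code I => exists X, X \in A /\ has_leaf X M) (15 * (18 * b)).
  rewrite -{1}cA; apply: (cov_dep (cov_set _) (Q := fun X => has_leaf X)) => [X|M //].
  by rewrite inE => /eqP cX; exact: (@cov_pair I X _ _ cX hI hW).
have h2 : cov (fun M : code I => exists Z, Z \in B /\ has_leaf (i0 |: Z) M) (10 * (1728 * b')).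
  rewrite -{1}cB; apply: (cov_dep (cov_set _) (Q := fun Z => has_leaf (i0 |: Z))) => [Z|M //].
  move=> /cZ[_ e]; have hI' : #|I| = (3 + #|i0 |: Z|)%N by rewrite e hI.
  have := cov_block _ hI' hW'; rewrite e (_ : 3 ^ 3 * 2 ^ (2 ^ 3 - 2) = 1728) //; exact.
apply: (cov_or h1 h2) => M hM.
have [|X [Y [X2 Y2 dXY LX LY]]] := nonsemi_leaves _ hM; first by rewrite hI.
have := disj_card dXY; rewrite hI => c6.
have [e|n1] := eqVneq #|X| 2; first by left; exists X; rewrite inE e.
have [e|n2] := eqVneq #|Y| 2; first by left; exists Y; rewrite inE e.
have cX : #|X| = 3 by lia. have cY : #|Y| = 3 by lia.
have fin (Z : {set I}) : #|Z| = 3 -> i0 \in Z -> has_leaf Z M -> exists Z, Z \in B /\ has_leaf (i0 |: Z) M.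
  move=> c3 iZ hZ; exists (Z :\ i0); rewrite setD1K //; split=> //.
  by rewrite inE setSD ?subsetT //=; have := cardsD1 i0 Z; rewrite iZ c3 => /eqP; rewrite eqSS eq_sym.
right; have [iX|iX] := boolP (i0 \in X); first exact: fin iX LX.
have [iY|iY] := boolP (i0 \in Y); first exact: fin iY LY.
have := subset_leq_card (subsetT (i0 |: (X :|: Y))).
rewrite cardsU1 !inE negb_or iX iY /= cardsT hI.
by have := cardsUI X Y; move: dXY; rewrite -setI_eq0 => /eqP->; rewrite cards0 addn0 cX cY => ->.
Qed.

(** With a = 2^(m - 2) and b = 2^(k - 2) the claim is that the product of a - 1 and b - 1 is not
    negative. *)
Lemma pow_sum m k : 2 <= m -> 2 <= k -> 2 ^ m + 2 ^ k <= 4 + 2 ^ (m + k - 2).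
Proof.
move=> hm hk; have -> : m = (m - 2) + 2 by lia. have -> : k = (k - 2) + 2 by lia.
have -> : m - 2 + 2 + (k - 2 + 2) - 2 = (m - 2) + (k - 2) + 2 by lia.
rewrite !expnD; have : 0 < 2 ^ (m - 2) by rewrite expn_gt0. have : 0 < 2 ^ (k - 2) by rewrite expn_gt0.
move: (2 ^ (m - 2)) (2 ^ (k - 2)) => a b; nia.
Qed.

(** The factor 2^(n+1) bounds the choices of the leaf. For a leaf of m coordinates and k = n + 1 -
    m, the exponents 2^m and 2^k add up to at most 4 + 2^(n-1), about half of the 2^n allowed, which
    pays for everything else; the 9 goes into 3^(n+3). *)
Lemma NBn n : 1 < n -> (forall k, 1 < k < n -> WB k (9 * L k)) ->
  NB n (2 ^ n.+1 * (3 ^ (n + 3) * 2 ^ (2 ^ n.-1 + 3))).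
Proof.
move=> n1 hW I hI; have h3 := n1; pose A := [set X : {set I} | 1 < #|X| < n].
have cov_A : cov (fun X : {set I} => X \in A) (2 ^ n.+1).
  by apply: (cov_sub (fun _ h => h) _ (cov_set _)); rewrite -hI -cardsT -card_powerset; apply: subset_leq_card; apply/subsetP => Z _; rewrite inE subsetT.
have [h4|h4] := leqP 4 #|I|; last first.
  apply: (cov_sub (R' := fun _ => False)) (leq0n _) _; last by exists [::].
  by move=> M [hM []]; apply: semi3; rewrite ?cardsT //; lia.
apply: (cov_dep cov_A (Q := fun X => has_leaf X)).
  move=> X; rewrite inE => /andP[X1 Xn]; have hI' : #|I| = ((n.+1 - #|X|) + #|X|)%N by rewrite hI; lia.
  have hk : 1 < n.+1 - #|X| < n by lia.
  apply: (cov_sub (fun _ h => h) _ (cov_block (ltnW X1) hI' (hW _ hk))).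
  move: hk; set m := #|X|; set k := n.+1 - m => /andP[k1 kn]; have e : n.+1 = m + k by rewrite /k; lia.
  have -> : 3 ^ m * 2 ^ (2 ^ m - 2) * (9 * L k) = 3 ^ (n + 3) * 2 ^ ((2 ^ m - 2) + (2 ^ k + 1)).
    have -> : n + 3 = m + k + 2 by lia.
    rewrite /L !expnD; move: (3 ^ m) (3 ^ k) (2 ^ (2 ^ m - 2)) (2 ^ 2 ^ k) => a b c' d; lia.
  rewrite leq_mul2l leq_exp2l //; apply/orP; right.
  have := pow_sum X1 k1; rewrite -/m -e; have -> : n.+1 - 2 = n.-1 by lia.
  have : 2 ^ 2 <= 2 ^ m by rewrite leq_exp2l.
  move: (2 ^ m) (2 ^ k) (2 ^ n.-1) => a b d; lia.
move=> M hM; have [X [Y [X2 Y2 dXY LX LY]]] := nonsemi_leaves h4 hM.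
have := disj_card dXY; rewrite hI => c5.
by exists X; rewrite inE X2; split=> //; lia.
Qed.

(** It fails at 5, since 6^8 > 2^16; this is why n = 5 needs the explicit recursion. From one n to
    the next the left side grows by 6 while the right side is squared. *)
Lemma six_pow n : 6 <= n -> 6 ^ (n + 3) <= 2 ^ (2 ^ n.-1).
Proof.
elim: n => // n IH; rewrite leq_eqVlt => /orP[/eqP<-|]; first by (have -> : 6.-1 = 5 by []); lia.
rewrite ltnS => hn; have := IH hn; rewrite addSn expnS /=.
have en : n = n.-1.+1 by lia.
have -> : 2 ^ (2 ^ n) = 2 ^ (2 ^ n.-1) * 2 ^ (2 ^ n.-1) by rewrite -expnD addnn -mul2n -expnS -en.
have : 2 ^ 3 <= 2 ^ (2 ^ n.-1).
  rewrite leq_exp2l //; apply: (leq_trans (_ : 3 <= 2 ^ 2)) => //; rewrite leq_exp2l //; lia.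
move: (6 ^ (n + 3)) (2 ^ (2 ^ n.-1)) => a b; nia.
Qed.

(** The induction carries [7 * L n], because [WB_NB] adds [2 * L k] and 9 is a power of 3, which
    merges with the powers in [NBn]. *)
Lemma nonsemi_bound n : 1 < n -> exists b, [/\ NB n b, b <= 7 * L n & 4 < n -> b <= 2 ^ (2 ^ n + 1)].
Proof.
have [m] := ubnP n; elim: m n => // m IH n hn n1.
have W3 : WB 3 (2 * L 3 + 3 * (18 * 288)) by apply: WB_NB NB3.
have N4 := NB4 W3; have W4 := WB_NB (isT : 0 < 4) N4; have N5 := NB5 W4 W3.
have [n6|] := leqP 6 n; last first.
  move=> n6; have : n \in [:: 2; 3; 4; 5] by rewrite !inE; lia.
  rewrite !inE => /or4P[]/eqP->.
  - by exists 0; split; [exact: NB2 | exact: leq0n | by []].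
  - by exists (3 * (18 * 288)); split; [exact: NB3 | rewrite /L; lia | by []].
  - by eexists; split; [exact: N4 | rewrite /L; lia | by []].
  by eexists; split; [exact: N5 | rewrite /L; lia | move=> _; rewrite /L; lia].
have hW k : 1 < k < n -> WB k (9 * L k).
  move=> /andP[k1 kn]; have [|b [hb b7 _]] := IH k _ k1; first by lia.
  move=> I x1 Q hI; apply: (cov_sub (fun _ h => h) _ (WB_NB (ltnW k1) hb x1 Q hI)); lia.
have X : 2 ^ n.+1 * (3 ^ (n + 3) * 2 ^ (2 ^ n.-1 + 3)) <= 2 ^ (2 ^ n + 1).
  have := six_pow n6; have -> : 6 ^ (n + 3) = 3 ^ (n + 3) * 2 ^ (n + 3) by rewrite -expnMn.
  have en : n = n.-1.+1 by lia.
  have -> : 2 ^ (2 ^ n + 1) = 2 ^ (2 ^ n.-1) * 2 ^ (2 ^ n.-1) * 2 by rewrite -expnD addnn -mul2n -expnS -en -expnSr addn1.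
  rewrite expnS !expnD; move: (3 ^ n) (2 ^ n) (2 ^ (2 ^ n.-1)) => a b d h.
  have : (a * 3 ^ 3 * (b * 2 ^ 3)) * (2 * d) <= d * (2 * d) by rewrite leq_mul2r h orbT.
  by lia.
exists (2 ^ n.+1 * (3 ^ (n + 3) * 2 ^ (2 ^ n.-1 + 3))); split; [exact: NBn | | by []].
apply: leq_trans X _; rewrite /L mulnA; apply: leq_pmull; by rewrite muln_gt0 expn_gt0.
Qed.

(** * From quasigroups to codes, and the final count *)

Definition sg (v : V) : 'I_4 := inord (vi v).
Definition gs (i : 'I_4) : V := nth zr vs i.
Lemma sgK : cancel sg gs.
Proof. by move=> v; rewrite /gs /sg inordK ?vi_lt // nth_vs. Qed.
Lemma gsK : cancel gs sg.
Proof. by case=> [[|[|[|[|]]]]] // ?; apply: val_inj; rewrite /sg /gs /= inordK. Qed.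

Section Codes.
Variable n : nat.
Notation pt := {ffun option 'I_n -> V}.
Notation tuples := {ffun 'I_n -> 'I_4}.
Definition args (x : pt) : tuples := [ffun i => sg (x (Some i))].
Definition graph (q : {ffun tuples -> 'I_4}) : code (option 'I_n) := [ffun x => q (args x) == sg (x None)].

Lemma graph_inj : injective graph.
Proof.
move=> q q' e; apply/ffunP => c.
pose x : pt := [ffun o => if o is Some i then gs (c i) else gs (q c)].
have ax : args x = c by apply/ffunP => i; rewrite !ffunE gsK.
have := congr1 (fun f : code _ => f x) e; rewrite !ffunE ax gsK eqxx.
by move=> /esym/eqP.
Qed.

Lemma args_None (x : pt) a : args (upd x None a) = args x.
Proof. by apply/ffunP => i; rewrite !ffunE. Qed.

Lemma graph_mds q : is_quasigroup q -> mds (graph q).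
Proof.
move=> /forallP hq; have inj (x : pt) i : injective (fun a => q (args (upd x (Some i) a))).
  move=> a b e; apply/eqP/negPn/negP => ne.
  have /forallP/(_ (args (upd x (Some i) b)))/implyP := hq (args (upd x (Some i) a)).
  rewrite e eqxx; move=> h; suff : false by []. apply: h.
  rewrite /hamming (_ : [set _ | _] = [set i]) ?cards1 //; apply/setP => j; rewrite !inE !ffunE.
  have [->|ji] := eqVneq j i; first by rewrite eqxx (can_eq sgK) ne.
  by rewrite (inj_eq (@Some_inj _)) (negbTE ji) eqxx.
split=> [x [i|]|x [i|] a b].
- have gi : injective (fun a => gs (q (args (upd x (Some i) a)))) by move=> a b /(can_inj gsK)/inj.
  exists (invF gi (x None)); have /= e := f_invF gi (x None).
  by rewrite ffunE [upd _ _ _ None]updE /= -[in sg _]e gsK.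
- by exists (gs (q (args x))); rewrite ffunE args_None updE eqxx gsK.
- rewrite !ffunE /= => /eqP e1 /eqP e2; apply: (inj x i); rewrite e1 e2 //.
by rewrite !ffunE !args_None eqxx => /eqP e1 /eqP e2; apply: (can_inj sgK); rewrite -e1 -e2.
Qed.
End Codes.

Theorem mainTheorem2 (n : nat) (hn : 5 <= n) :
  Q n <= (3 ^ n.+1 + 1) * 2 ^ (2 ^ n + 1).
Proof.
have [|b [hb _ b1]] := @nonsemi_bound n; first by apply: leq_trans hn.
have n0 : 0 < n by apply: leq_trans hn.
pose I : finType := option 'I_n; have hI : #|I| = n.+1 by rewrite card_option card_ord.
have C Q0 := cov_rooted (None : I) Q0 n0 hI.
have [r hr cr] : cov (fun M : code I => mds M) (L n + L n + L n + b).
  apply: (cov_or (cov_or (cov_or (C None) (C (Some true)) (fun x h => h)) (C (Some false)) (fun x h => h)) (hb I hI)).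
  move=> M hM; have [h|h] := classic (semi M setT (c0 I)); last by right.
  by left; have [[[]|] hQ] := semi_rooted (None : I) h; [left; right | right | left; left].
have -> : (3 ^ n.+1 + 1) * 2 ^ (2 ^ n + 1) = L n + L n + L n + 2 ^ (2 ^ n + 1).
  rewrite /L expnS; move: (3 ^ n) (2 ^ _) => a d; lia.
apply: leq_trans (leq_trans hr _); last by rewrite leq_add2l b1.
rewrite /Q -(card_imset _ (@graph_inj n)); apply: leq_trans (card_size r).
apply: subset_leq_card; apply/subsetP => M /imsetP[q]; rewrite inE => hq ->.
exact/cr/graph_mds.
Qed.
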